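(* Let $(W,S)$ be a finite Coxeter group of rank $n=|S|$ which is either of type $B_n$ ($n\ge 2$) or of one of the exceptional types $E_6,E_7,E_8,F_4,H_3,H_4$, $I_2(m)$ ($m\ge 2$). Then the contingency metamatrix $M(W)=(M_{pq})_{0\le p,q\le n}$, where $$M_{pq}=\sum_{I,J\subset S,\ |I|=p,\ |J|=q}\bigl|W_I\backslash W/W_J\bigr|,$$ is totally positive.
   Context: For $I\subset S$, $W_I$ denotes the (standard) parabolic subgroup of $W$ generated by $I$, and $W_I\backslash W/W_J$ is the set of double cosets $W_I w W_J$, $w\in W$. A real matrix is totally positive if every minor (determinant of a square submatrix) is strictly positive. *)

(* Defs.v *)
From mathcomp Require Import all_boot all_order all_algebra all_fingroup.

Set Implicit Arguments.
Unset Strict Implicit.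
Unset Printing Implicit Defensive.

Import Order.TTheory GRing.Theory Num.Theory.
Local Open Scope group_scope.

(* Bourbaki's definition: S generates W, consists of elements of order 2, and
   the relations (s t)^m(s,t) = 1, with m(s,t) the order of s t, present W.
   The presentation is the universal property with respect to all groups,
   finite or not; the case s = t is the relation s^2 = 1. *)
Definition coxeter_system (W : finGroupType) (S : {set W}) : Prop :=
  [/\ <<S>> = [set: W],
      {in S, forall s, #[s] = 2}
    & forall (H : groupType) (f : W -> H),
        {in S &, forall s t, (f s * f t) ^+ #[s * t] = 1} ->
        exists2 phi : W -> H, {morph phi : x y / x * y} & {in S, phi =1 f}].

Definition has_coxeter_matrix (W : finGroupType) (S : {set W})
    (n : nat) (m : 'M[nat]_n) : Prop :=
  exists s : 'I_n -> W,
    [/\ injective s, s @: setT = S & forall i j, #[s i * s j] = m i j].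

(* A Coxeter diagram on the vertices 0, ..., n-1 is given by its list of edges
   (i, j, label); distinct vertices that are not joined have label 2. *)
Definition diagram_matrix (n : nat) (E : seq (nat * nat * nat)) : 'M[nat]_n :=
  \matrix_(i, j)
    if i == j then 1%N else
    head 2 [seq e.2 | e <- E & (e.1 == (val i, val j)) || (e.1 == (val j, val i))].

Definition type_B (n : nat) : 'M[nat]_n :=
  diagram_matrix n
    (rcons [seq (i, i.+1, 3) | i <- iota 0 (n - 2)] (n - 2, n - 1, 4)%N).

(* Bourbaki's labelling, shifted to start at 0: the chain 0-2-3-4-5-6-7 with
   the vertex 1 attached to 3. *)
Definition type_E6 : 'M[nat]_6 :=
  diagram_matrix 6 [:: (0, 2, 3); (2, 3, 3); (3, 4, 3); (4, 5, 3); (1, 3, 3)]%N.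

Definition type_E7 : 'M[nat]_7 :=
  diagram_matrix 7
    [:: (0, 2, 3); (2, 3, 3); (3, 4, 3); (4, 5, 3); (5, 6, 3); (1, 3, 3)]%N.

Definition type_E8 : 'M[nat]_8 :=
  diagram_matrix 8
    [:: (0, 2, 3); (2, 3, 3); (3, 4, 3); (4, 5, 3); (5, 6, 3); (6, 7, 3);
        (1, 3, 3)]%N.

Definition type_F4 : 'M[nat]_4 :=
  diagram_matrix 4 [:: (0, 1, 3); (1, 2, 4); (2, 3, 3)]%N.

Definition type_H3 : 'M[nat]_3 :=
  diagram_matrix 3 [:: (0, 1, 5); (1, 2, 3)]%N.

Definition type_H4 : 'M[nat]_4 :=
  diagram_matrix 4 [:: (0, 1, 5); (1, 2, 3); (2, 3, 3)]%N.

Definition type_I2 (m : nat) : 'M[nat]_2 := diagram_matrix 2 [:: (0, 1, m)]%N.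

Definition double_cosets (W : finGroupType) (I J : {set W}) : {set {set W}} :=
  [set <<I>> * [set w] * <<J>> | w in [set: W]].

Definition contingency_metamatrix (R : realFieldType) (W : finGroupType)
    (S : {set W}) : 'M[R]_(#|S|.+1) :=
  (\matrix_(p, q)
    (\sum_(I : {set W} | (I \subset S) && (#|I| == p))
     \sum_(J : {set W} | (J \subset S) && (#|J| == q))
       #|double_cosets I J|)%N%:R)%R.

Definition totally_positive (R : realFieldType) (m n : nat)
    (A : 'M[R]_(m, n)) : Prop :=
  forall (k : nat) (f : 'I_k -> 'I_m) (g : 'I_k -> 'I_n),
    {homo f : i j / (i < j)%N} -> {homo g : i j / (i < j)%N} ->
    (0 < \det (mxsub f g A))%R.

(* Main.v *)
From Stdlib Require Import ZArith QArith.
Require Import Defs.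
From HB Require Import structures.
From mathcomp Require Import all_boot all_order all_algebra all_fingroup cyclic.
From mathcomp Require Import zify ssrZ ring lra.

(* In a reflection representation of W over the integers, the double cosets
   W_K \ W / W_J correspond to those vectors in the orbit of a dominant vector
   with stabiliser W_K that are dominant for J.

   Type B: write a dominant lattice vector of the box of size a, where
   2a + 1 = (2k + 1)(2l + 1), with balanced digits in base 2k + 1. Counting both
   sides shows that the binomial transform of the metamatrix (with reversed
   indices) at (k, l) is the binomial coefficient C(n + a, n), which is a
   polynomial in (2k + 1)(2l + 1) with positive coefficients. Undoing the
   transform writes the metamatrix as an iterated conjugate of positive diagonal
   blocks by positive bidiagonal matrices, and Cauchy-Binet gives positivity.

   Exceptional types: the entries are evaluated by a verified computation, which
   restricts sums over double cosets to parabolic subgroups one generator at a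
   time, and positivity is certified by the same kind of bidiagonal
   factorisation. Type I_2 is a direct count. *)

Set Implicit Arguments.
Unset Strict Implicit.
Unset Printing Implicit Defensive.
Import Order.TTheory GRing.Theory Num.Theory.
Local Open Scope ring_scope.
Close Scope Q_scope.
Delimit Scope Z_scope with BZ.

(** Type B: with x = 2a + 1, the number C(n + a, n) is the product of (x + 2i - 1) / (2i) over 1 <=
    i <= n, hence the positive coefficients. In the basis of the C(k, r), multiplication by 2k + 1
    is bidiagonal: (2k + 1) C(k, r) = (2r + 1) C(k, r) + 2 (r + 1) C(k, r + 1). A polynomial in (2k
    + 1)(2l + 1) written in Horner form therefore becomes a nest of bidiagonal conjugations, one for
    each coefficient. Strict positivity needs, for every minor, one nonzero term in the Cauchy-Binet
    sum.

    Exceptional types: enumerating W is out of reach (E_8 has 696729600 elements), so only orbits of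
    fundamental weights under parabolic subgroups are enumerated, and the sum over all J with |J| =
    q is carried along as one formal combination of subsets. Large I would require the largest
    orbits; symmetry, the binomial last row and a vanishing alternating sum replace these
    computations, except for two entries of row n - 2. *)

Section TotalPositivity.

(** * Total positivity of bidiagonal conjugates *)

Variable R : realFieldType.

Definition minor (F : nat -> nat -> R) k (f g : 'I_k -> nat) : R :=
  \det (\matrix_(i < k, j < k) F (f i) (g j)).

Definition strict_incr k (f : 'I_k -> nat) := {homo f : i j / (i < j)%N}.

Definition tp_upto (N : nat) (F : nat -> nat -> R) :=
  forall k (f g : 'I_k -> nat), strict_incr f -> strict_incr g ->
    (forall i, f i < N)%N -> (forall i, g i < N)%N -> 0 < minor F f g.

Lemma eq_tp_upto N F G : (forall i j, (i < N)%N -> (j < N)%N -> F i j = G i j) ->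
  tp_upto N F -> tp_upto N G.
Proof.
move=> FG tpF k f g hf hg fN gN; suff <- : minor F f g = minor G f g by exact: tpF.
by congr (\det _); apply/matrixP=> i j; rewrite !mxE FG.
Qed.

Lemma tp_upto_mx N (F : nat -> nat -> R) (A : 'M[R]_N) :
  (forall i j, A i j = F i j) -> tp_upto N F -> totally_positive A.
Proof.
move=> AF tpF k f g hf hg.
suff -> : mxsub f g A = \matrix_(i < k, j < k) F (f i) (g j) by apply: tpF.
by apply/matrixP=> i j; rewrite !mxE AF.
Qed.

(** The order-reversing permutation acts on the rows and on the columns, so its sign occurs twice
    and cancels. *)
Lemma minor_rev N (F : nat -> nat -> R) k (f g : 'I_k -> nat) :
  minor (fun i j => F (N - i)%N (N - j)%N) f g =
  minor F (fun i => N - f (rev_ord i))%N (fun i => N - g (rev_ord i))%N.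
Proof.
pose p : 'S_k := perm (@rev_ord_inj k).
rewrite /minor; set A := (X in \det X = _); set B := (X in _ = \det X).
have -> : A = row_perm p (col_perm p B).
  by apply/matrixP=> i j; rewrite !mxE !permE !rev_ordK.
rewrite row_permE col_permE !det_mulmx !det_perm odd_permV mulrCA.
by rewrite -signr_addb addbb mulr1.
Qed.

(** Lets the factorisation start at the corner |I| = |J| = n of the metamatrix: it is the reversed
    matrix that is peeled. *)
Lemma tp_upto_rev N F :
  tp_upto N.+1 (fun i j => F (N - i)%N (N - j)%N) -> tp_upto N.+1 F.
Proof.
move=> tpF k f g hf hg fN gN.
have rev_incr h : strict_incr h -> (forall i, h i < N.+1)%N ->
    strict_incr (fun i : 'I_k => N - h (rev_ord i))%N.
  move=> hh hN i j ij; have lt : (rev_ord j < rev_ord i)%N by rewrite /=; have := ltn_ord j; lia.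
  by have := hh _ _ lt; have := hN (rev_ord i); lia.
have := tpF k _ _ (rev_incr f hf fN) (rev_incr g hg gN).
rewrite minor_rev => H.
suff -> : minor F f g = minor F (fun i => N - (N - f (rev_ord (rev_ord i))))%N
   (fun i => N - (N - g (rev_ord (rev_ord i))))%N.
  by apply: H => i; lia.
congr (\det _); apply/matrixP=> i j; rewrite !mxE !rev_ordK.
by congr (F _ _); have := fN i; have := gN j; lia.
Qed.

(** Multilinearity in the rows: each row is a sum of two terms, and [e] records which term is
    chosen. *)
Lemma det_sum_rows k (c : 'I_k -> bool -> R) (F : 'I_k -> bool -> 'I_k -> R) :
  \det (\matrix_(i, j) \sum_(e : bool) c i e * F i e j) =
  \sum_(e : {ffun 'I_k -> bool}) (\prod_i c i (e i)) *
     \det (\matrix_(i, j) F i (e i) j).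
Proof.
rewrite /determinant; under [RHS]eq_bigr do rewrite big_distrr /=.
rewrite exchange_big /=; apply: eq_bigr => p _.
under eq_bigr do rewrite mxE.
rewrite bigA_distr_bigA big_distrr /=; apply: eq_bigr => e _.
rewrite big_split /= mulrCA; congr (_ * (_ * _)).
by apply: eq_bigr => i _; rewrite mxE.
Qed.

Lemma minor_tr F k (f g : 'I_k -> nat) :
  minor (fun i j => F j i) f g = minor F g f.
Proof. by rewrite /minor -det_tr; congr (\det _); apply/matrixP=> i j; rewrite !mxE. Qed.

Definition bidiag_row (a b : nat -> R) (F : nat -> nat -> R) i j :=
  a i * F i j + b i * F i.+1 j.

Definition bump_by k (f : 'I_k -> nat) (e : {ffun 'I_k -> bool}) i := (f i + e i)%N.

(** Cauchy-Binet for an upper bidiagonal left factor: row [f i] of the product only involves rows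
    [f i] and [f i + 1], so the intermediate index sequences are the bumps of [f]. *)
Lemma minor_bidiag_row a b F k (f g : 'I_k -> nat) :
  minor (bidiag_row a b F) f g =
  \sum_(e : {ffun 'I_k -> bool})
    (\prod_i (if e i then b (f i) else a (f i))) * minor F (bump_by f e) g.
Proof.
rewrite /minor; have -> : \matrix_(i < k, j < k) bidiag_row a b F (f i) (g j) =
  \matrix_(i, j) \sum_(e : bool) (if e then b (f i) else a (f i)) * F (f i + e)%N (g j).
  apply/matrixP=> i j; rewrite !mxE (bigD1 true) //= (bigD1 false) //= big_pred0.
    by rewrite addr0 addn1 addn0 addrC.
  by case.
exact: (det_sum_rows (fun i (e : bool) => if e then b (f i) else a (f i))
          (fun i (e : bool) j => F (f i + e)%N (g j))).
Qed.

Definition block_extend (d : R) (G : nat -> nat -> R) (i j : nat) : R :=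
  match i, j with 0, 0 => d | i'.+1, j'.+1 => G i' j' | _, _ => 0 end.

Definition weak_incr k (f : 'I_k -> nat) := {homo f : i j / (i <= j)%N}.

(** A bump adds at most 1, so two values may meet but never cross; Cauchy-Binet thus produces weakly
    increasing index sequences only. *)
Lemma bump_weak k (f : 'I_k -> nat) e : strict_incr f -> weak_incr (bump_by f e).
Proof.
move=> hf i j; rewrite leq_eqVlt => /orP[/eqP/val_inj -> //|ij].
by have := hf _ _ ij; rewrite /bump_by; case: (e i); case: (e j) => /=; lia.
Qed.

Section BlockExtend.
Variables (N : nat) (d : R) (G : nat -> nat -> R).
Hypotheses (d_gt0 : 0 < d) (tpG : tp_upto N G).
Let Y := block_extend d G.

(** If both sequences contain the index 0, the entry [d] splits off; if neither does, the minor is a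
    minor of [G]. *)
Lemma minor_block_pos k (f g : 'I_k -> nat) :
  strict_incr f -> strict_incr g -> (forall i, f i < N.+1)%N -> (forall i, g i < N.+1)%N ->
  (forall i, (f i == 0)%N = (g i == 0)%N) -> 0 < minor Y f g.
Proof.
case: k f g => [|k] f g hf hg fN gN fg0; first by rewrite /minor det_mx00.
case f0 : (f ord0 == 0)%N; last first.
  have fpos i : (0 < f i)%N.
    rewrite lt0n; apply/negP=> /eqP fi0.
    case: (posnP i) => [i0|ipos]; last by have := hf ord0 i ipos; rewrite fi0.
    have e : i = ord0 by apply: val_inj.
    by rewrite -e fi0 in f0.
  have gpos i : (0 < g i)%N by rewrite lt0n -fg0 -lt0n.
  have := tpG (k := k.+1) (f := fun i => (f i).-1) (g := fun i => (g i).-1).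
  suff -> : minor Y f g = minor G (fun i => (f i).-1) (fun i => (g i).-1).
    apply=> [i j ij|i j ij|i|i].
    - by have := hf _ _ ij; have := fpos i; lia.
    - by have := hg _ _ ij; have := gpos i; lia.
    - by have := fN i; have := fpos i; lia.
    - by have := gN i; have := gpos i; lia.
  congr (\det _); apply/matrixP=> i j; rewrite !mxE /Y /block_extend.
  by case: (f i) (fpos i) => // ?; case: (g j) (gpos j).
have g0 : (g ord0 == 0)%N by rewrite -fg0.
rewrite /minor (expand_det_row _ ord0) (bigD1 ord0) //= big1 ?addr0; last first.
  move=> j jn0; rewrite !mxE (eqP f0) /=.
  have jpos : (0 < j)%N by rewrite lt0n.
  by have := hg ord0 j jpos; case: (g j) => //=; rewrite mul0r.
rewrite mxE (eqP f0) (eqP g0) /= pmulr_rgt0 //.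
rewrite /cofactor /= expr0 mul1r.
have lf (h : 'I_k.+1 -> nat) : strict_incr h -> forall i, (0 < h (lift ord0 i))%N.
  by move=> hh i; have := hh ord0 (lift ord0 i) isT; case: (h (lift _ _)).
suff -> : \det (row' ord0 (col' ord0 (\matrix_(i < k.+1, j < k.+1) Y (f i) (g j)))) =
   minor G (fun i => (f (lift ord0 i)).-1) (fun i => (g (lift ord0 i)).-1).
  have li (i j : 'I_k) : (i < j)%N -> (lift ord0 i < lift ord0 j)%N.
    by rewrite /= /bump /=; lia.
  apply: tpG => [i j ij|i j ij|i|i].
  - by have := hf _ _ (li _ _ ij); have := lf f hf i; lia.
  - by have := hg _ _ (li _ _ ij); have := lf g hg i; lia.
  - by have := fN (lift ord0 i); have := lf f hf i; lia.
  - by have := gN (lift ord0 i); have := lf g hg i; lia.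
congr (\det _); apply/matrixP=> i j; rewrite !mxE /Y /block_extend.
by have := lf f hf i; have := lf g hg j; case: (f _) => // ?; case: (g _).
Qed.

(** A minor outside the scope of [minor_block_pos] vanishes: either an index is repeated, or the
    index 0 occurs on one side only. *)
Lemma minor_block_ge0 k (f g : 'I_k -> nat) :
  weak_incr f -> weak_incr g -> (forall i, f i < N.+1)%N -> (forall i, g i < N.+1)%N ->
  0 <= minor Y f g.
Proof.
move=> hf hg fN gN.
have strictP (h : 'I_k -> nat) : weak_incr h ->
    strict_incr h \/ exists i j, i != j /\ h i = h j.
  move=> hh; case: (boolP [exists i, [exists j, (i != j) && (h i == h j)]]).
    by case/existsP=> i /existsP[j /andP[ij /eqP hij]]; right; exists i, j.
  move=> ne; left=> i j ij; rewrite ltn_neqAle hh ?(ltnW ij) // andbT.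
  apply: contra ne => hij; apply/existsP; exists i; apply/existsP; exists j.
  by rewrite hij andbT neq_ltn ij.
case: (strictP f hf) => [sf|[i [j [ij fij]]]]; last first.
  by rewrite /minor (determinant_alternate ij) // => l; rewrite !mxE fij.
case: (strictP g hg) => [sg|[i [j [ij gij]]]]; last first.
  rewrite -minor_tr /minor (determinant_alternate ij) // => l.
  by rewrite !mxE gij.
case: (boolP [forall i, (f i == 0)%N == (g i == 0)%N]) => [/forallP fg0|].
  by apply/ltW/minor_block_pos => // i; exact: (eqP (fg0 i)).
(* [h i = 0] makes i the first position, and [l] is positive from there on, so row i consists of
   zeros. *)
have row0 (F : nat -> nat -> R) (h l : 'I_k -> nat) i :
    (forall j, F 0 j.+1 = 0) -> strict_incr h -> weak_incr l ->
    h i = 0%N -> (0 < l i)%N -> minor F h l = 0.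
  move=> F0 sh hl hi li; rewrite /minor (expand_det_row _ i) big1 // => j _.
  rewrite mxE hi; case: (ltnP j i) => [/sh|/hl]; first by rewrite hi.
  by case: (l j) => [|lj _]; rewrite ?F0 ?mul0r //; lia.
rewrite negb_forall => /existsP[i].
case: (posnP (f i)) => fi; case: (posnP (g i)) => gi; rewrite ?fi ?gi ?eqxx //.
- by rewrite (row0 _ _ _ i).
- by rewrite -minor_tr (row0 _ _ _ i).
Qed.

End BlockExtend.

(** $A F A^T$ for the upper bidiagonal $A$ with diagonal [a] and superdiagonal [b]. *)
Definition bidiag_conj (a b : nat -> R) (F : nat -> nat -> R) i j :=
  bidiag_row a b (fun i' j' => bidiag_row a b (fun x y => F y x) j' i') i j.

Lemma minor_bidiag_conj a b F k (f g : 'I_k -> nat) :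
  minor (bidiag_conj a b F) f g =
  \sum_(e : {ffun 'I_k -> bool}) \sum_(e' : {ffun 'I_k -> bool})
    (\prod_i (if e i then b (f i) else a (f i))) *
    (\prod_i (if e' i then b (g i) else a (g i))) *
    minor F (bump_by f e) (bump_by g e').
Proof.
rewrite (minor_bidiag_row a b (fun i' j' => bidiag_row a b (fun x y => F y x) j' i')).
apply: eq_bigr => e _; rewrite minor_tr.
rewrite (minor_bidiag_row a b (fun x y => F y x)) big_distrr /=.
by apply: eq_bigr => e' _; rewrite minor_tr mulrA.
Qed.

Lemma strict_incr_ge k (h : 'I_k -> nat) : strict_incr h -> forall i : 'I_k, (i <= h i)%N.
Proof.
move=> hh [i ik]; elim: i ik => // i IH ik.
have ik' : (i < k)%N by apply: ltnW.
apply: leq_ltn_trans (IH ik') _; exact: (hh (Ordinal ik') (Ordinal ik) (ltnSn i)).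
Qed.

Lemma strict_incr_gt k (h : 'I_k -> nat) : strict_incr h ->
  (forall i, 0 < h i)%N -> forall i : 'I_k, (i < h i)%N.
Proof.
move=> hh h0 [i ik]; elim: i ik => [|i IH] ik; first exact: h0.
have ik' : (i < k)%N by apply: ltnW.
apply: leq_ltn_trans (IH ik') _; exact: (hh (Ordinal ik') (Ordinal ik) (ltnSn i)).
Qed.

Lemma bump_eq_lt (a b i j : nat) :
  (a < b -> i <= a -> j <= b -> i < j -> a + (a == i) < b + (b == j))%N.
Proof. by case: (a =P i); case: (b =P j) => /=; lia. Qed.

(* The minors of the conjugate expand as nonnegative combinations of minors of
   the block sum; the bumps below select one that is positive. *)
Lemma tp_bidiag_conj N d G a b :
  0 < d -> tp_upto N G -> (forall i, (i <= N)%N -> 0 < a i) ->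
  (forall i, (i < N)%N -> 0 < b i) -> b N = 0 ->
  tp_upto N.+1 (bidiag_conj a b (block_extend d G)).
Proof.
move=> d0 tpG a0 b0 bN k f g hf hg fN gN; rewrite minor_bidiag_conj.
pose c (h : 'I_k -> nat) (e : {ffun 'I_k -> bool}) :=
  \prod_i (if e i then b (h i) else a (h i)).
have b_ge0 i : (i <= N)%N -> 0 <= b i.
  by rewrite leq_eqVlt => /orP[/eqP ->|/b0/ltW//]; rewrite bN.
have c_ge0 h e : (forall i, h i < N.+1)%N -> 0 <= c h e.
  by move=> hN; apply: prodr_ge0 => i _; case: (e i); [apply: b_ge0|apply/ltW/a0]; apply: hN.
have c_eq0 h (e : {ffun 'I_k -> bool}) i : h i = N -> e i -> c h e = 0.
  by move=> hi ei; rewrite /c (bigD1 i) //= ei hi bN mul0r.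
have term_ge0 e e' : 0 <= c f e * c g e' *
    minor (block_extend d G) (bump_by f e) (bump_by g e').
  (* [b N = 0] removes every term in which the last index N is bumped, so the surviving index
     sequences stay in range. *)
  have bN' h (e0 : {ffun 'I_k -> bool}) : (forall i, h i < N.+1)%N ->
      c h e0 = 0 \/ forall i, (bump_by h e0 i < N.+1)%N.
    move=> hN; case: (boolP [exists i, (h i == N) && e0 i]).
      by case/existsP=> i /andP[/eqP hi ei]; left; apply: c_eq0 hi ei.
    rewrite negb_exists => /forallP H; right=> i; have := H i; have := hN i.
    by rewrite /bump_by; case: (e0 i) => /=; lia.
  case: (bN' f e fN) => [->|fe]; first by rewrite !mul0r.
  case: (bN' g e' gN) => [->|ge]; first by rewrite mulr0 mul0r.
  rewrite !mulr_ge0 ?c_ge0 //.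
  by apply: (minor_block_ge0 d0 tpG) => //; apply: bump_weak.
suff [e [e' pos]] : exists e e', 0 < c f e * c g e' *
    minor (block_extend d G) (bump_by f e) (bump_by g e').
  rewrite (bigD1 e) //= (bigD1 e') //= -addrA ltr_wpDr //.
  rewrite addr_ge0 ?sumr_ge0 // => [x _|x _]; first exact: term_ge0.
  by rewrite sumr_ge0 // => y _; apply: term_ge0.
pose z : {ffun 'I_k -> bool} := [ffun=> false].
(* For the case where [h] contains 0 and the other sequence [l] does not. Bumping the initial run
   where [h i = i] moves [h] off 0 and keeps it strictly increasing; [b i] is positive there because
   i < l i <= N. *)
pose sh (h : 'I_k -> nat) : {ffun 'I_k -> bool} := [ffun i => h i == i].
have c_z h : (forall i, h i < N.+1)%N -> 0 < c h z.
  by move=> hN; apply: prodr_gt0 => i _; rewrite ffunE a0 //; apply: hN.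
have bz h i : bump_by h z i = h i by rewrite /bump_by ffunE addn0.
have low (h l : 'I_k -> nat) i0 : strict_incr h -> strict_incr l ->
    (forall i, h i < N.+1)%N -> (forall i, l i < N.+1)%N ->
    h i0 = 0%N -> (0 < l i0)%N ->
    [/\ 0 < c h (sh h), strict_incr (bump_by h (sh h)),
        forall i, (bump_by h (sh h) i < N.+1)%N,
        forall i, (0 < bump_by h (sh h) i)%N & forall i, (0 < l i)%N].
  move=> hh hl hN lN hi0 li0.
  have i00 : (i0 : nat) = 0%N by apply/eqP; rewrite -leqn0 -hi0 strict_incr_ge.
  have lpos i : (0 < l i)%N.
    case: (eqVneq i i0) => [->//|ii0]; suff /hl : (i0 < i)%N by apply: leq_ltn_trans.
    by rewrite i00 lt0n; apply: contra ii0 => /eqP ?; apply/eqP/val_inj; rewrite /= i00.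
  have l_gt := strict_incr_gt hl lpos.
  have ltN (i : 'I_k) : (i < N)%N by apply: leq_trans (l_gt i) _; rewrite -ltnS.
  split=> //.
  - apply: prodr_gt0 => i _; rewrite ffunE; case: eqP => [->|_]; first exact: b0.
    by rewrite a0 //; apply: hN.
  - by move=> i j ij; rewrite /bump_by !ffunE bump_eq_lt ?strict_incr_ge ?hh.
  - move=> i; rewrite /bump_by !ffunE; case: eqP => [->|_]; first by rewrite addn1 ltnS.
    by rewrite addn0.
  - move=> i; rewrite /bump_by !ffunE; case: eqP => [->|]; first by rewrite addn1.
    have := strict_incr_ge hh i; clear; case: (h i) => [|//]; rewrite leqn0 => /eqP ->.
    by move=> /(_ erefl).
case: (boolP [forall i, (f i == 0)%N == (g i == 0)%N]) => [/forallP fg0|].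
  exists z, z; rewrite !mulr_gt0 ?c_z //.
  apply: (minor_block_pos d0 tpG) => [i j|i j|i|i|i]; rewrite !bz; auto.
  exact: (eqP (fg0 i)).
rewrite negb_forall => /existsP[i].
case: (posnP (f i)) => fi; case: (posnP (g i)) => gi; rewrite ?fi ?gi ?eqxx //.
- case: (low f g i hf hg fN gN fi gi) => cf sf bf pf pg.
  exists (sh f), z; rewrite !mulr_gt0 ?c_z //.
  apply: (minor_block_pos d0 tpG) => [//|x y|//|x|x]; rewrite ?bz; auto.
  by rewrite !eqn0Ngt pf pg.
- case: (low g f i hg hf gN fN gi fi) => cg sg bg pg pf.
  exists z, (sh g); rewrite !mulr_gt0 ?c_z //.
  apply: (minor_block_pos d0 tpG) => [x y|//|x|//|x]; rewrite ?bz; auto.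
  by rewrite !eqn0Ngt pf pg.
Qed.

Lemma tp_upto0 F : tp_upto 0 F.
Proof.
move=> [|k] f g _ _ fN _; first by rewrite /minor det_mx00.
by have := fN ord0.
Qed.
End TotalPositivity.

(** The alternating word of length r that ends in [j]. Its last letter stays fixed when letters are
    added on the left ([altwSl]), while the recursion exhibits the right end, where a further
    generator is multiplied. *)
Fixpoint altw (T : Type) (i j : T) r : seq T :=
  if r is r'.+1 then rcons (altw j i r') j else [::].

Lemma size_altw T (i j : T) r : size (altw i j r) = r.
Proof. by elim: r i j => //= r IH i j; rewrite size_rcons IH. Qed.

Lemma altwSl T (i j : T) r :
  altw i j r.+1 = (if odd r then i else j) :: altw i j r.
Proof.
elim: r i j => // r IH i j; rewrite [LHS]/= -/(altw j i r.+1) IH rcons_cons /=.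
by case: (odd r).
Qed.

Lemma all_altw T (p : pred T) i j r : p i -> p j -> all p (altw i j r).
Proof. by elim: r i j => //= r IH i j pi pj; rewrite all_rcons pj IH. Qed.

(** * Reflection representations: lengths, positivity of roots, dominant vectors *)

Section Reflection.
Variables (W : finGroupType) (n N : nat) (s : 'I_n -> W) (blk : 'I_N -> 'I_n).
Variable rho : W -> 'M[Z]_N.

Definition wprod (t : seq 'I_n) : W := (\prod_(i <- t) s i)%g.

(* W acts on row vectors by v |-> v *m rho x. The coordinates with blk a = i
   are the pairings with the simple root of s i (several coordinates when the
   scalars are a ring of rank > 1 over Z), so that the columns of rho x are the
   images of the simple roots. *)
Record reflection_rep : Prop := ReflectionRep {
  rr_gen : <<[set s i | i in setT]>>%g = [set: W];
  rr_inv : forall i, (s i * s i)%g = 1%g;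
  rr_one : rho 1%g = 1%:M;
  rr_mul : forall x y, rho (x * y)%g = rho x *m rho y;
  rr_row : forall i b c, blk b != i -> rho (s i) b c = (b == c)%:R;
  rr_col : forall i b a, blk a = i -> rho (s i) b a = - (b == a)%:R;
  rr_sgn : exists2 sg : W -> bool,
    forall x y, sg (x * y)%g = sg x (+) sg y & forall i, sg (s i);
  rr_alt : forall i j, i != j -> exists m : nat,
    [/\ (0 < m)%N, wprod (altw i j m) = wprod (altw j i m) &
        forall r, (r < m)%N -> forall a b, blk a = i ->
          0 <= rho (wprod (altw i j r)) b a]
}.

Hypothesis rr : reflection_rep.

Definition par (J : {set 'I_n}) : {group W} := <<[set s i | i in J]>>%G.

Lemma wprod_cat t u : wprod (t ++ u) = (wprod t * wprod u)%g.
Proof. by rewrite /wprod big_cat. Qed.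

Lemma wprod_rcons t i : wprod (rcons t i) = (wprod t * s i)%g.
Proof. by rewrite -cats1 wprod_cat /wprod big_seq1. Qed.

Lemma wprod_cons t i : wprod (i :: t) = (s i * wprod t)%g.
Proof. by rewrite /wprod big_cons. Qed.

Lemma wprod_nil : wprod [::] = 1%g.
Proof. by rewrite /wprod big_nil. Qed.

Lemma mem_gen_par (J : {set 'I_n}) i : i \in J -> s i \in par J.
Proof. by move=> iJ; rewrite mem_gen // imset_f. Qed.

Lemma wprod_par (J : {set 'I_n}) t : all (mem J) t -> wprod t \in par J.
Proof.
elim: t => [_|i t IH /=/andP[iJ tJ]]; first by rewrite wprod_nil group1.
by rewrite wprod_cons groupM ?mem_gen_par ?IH.
Qed.

Lemma sV i : (s i)^-1%g = s i.
Proof. by apply/eqP; rewrite eq_invg_mul (rr_inv rr). Qed.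

Lemma sK x i : (x * s i * s i)%g = x.
Proof. by rewrite -mulgA (rr_inv rr) mulg1. Qed.

Lemma par_word (J : {set 'I_n}) x : x \in par J ->
  exists2 t, all (mem J) t & wprod t = x.
Proof.
case/gen_prodgP => k [c cJ ->].
pose P (y : W) := exists2 t, all (mem J) t & wprod t = y.
apply: (big_ind P) => [|y z [t tJ <-] [u uJ <-]|i _].
- by exists [::]; rewrite ?wprod_nil.
- by exists (t ++ u); rewrite ?all_cat ?tJ ?wprod_cat.
by case/imsetP: (cJ i) => j jJ ->; exists [:: j]; rewrite /= ?jJ // wprod_cons wprod_nil mulg1.
Qed.

Lemma par_setT : par setT = [set: W] :> {set W}.
Proof. exact: (rr_gen rr). Qed.

Lemma par_sub (I J : {set 'I_n}) : I \subset J -> par I \subset par J.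
Proof. by move=> IJ; rewrite genS ?imsetS. Qed.

Definition sphere (J : {set 'I_n}) k :=
  [set x | [exists t : k.-tuple 'I_n, all (mem J) t && (wprod t == x)]].

(** The second disjunct makes the minimum exist for every x; [len J x] is 0 outside [par J]. *)
Lemma len_ex (J : {set 'I_n}) x : exists k, (x \in sphere J k) || (x \notin par J).
Proof.
have [xJ|xJ] := boolP (x \in par J); last by exists 0%N; rewrite orbT.
case: (par_word xJ) => t tJ tx; exists (size t); rewrite orbF inE.
by apply/existsP; exists (in_tuple t); rewrite /= tJ tx eqxx.
Qed.

Definition len J x := ex_minn (len_ex J x).

Lemma lenP (J : {set 'I_n}) x : x \in par J ->
  exists t, [/\ all (mem J) t, wprod t = x & size t = len J x].
Proof.
move=> xJ; rewrite /len; case: ex_minnP => k; rewrite xJ orbF inE.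
by case/existsP=> t /andP[tJ /eqP tx] _; exists t; rewrite size_tuple.
Qed.

Lemma len_le (J : {set 'I_n}) t : all (mem J) t -> (len J (wprod t) <= size t)%N.
Proof.
move=> tJ; rewrite /len; case: ex_minnP => k _; apply.
by rewrite inE; apply/orP; left; apply/existsP; exists (in_tuple t); rewrite /= tJ eqxx.
Qed.

Lemma len_mul_word (J : {set 'I_n}) x t : x \in par J -> all (mem J) t ->
  (len J (x * wprod t)%g <= len J x + size t)%N.
Proof.
move=> /lenP[u [uJ <- <-]] tJ; rewrite -wprod_cat -size_cat len_le //.
by rewrite all_cat uJ.
Qed.

Lemma par_mul_s (J : {set 'I_n}) x i : i \in J -> (x * s i \in par J)%g = (x \in par J).
Proof. by move=> iJ; rewrite groupMr ?mem_gen_par. Qed.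

Lemma len_mul_s (J : {set 'I_n}) x i : x \in par J -> i \in J ->
  (len J (x * s i)%g <= (len J x).+1)%N.
Proof.
move=> xJ iJ; have := len_mul_word xJ (t := [:: i]).
by rewrite /= iJ addn1 wprod_cons wprod_nil mulg1; apply.
Qed.

(** The sign character gives the parity of the length, so multiplication by a generator cannot
    preserve the length. *)
Lemma len_cases (J : {set 'I_n}) x i : x \in par J -> i \in J ->
  len J (x * s i)%g = (len J x).+1 \/ len J x = (len J (x * s i)%g).+1.
Proof.
move=> xJ iJ; have le1 := len_mul_s xJ iJ.
have xiJ : (x * s i)%g \in par J by rewrite par_mul_s.
have := len_mul_s xiJ iJ; rewrite sK => le2.
suff : len J (x * s i)%g != len J x by move/eqP; lia.
case: (rr_sgn rr) => sg sgM sgs; apply/eqP=> eql.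
have sg1 : sg 1%g = false by have := sgM 1%g 1%g; rewrite mulg1; case: (sg 1%g).
have sgP y : y \in par J -> odd (len J y) = sg y.
  case/lenP=> t [_ <- <-]; elim: t => [|k t IH]; first by rewrite wprod_nil sg1.
  by rewrite wprod_cons sgM sgs /= IH.
by have := sgP _ xiJ; rewrite eql sgP // sgM sgs; case: (sg x).
Qed.

Lemma descent_ex (J : {set 'I_n}) x : x \in par J -> x != 1%g ->
  exists2 j, j \in J & (len J (x * s j)%g < len J x)%N.
Proof.
move=> xJ; case: (lenP xJ) => t [tJ tx sz] xn1.
case/lastP: t tJ tx sz => [|t j] tJ tx sz; first by rewrite -tx wprod_nil eqxx in xn1.
move: tJ; rewrite all_rcons => /andP[jJ tJ]; exists j => //.
by rewrite -sz size_rcons ltnS -tx wprod_rcons sK len_le.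
Qed.

(** A generator changes only the rows of its own block: it adds multiples of its own simple root. *)
Lemma rho_row (J : {set 'I_n}) x b c : x \in par J -> blk b \notin J ->
  rho x b c = (b == c)%:R.
Proof.
move=> /par_word[t tJ <-] bJ; elim/last_ind: t tJ c => [_ c|t i IH].
  by rewrite wprod_nil (rr_one rr) mxE.
rewrite all_rcons => /andP[iJ tJ] c; rewrite wprod_rcons (rr_mul rr) mxE.
under eq_bigr do rewrite IH //.
rewrite (bigD1 b) //= eqxx mul1r big1 => [|k kb]; last by rewrite eq_sym (negbTE kb) mul0r.
by rewrite addr0 (rr_row rr) //; apply: contraNneq bJ => ->.
Qed.

(** The root x(alpha_i) is positive when x s_i is longer than x. With a descent j of x, write x = v
    w with lengths adding, w alternating in i and j, and neither s_i nor s_j a descent of v. By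
    [rr_alt], w(alpha_i) is a nonnegative combination of alpha_i and alpha_j, and the induction
    hypothesis applies to v. *)
Theorem rho_col_ge0 (J : {set 'I_n}) x i : x \in par J -> i \in J ->
  (len J x < len J (x * s i)%g)%N -> forall a b, blk a = i -> 0 <= rho x b a.
Proof.
have [k] := ubnP (len J x); elim: k x i => // k IH x i /ltnSE lex xJ iJ xi a b ai.
have [->|xn1] := eqVneq x 1%g; first by rewrite (rr_one rr) mxE; case: eqP.
have [j jJ xj] := descent_ex xJ xn1.
have ij : i != j by apply: contraTneq xi => ->; rewrite -leqNgt ltnW.
case: (rr_alt rr ij) => m [m0 braid altpos].
have [] : exists r v, [/\ (0 < r < m)%N, v \in par J, x = (v * wprod (altw i j r))%g,
    len J x = (len J v + r)%N & (len J v < len J (v * s i)%g)%N /\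
    (len J v < len J (v * s j)%g)%N].
  (* Letters are moved from v to the alternating word as long as this shortens v; the induction is
     on m - r. *)
  suff peel d r v : (m - r = d)%N -> (r < m)%N -> v \in par J ->
      x = (v * wprod (altw i j r))%g -> len J x = (len J v + r)%N ->
      exists r v, [/\ (0 < r < m)%N, v \in par J, x = (v * wprod (altw i j r))%g,
      len J x = (len J v + r)%N & (len J v < len J (v * s i)%g)%N /\
      (len J v < len J (v * s j)%g)%N].
    by apply: (peel (m - 0)%N 0%N x); rewrite ?addn0 // wprod_nil mulg1.
  elim: d r v {IH lex altpos} => [|d IHd] r v mr rm vJ xv lxv; first by lia.
  (* [c] is the letter that would come next on the left of the word, [c'] its present first
     letter. *)
  pose c := if odd r then i else j; pose c' := if odd r then j else i.
  have cJ : c \in J by rewrite /c; case: ifP.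
  have c'J : c' \in J by rewrite /c'; case: ifP.
  have alt1 : altw i j r.+1 = c :: altw i j r by rewrite altwSl.
  have alt2 : (0 < r)%N -> altw i j r = c' :: altw i j r.-1.
    by rewrite /c'; case: (r) => // r' _; rewrite altwSl /=; case: (odd r').
  have cc' : (c, c') = (i, j) \/ (c, c') = (j, i) by rewrite /c /c'; case: ifP; auto.
  have c0 : r = 0%N -> c = j by rewrite /c => ->.
  clearbody c c'.
  have [vc|vc] := ltnP (len J (v * s c)%g) (len J v).
    have vcJ : (v * s c)%g \in par J by rewrite par_mul_s.
    have xc : x = (v * s c * wprod (altw i j r.+1))%g.
      by rewrite alt1 wprod_cons mulgA sK.
    have lc : len J x = (len J (v * s c)%g + r.+1)%N.
      by move: (len_cases vJ cJ) lxv vc; clear; lia.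
    have [rm'|mr'] := ltnP r.+1 m; first by apply: (IHd r.+1 (v * s c)%g) => //; move: mr; clear; lia.
    have em : m = r.+1 by move: rm mr'; clear; lia.
    (* A word of full length m could be rewritten by the braid relation to end in i; then x s_i
       would be shorter than x. *)
    have xs : (x * s i)%g = (v * s c * wprod (altw i j r))%g.
      by rewrite xc -em braid em /= wprod_rcons mulgA sK.
    have := len_mul_word vcJ (t := altw i j r).
    by rewrite -xs size_altw all_altw // => /(_ isT); move: lc xi; clear; lia.
  have r0 : (0 < r)%N.
    rewrite lt0n; apply/eqP=> r0; move: vc; rewrite (c0 r0).
    by move: xv; rewrite r0 wprod_nil mulg1 => <-; move: xj; clear; lia.
  have vc' : (len J v < len J (v * s c')%g)%N.
    rewrite ltnNge; apply/negP=> le; have {}le : len J v = (len J (v * s c')%g).+1.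
      by move: (len_cases vJ c'J) le; clear; lia.
    have xc' : x = (v * s c' * wprod (altw i j r.-1))%g.
      by rewrite xv alt2 // wprod_cons mulgA.
    have vcJ : (v * s c')%g \in par J by rewrite par_mul_s.
    have := len_mul_word vcJ (t := altw i j r.-1).
    by rewrite -xc' size_altw all_altw // => /(_ isT); move: lxv le r0; clear; lia.
  have {}vc : (len J v < len J (v * s c)%g)%N by move: (len_cases vJ cJ) vc; clear; lia.
  exists r, v; rewrite r0 rm; split=> //.
  by case: cc' vc vc' => -[-> ->].
move=> r [v [/andP[r0 rm] vJ xv lxv [vi vj]]].
have lv : (len J v < k)%N by move: lxv lex r0; clear; lia.
rewrite xv (rr_mul rr) mxE; apply: sumr_ge0 => c _.
have aJ : wprod (altw i j r) \in par [set i; j].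
  by apply/wprod_par/all_altw; rewrite /= !inE eqxx ?orbT.
have [cij|cij] := boolP (blk c \in [set i; j]).
  apply: mulr_ge0; last exact: altpos.
  by move: cij; rewrite !inE => /orP[/eqP ci|/eqP cj]; [apply: (IH v i)|apply: (IH v j)].
rewrite (rho_row _ aJ cij); case: eqP => [ca|_]; last by rewrite mulr0.
by rewrite ca ai !inE eqxx in cij.
Qed.

Lemma rho_mul_s x i b a : blk a = i -> rho (x * s i)%g b a = - rho x b a.
Proof.
move=> ai; rewrite (rr_mul rr) mxE (bigD1 a) //= (rr_col rr) // eqxx big1 => [|c ca].
  by rewrite addr0 mulrN mulr1.
by rewrite (rr_col rr) // (negbTE ca) oppr0 mulr0.
Qed.

Lemma rho_col_le0 (J : {set 'I_n}) x i : x \in par J -> i \in J ->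
  (len J (x * s i)%g < len J x)%N -> forall a b, blk a = i -> rho x b a <= 0.
Proof.
move=> xJ iJ xi a b ai.
have xiJ : (x * s i)%g \in par J by rewrite par_mul_s.
rewrite -[x](sK x i) rho_mul_s // oppr_le0; apply: (rho_col_ge0 xiJ iJ) => //.
by rewrite sK.
Qed.

Definition dominant (J : {set 'I_n}) (v : 'rV[Z]_N) := [forall a, (blk a \in J) ==> (0 <= v 0 a)].

Lemma dominantP (J : {set 'I_n}) (v : 'rV[Z]_N) : reflect (forall a, blk a \in J -> 0 <= v 0 a) (dominant J v).
Proof. by apply: (iffP forallP) => H a; [apply/implyP|apply/implyP]; apply: H. Qed.

Definition zero_set (J : {set 'I_n}) (v : 'rV[Z]_N) :=
  [set i in J | [forall a, (blk a == i) ==> (v 0 a == 0)]].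

Lemma zero_setP (J : {set 'I_n}) (v : 'rV[Z]_N) i : reflect (i \in J /\ forall a, blk a = i -> v 0 a = 0) (i \in zero_set J v).
Proof.
rewrite inE; apply: (iffP andP) => -[iJ H]; split=> //.
  by move=> a ai; apply/eqP; have /implyP := forallP H a; apply; apply/eqP.
by apply/forallP=> a; apply/implyP=> /eqP ai; rewrite H.
Qed.

Lemma fix_zero J v i : i \in zero_set J v -> v *m rho (s i) = v.
Proof.
case/zero_setP=> _ v0; apply/rowP=> c; rewrite mxE (bigD1 c) //= big1 => [|b bc].
  have [ci|ci] := eqVneq (blk c) i; first by rewrite v0 // mul0r addr0.
  by rewrite (rr_row rr) // eqxx mulr1 addr0.
have [bi|bi] := eqVneq (blk b) i; first by rewrite v0 // mul0r.
by rewrite (rr_row rr) // (negbTE bc) mulr0.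
Qed.

Lemma fix_zeros J v x : x \in par (zero_set J v) -> v *m rho x = v.
Proof.
case/par_word=> t tJ <-; elim: t tJ => [_|i t IH /=/andP[iJ tJ]].
  by rewrite wprod_nil (rr_one rr) mulmx1.
by rewrite wprod_cons (rr_mul rr) mulmxA (fix_zero iJ) IH.
Qed.

(** The dominant chamber is a strict fundamental domain with standard parabolic stabilisers. If s_i
    is a descent of x^-1, then x^-1(alpha_i) is negative, so coordinate i of v is both >= 0 and <=
    0. Hence s_i fixes v and can be removed from x. *)
Lemma dominant_unique (J : {set 'I_n}) v x : x \in par J -> dominant J v -> dominant J (v *m rho x) ->
  v *m rho x = v /\ x \in par (zero_set J v).
Proof.
have [k] := ubnP (len J x); elim: k x => // k IH x /ltnSE lex xJ dv dvx.
have [->|xn1] := eqVneq x 1%g; first by rewrite (rr_one rr) mulmx1 group1.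
have [i iJ] : exists2 i, i \in J & (len J (x^-1 * s i)%g < len J (x^-1)%g)%N.
  by apply: descent_ex; rewrite ?groupV // invg_eq1.
move=> desc.
have iz : i \in zero_set J v.
  apply/zero_setP; split=> // a ai; apply/eqP; rewrite eq_le (dominantP _ _ dv) ?ai // andbT.
  have -> : v = v *m rho x *m rho (x^-1)%g.
    by rewrite -mulmxA -(rr_mul rr) mulgV (rr_one rr) mulmx1.
  rewrite mxE; apply: sumr_le0 => b _.
  have [bJ|bJ] := boolP (blk b \in J).
    apply: mulr_ge0_le0; first exact: (dominantP _ _ dvx).
    by apply: (rho_col_le0 _ iJ desc) => //; rewrite groupV.
  rewrite (rho_row (J := J)) ?groupV //; case: eqP => [ba|_]; last by rewrite mulr0.
  by rewrite ba ai iJ in bJ.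
have lenV y : y \in par J -> (len J (y^-1)%g <= len J y)%N.
  case/lenP=> t [tJ <- <-].
  have -> : ((wprod t)^-1)%g = wprod (rev t).
    elim: t {tJ} => [|c t IHt]; first by rewrite wprod_nil invg1.
    by rewrite rev_cons wprod_rcons wprod_cons invMg sV IHt.
  by rewrite -(size_rev t) len_le // all_rev.
pose y := (s i * x)%g.
have yJ : y \in par J by rewrite groupM ?mem_gen_par.
have vy : v *m rho y = v *m rho x by rewrite (rr_mul rr) mulmxA (fix_zero iz).
have ly : (len J y < k)%N.
  have yV : (y^-1 = x^-1 * s i)%g by rewrite invMg sV.
  have yVJ : (y^-1)%g \in par J by rewrite groupV.
  have := lenV _ yVJ; have := lenV _ xJ.
  by rewrite invgK yV; move: desc lex; clear; lia.
have [] := IH y ly yJ dv; first by rewrite vy.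
rewrite vy => -> yz; split=> //.
by rewrite -[x](mulKg (s i)) -/y groupM // groupV mem_gen_par.
Qed.

(** Choose y so that x y is shortest in its coset x W_J; no generator in J shortens it, so its
    columns over J are nonnegative. *)
Lemma dominant_ex (J : {set 'I_n}) v x : dominant setT v ->
  exists2 y, y \in par J & dominant J (v *m rho (x * y)%g).
Proof.
move=> dv.
have xT z : z \in par setT by rewrite par_setT inE.
have ex : exists k, [exists y, (y \in par J) && (len setT (x * y)%g == k)].
  by exists (len setT (x * 1)%g); apply/existsP; exists 1%g; rewrite group1 eqxx.
case: (ex_minnP ex) => k /existsP[y /andP[yJ /eqP ly]] kmin.
exists y => //; apply/dominantP=> a aJ; rewrite mxE; apply: sumr_ge0 => b _.
apply: mulr_ge0; first by apply: (dominantP _ _ dv); rewrite inE.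
apply: (rho_col_ge0 (xT _) (i := blk a)); rewrite ?inE //.
have := kmin (len setT (x * y * s (blk a))%g); rewrite ly.
have -> : [exists y0, (y0 \in par J) && (len setT (x * y0)%g == len setT (x * y * s (blk a))%g)].
  by apply/existsP; exists (y * s (blk a))%g; rewrite par_mul_s // yJ mulgA eqxx.
move=> /(_ isT) le.
by case: (len_cases (xT (x * y)%g) (in_setT (blk a))); lia.
Qed.

End Reflection.

(** * Double cosets in finite groups and Mackey's decomposition *)

Section DoubleCosets.
Local Open Scope group_scope.
Variable gT : finGroupType.
Implicit Types (G L I J : {group gT}) (x y d : gT).

Definition dcosets (G I J : {set gT}) : {set {set gT}} := [set I * [set x] * J | x in G].

Lemma dcosetP (I J : {set gT}) x y :
  reflect (exists a b, [/\ a \in I, b \in J & y = a * x * b]) (y \in I * [set x] * J).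
Proof.
apply: (iffP mulsgP) => [[z b /mulsgP[a x' aI /set1P -> ->] bJ ->]|[a [b [aI bJ ->]]]].
  by exists a, b.
by exists (a * x) b => //; apply/mulsgP; exists a x; rewrite ?set11.
Qed.

Lemma dcoset_refl I J x : x \in I * [set x] * J.
Proof. by apply/dcosetP; exists 1, 1; rewrite !group1 mul1g mulg1. Qed.

Lemma dcoset_eq I J x y : y \in I * [set x] * J -> I * [set y] * J = I * [set x] * J.
Proof.
case/dcosetP=> a [b [aI bJ ->]]; apply/setP=> z; apply/dcosetP/dcosetP.
  case=> [c [e [cI eJ ->]]]; exists (c * a), (b * e); rewrite !groupM //; split=> //.
  by rewrite !mulgA.
case=> [c [e [cI eJ ->]]]; exists (c * a^-1), (b^-1 * e).
by rewrite !groupM ?groupV //; split=> //; rewrite !mulgA mulgKV mulgK.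
Qed.

Lemma dcosets_sym G I J : #|dcosets G I J| = #|dcosets G J I|.
Proof.
suff le (I' J' : {group gT}) : (#|dcosets G I' J'| <= #|dcosets G J' I'|)%N.
  by apply/eqP; rewrite eqn_leq !le.
suff sub : dcosets G I' J' \subset [set [set z^-1 | z in D] | D : {set gT} in dcosets G J' I'].
  exact: leq_trans (subset_leq_card sub) (leq_imset_card _ _).
apply/subsetP=> D /imsetP[x xG ->]; apply/imsetP; exists (J' * [set x^-1] * I').
  by apply: imset_f; rewrite groupV.
apply/setP=> z; apply/dcosetP/imsetP => [[a [b [aI bJ ->]]]|[y /dcosetP[a [b [aJ bI ->]]] ->]].
  exists (b^-1 * x^-1 * a^-1); last by rewrite !invMg !invgK mulgA.
  by apply/dcosetP; exists b^-1, a^-1; rewrite !groupV.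
by exists b^-1, a^-1; rewrite !groupV !invMg invgK mulgA.
Qed.

(** Left multiplication by x^-1 carries the double cosets of I to those of its conjugate. *)
Lemma dcosets_conj I I' J x : I' :=: I :^ x ->
  #|dcosets [set: gT] I' J| = #|dcosets [set: gT] I J|.
Proof.
suff le (H H' : {group gT}) y : H' :=: H :^ y ->
    (#|dcosets [set: gT] H' J| <= #|dcosets [set: gT] H J|)%N.
  move=> e; apply/eqP; rewrite eqn_leq (le I I' x) //=.
  by apply: (le I' I x^-1); rewrite e conjsgK.
move=> e.
suff sub : dcosets [set: gT] H' J \subset
    [set [set y^-1 * z | z in D] | D : {set gT} in dcosets [set: gT] H J].
  exact: leq_trans (subset_leq_card sub) (leq_imset_card _ _).
apply/subsetP=> D /imsetP[z _ ->]; apply/imsetP; exists (H * [set y * z] * J).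
  by apply: imset_f; rewrite inE.
apply/setP=> t; apply/dcosetP/imsetP => [[a [b [aI bJ ->]]]|[u /dcosetP[a [b [aI bJ ->]]] ->]].
  move: aI; rewrite e => /imsetP[c cH ->]; exists (c * (y * z) * b).
    by apply/dcosetP; exists c, b.
  by rewrite /conjg !mulgA.
by exists (a ^ y), b; rewrite e memJ_conjg; split=> //; rewrite /conjg !mulgA.
Qed.

Lemma big_uniq1 (T : eqType) (r : seq T) (P : pred T) a :
  uniq r -> a \in r -> P a -> {in r, forall b, P b -> b = a} ->
  (\sum_(b <- r | P b) 1 = 1)%N.
Proof.
move=> ur ar Pa Pu; rewrite -big_filter.
rewrite (perm_big [:: a]) ?big_seq1 //=; apply: uniq_perm; rewrite ?filter_uniq // => b; rewrite mem_filter inE.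
by apply/andP/eqP => [[Pb br]|->//]; apply: Pu.
Qed.

(** Inside a single L d J, the double cosets of I and J correspond to those of I and L :&: d J d^-1
    in L, by X |-> X d J. *)
Lemma dcosets_mackey G L I J (ds : seq gT) :
  I \subset L -> L \subset G -> J \subset G -> {subset ds <= G} -> uniq ds ->
  {in G, forall x, exists2 d, d \in ds & x \in L * [set d] * J} ->
  {in ds &, forall d e, e \in L * [set d] * J -> e = d} ->
  #|dcosets G I J| = (\sum_(d <- ds) #|dcosets L I (L :&: J :^ d^-1)|)%N.
Proof.
move=> IL LG JG dsG uds cov dis.
have step1 : #|dcosets G I J| = (\sum_(d <- ds) #|[set D in dcosets G I J | D \subset (L * [set d] * J)%g]|)%N.
  under eq_bigr do rewrite -sum1_card big_mkcond.
  rewrite exchange_big -sum1_card [LHS]big_mkcond; apply: eq_bigr => D _ /=.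
  rewrite -big_mkcond; case: ifP => DG; last first.
    by rewrite big_pred0 // => d; rewrite !inE DG.
  case/imsetP: DG => x xG DE; case: (cov x xG) => d dds xd.
  rewrite (@big_uniq1 _ _ _ d) // ?inE.
    rewrite DE; apply/andP; split; first exact: imset_f.
    apply/subsetP=> y /dcosetP[a [b [aI bJ ->]]].
    case/dcosetP: xd => l [j [lL jJ ->]]; apply/dcosetP; exists (a * l), (j * b).
    by rewrite !groupM ?(subsetP IL a aI) //; split=> //; rewrite !mulgA.
  move=> e eds; rewrite !inE => /andP[_ /subsetP sub].
  have xe : x \in L * [set e] * J by apply: sub; rewrite DE dcoset_refl.
  by apply: dis => //; rewrite -(dcoset_eq xd) (dcoset_eq xe) dcoset_refl.
rewrite step1 big_seq [RHS]big_seq; apply: eq_bigr => d dds.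
pose h (X : {set gT}) := X * [set d] * J.
pose K := (L :&: J :^ d^-1)%G.
have hE l : h (I * [set l] * K) = I * [set l * d] * J.
  apply/setP=> z; apply/dcosetP/dcosetP => [[y [b [/dcosetP[a [c [aI cK ->]]] bJ ->]]]|].
    move: cK; rewrite inE => /andP[_ /imsetP[j jJ ->]].
    exists a, (j * b); rewrite groupM //; split=> //.
    by rewrite /conjg invgK !mulgA mulgKV.
  case=> [a [b [aI bJ ->]]]; exists (a * l), b; split=> //; last by rewrite !mulgA.
  by apply/dcosetP; exists a, 1; rewrite group1 mulg1.
have -> : [set D in dcosets G I J | D \subset L * [set d] * J] = h @: dcosets L I K.
  apply/setP=> D; rewrite inE; apply/andP/imsetP.
    case=> /imsetP[x xG ->] /subsetP sub.
    have /dcosetP[l [j [lL jJ xE]]] := sub _ (dcoset_refl I J x).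
    exists (I * [set l] * K); first exact: imset_f.
    rewrite hE; symmetry; apply: dcoset_eq; rewrite xE.
    by apply/dcosetP; exists 1, j^-1; rewrite group1 groupV mul1g mulgK.
  case=> X /imsetP[l lL ->] ->; rewrite hE; split.
    by apply: imset_f; rewrite groupM ?(subsetP LG l lL) // dsG.
  apply/subsetP=> y /dcosetP[a [b [aI bJ ->]]]; apply/dcosetP.
  by exists (a * l), b; rewrite groupM ?(subsetP IL a aI) // !mulgA.
rewrite card_in_imset // => X Y /imsetP[l lL ->] /imsetP[l' l'L ->]; rewrite !hE => e.
apply: dcoset_eq; have := dcoset_refl I J (l * d); rewrite e.
case/dcosetP=> [a [b [aI bJ E]]]; apply/dcosetP; exists a, (b ^ d^-1); split=> //.
  rewrite inE memJ_conjg bJ andbT.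
  have -> : b ^ d^-1 = l'^-1 * a^-1 * l.
    apply: (mulgI (a * l')); rewrite !mulgA mulgK mulgV mul1g.
    by apply: (mulIg d); rewrite E /conjg invgK !mulgA mulgKV.
  by rewrite !groupM ?groupV ?(subsetP IL a aI).
apply: (mulIg d); rewrite E /conjg invgK !mulgA mulgKV //.
Qed.

End DoubleCosets.

Lemma uniq_map_inj (T U : eqType) (f : T -> U) (r : seq T) :
  uniq [seq f x | x <- r] -> {in r &, injective f}.
Proof.
elim: r => // a r IH /= /andP[ar ur] x y; rewrite !inE.
case/predU1P=> [->|xr] /predU1P[->|yr] // e; last exact: IH.
- by case/negP: ar; rewrite e map_f.
- by case/negP: ar; rewrite -e map_f.
Qed.

(** * Counting double cosets by dominant vectors *)

Section Counting.
Variables (W : finGroupType) (n N : nat) (s : 'I_n -> W) (blk : 'I_N -> 'I_n).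
Variable rho : W -> 'M[Z]_N.
Hypothesis rr : reflection_rep s blk rho.

Local Notation par := (par s).
Local Notation dominant := (dominant blk).
Local Notation zero_set := (zero_set blk).

Definition ndc (A I J : {set 'I_n}) : nat := #|dcosets (par A) (par I) (par J)|.

Lemma ndc_sym A I J : ndc A I J = ndc A J I.
Proof. exact: dcosets_sym. Qed.

Lemma act_inv (v : 'rV[Z]_N) x y : v *m rho x = v *m rho y -> v *m rho (x * y^-1)%g = v.
Proof.
move=> e; rewrite (rr_mul rr) mulmxA e -mulmxA -(rr_mul rr) mulgV (rr_one rr).
by rewrite mulmx1.
Qed.

Lemma domS (I J : {set 'I_n}) (v : 'rV[Z]_N) : I \subset J -> dominant J v -> dominant I v.
Proof. by move=> IJ /dominantP d; apply/dominantP=> a aI; apply: d; apply: (subsetP IJ). Qed.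

Lemma stab_dom A (v : 'rV[Z]_N) x : dominant A v -> x \in par A -> v *m rho x = v -> x \in par (zero_set A v).
Proof. by move=> dv xA vx; case: (dominant_unique rr xA dv); rewrite ?vx. Qed.

Lemma zero_set_sub A (v : 'rV[Z]_N) : zero_set A v \subset A.
Proof. by apply/subsetP=> i /zero_setP[]. Qed.

Lemma par_conj (I K : {set 'I_n}) x :
  [set (s i ^ x)%g | i in I] = [set s k | k in K] -> (par I :^ x)%g = par K.
Proof.
move=> e; rewrite /par /= -genJ; congr <<_>>%g; rewrite -e /conjugate -imset_comp.
by apply: eq_imset.
Qed.

(** Mackey's formula with [par L] the stabiliser of [om] in [par A]. The J-dominant orbit vectors
    [om d] index the (L, J) double cosets, and by [dominant_unique] the group L :&: d J d^-1 is
    generated by the conjugates of the simple reflections in J that fix [om d]. The last hypothesis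
    asks these conjugates to be simple, which keeps the recursion within standard parabolics. *)
Lemma ndc_restrict (A L I J : {set 'I_n}) (om : 'rV[Z]_N) (ds : seq W)
    (K : W -> {set 'I_n}) :
  dominant setT om -> zero_set A om = L -> I \subset L -> J \subset A ->
  {subset ds <= par A} -> uniq [seq om *m rho d | d <- ds] ->
  (forall x, x \in par A -> exists2 d, d \in ds & om *m rho x = om *m rho d) ->
  (forall d, d \in ds -> dominant J (om *m rho d) ->
     [set (s j ^ (d^-1))%g | j in zero_set J (om *m rho d)] = [set s m | m in K d]) ->
  ndc A I J = (\sum_(d <- ds | dominant J (om *m rho d)) ndc L I (K d))%N.
Proof.
move=> dT zL IL JA dsA uds cov conjK.
have dA : dominant A om by apply: domS dT; apply: subsetT.
have uds' : uniq ds by apply: map_uniq uds.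
have LA : L \subset A by rewrite -zL zero_set_sub.
have fixL l : l \in par L -> om *m rho l = om by rewrite -zL; apply: fix_zeros.
rewrite -big_filter /ndc.
rewrite (dcosets_mackey (L := par L) (ds := [seq d <- ds | dominant J (om *m rho d)])).
- rewrite big_seq [RHS]big_seq; apply: eq_bigr => d; rewrite mem_filter => /andP[dd dds].
  suff -> : (par L :&: par J :^ d^-1)%g = par (K d) by [].
  rewrite -(par_conj (conjK d dds dd)); apply/setP=> x; rewrite inE.
  apply/andP/imsetP.
    case=> xL /imsetP[j jJ xE]; exists j => //.
    apply: stab_dom => //; rewrite -mulmxA -(rr_mul rr).
    have -> : (d * j)%g = (x * d)%g by rewrite xE /conjg invgK !mulgA mulgKV.
    by rewrite (rr_mul rr) mulmxA fixL.
  case=> j jz ->; split.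
    rewrite -zL; apply: stab_dom => //.
      have jA := subsetP (par_sub s (subset_trans (zero_set_sub _ _) JA)) j jz.
      by rewrite groupJ // groupV dsA.
    rewrite /conjg invgK !(rr_mul rr) !mulmxA (fix_zeros rr jz).
    by rewrite -mulmxA -(rr_mul rr) mulgV (rr_one rr) mulmx1.
  by rewrite memJ_conjg (subsetP (par_sub s (zero_set_sub _ _)) j jz).
- exact: par_sub.
- exact: par_sub.
- exact: par_sub.
- by move=> d; rewrite mem_filter => /andP[_ /dsA].
- exact: filter_uniq.
- move=> x xA; case: (dominant_ex rr J x dT) => y yJ dxy.
  have xyA : (x * y)%g \in par A.
    by rewrite groupM // (subsetP (par_sub s JA)).
  case: (cov _ xyA) => d dds xyd; exists d; first by rewrite mem_filter dds -xyd dxy.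
  apply/dcosetP; exists (x * y * d^-1)%g, (y^-1)%g; rewrite groupV yJ mulgKV mulgK.
  split=> //; rewrite -zL; apply: stab_dom => //; last exact: act_inv.
  by rewrite groupM // groupV dsA.
move=> d e; rewrite !mem_filter => /andP[dd dds] /andP[de eds].
case/dcosetP=> l [j [lL jJ eE]].
have ed : om *m rho e = om *m rho d *m rho j.
  by rewrite eE !(rr_mul rr) !mulmxA fixL.
have [] := dominant_unique rr jJ dd; rewrite -?ed // => ede _.
exact: (uniq_map_inj uds).
Qed.

Definition weight (K : {set 'I_n}) : 'rV[Z]_N := \row_a (blk a \notin K)%:R.

Hypothesis blk_surj : forall i, exists a, blk a = i.

Lemma weight_dom K J : dominant J (weight K).
Proof. by apply/dominantP=> a _; rewrite mxE ler0n. Qed.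

Lemma weight_zeros (A K : {set 'I_n}) : zero_set A (weight K) = A :&: K.
Proof.
apply/setP=> i; rewrite !inE; case: (i \in A) => //=; apply/forallP/idP => [H|iK a].
  have [a ai] := blk_surj i; have := implyP (H a); rewrite ai eqxx mxE => /(_ isT).
  by rewrite ai pnatr_eq0 eqb0 negbK.
by apply/implyP=> /eqP ai; rewrite mxE ai iK.
Qed.

Lemma weight_fix K x : x \in par K -> weight K *m rho x = weight K.
Proof. by move=> xK; apply: (fix_zeros rr (J := setT)); rewrite weight_zeros setTI. Qed.

(** The all-ones vector is regular: its stabiliser is generated by the empty set. Computations use
    it to identify group elements. *)
Lemma act_faithful x y : weight set0 *m rho x = weight set0 *m rho y -> x = y.
Proof.
move=> /act_inv e; have := stab_dom (weight_dom set0 setT) _ e.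
rewrite weight_zeros setI0 (par_setT rr) inE => /(_ isT).
by rewrite /par /= imset0 gen0 => /set1P/eqP; rewrite -eq_mulgV1 => /eqP.
Qed.

(** The cosets W_K x are the points of the orbit of [om], and each W_J-orbit among these points
    contains exactly one J-dominant point. *)
Lemma ndc_dominant (K J : {set 'I_n}) (om : 'rV[Z]_N) :
  dominant setT om -> zero_set setT om = K ->
  ndc setT K J = #|[set c in rcosets (par K) [set: W] | dominant J (om *m rho (repr c))]|.
Proof.
move=> dT zK; set C := [set c in _ | _].
have fixK k : k \in par K -> om *m rho k = om.
  by move=> kK; apply: (fix_zeros rr (J := setT)); rewrite zK.
have reprE x : om *m rho (repr (par K :* x)%g) = om *m rho x.
  case/rcosetP: (mem_repr_rcoset (par K) x) => k kK ->.
  by rewrite (rr_mul rr) mulmxA fixK.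
have -> : ndc setT K J = #|[set (c * par J)%g | c : {set W} in C]|.
  congr #|pred_of_set _|; rewrite /dcosets (par_setT rr); apply/setP=> D.
  apply/imsetP/imsetP => [[x _ ->]|[c]].
    case: (dominant_ex rr J x dT) => y yJ dxy.
    exists (par K :* (x * y))%g; last first.
      symmetry; apply: (@dcoset_eq _ (par K) (par J)); apply/dcosetP.
      by exists 1%g, y; rewrite group1 mul1g.
    by rewrite inE; apply/andP; split; [apply/rcosetsP; exists (x * y)%g; rewrite ?inE|rewrite reprE].
  by rewrite inE => /andP[/rcosetsP[x _ ->] _] ->; exists x; rewrite ?inE.
apply: card_in_imset => c c'.
rewrite !inE => /andP[/rcosetsP[x _ ->] dx] /andP[/rcosetsP[y _ ->] dy] e.
have := dcoset_refl (par K) (par J) y; rewrite -e => /dcosetP[k [j [kK jJ yE]]].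
have yx : om *m rho y = om *m rho x *m rho j.
  by rewrite yE !(rr_mul rr) !mulmxA fixK.
rewrite !reprE in dx dy.
have [] := dominant_unique rr jJ dx; rewrite -?yx // => e2 _.
symmetry; apply/rcoset_eqP; rewrite mem_rcoset -zK; apply: stab_dom => //.
  by rewrite (par_setT rr) ?inE.
exact: act_inv.
Qed.

Lemma ndc_dom (K J : {set 'I_n}) :
  ndc setT K J = #|[set c in rcosets (par K) [set: W] |
                     dominant J (weight K *m rho (repr c))]|.
Proof. by apply: ndc_dominant; rewrite ?weight_dom // weight_zeros setTI. Qed.

(** Toggling a fixed element of D is a sign-reversing involution. *)
Lemma sum_sign_subset (T : finType) (D : {set T}) : D != set0 ->
  \sum_(J : {set T} | J \subset D) (-1) ^+ #|J| = 0 :> Z.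
Proof.
case/set0Pn=> i iD.
pose f (J : {set T}) := if i \in J then J :\ i else i |: J.
have fK : involutive f.
  move=> J; rewrite /f; case: (boolP (i \in J)) => iJ; rewrite !inE eqxx /=.
    by rewrite setD1K.
  by rewrite setU1K.
set S := \sum_(J | _) _; suff : S = - S by clear; lia.
rewrite {1}/S (reindex_inj (inv_inj fK)) /= -sumrN.
apply: eq_big => J.
  rewrite /f; case: ifP => iJ; rewrite ?subUset ?sub1set ?iD //.
  apply/idP/idP => [/subsetP H|]; last by apply: subset_trans; apply: subD1set.
  by apply/subsetP=> k kJ; have [->//|ki] := eqVneq k i; apply: H; rewrite !inE ki.
move=> _; rewrite /f; case: (boolP (i \in J)) => iJ.
  by rewrite (cardsD1 i J) iJ exprS mulN1r opprK.
by rewrite cardsU1 iJ exprS mulN1r.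
Qed.

(** After exchanging the sums, an orbit point contributes the alternating sum over all subsets of
    the set D of its nonnegative blocks, which is zero unless D is empty. If D is empty, the negated
    point is dominant and regular; its stabiliser contains a conjugate of W_K, so K would be
    empty. *)
Lemma ndc_alternating (K : {set 'I_n}) : K != set0 ->
  \sum_(J : {set 'I_n}) (-1) ^+ #|J| * (ndc setT K J)%:R = 0 :> Z.
Proof.
move=> Kn0; under eq_bigr => J _ do
  rewrite ndc_dom -[X in _ * X%:R]sum1_card natr_sum big_distrr /=.
rewrite (exchange_big_dep [pred c | c \in rcosets (par K) [set: W]]) /=; last first.
  by move=> J c _; rewrite inE => /andP[].
apply: big1 => c cR; set v := weight K *m rho (repr c).
pose D := [set i | [forall a, (blk a == i) ==> (0 <= v 0 a)]].
have domD J : dominant J v = (J \subset D).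
  apply/dominantP/subsetP => [H i iJ|H a aJ].
    by rewrite inE; apply/forallP=> a; apply/implyP=> /eqP ai; apply: H; rewrite ai.
  by have := H _ aJ; rewrite inE => /forallP/(_ a); rewrite eqxx.
rewrite (eq_bigl (fun J : {set 'I_n} => J \subset D)); last first.
  by move=> J; rewrite inE cR -/v domD.
under eq_bigr do rewrite mulr1.
apply: sum_sign_subset; apply: contraNneq Kn0 => D0.
(* A block of v has constant sign, because v pairs a dominant vector with a root; since D is empty,
   the sign is negative. *)
have neg a : v 0 a <= 0.
  have aT : repr c \in par setT by rewrite (par_setT rr) ?inE.
  case: (len_cases rr aT (in_setT (blk a))) => l; last first.
    rewrite mxE; apply: sumr_le0 => b _; rewrite mulr_ge0_le0 //.
      by rewrite mxE ler0n.
    by apply: (rho_col_le0 rr aT (in_setT (blk a))) => //; rewrite l.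
  suff : blk a \in D by rewrite D0 inE.
  rewrite inE; apply/forallP=> a'; apply/implyP=> /eqP a'a.
  rewrite mxE; apply: sumr_ge0 => b _; rewrite mulr_ge0 //.
    by rewrite mxE ler0n.
  by apply: (rho_col_ge0 rr aT (in_setT (blk a))) => //; rewrite l.
have dN : dominant setT (- v) by apply/dominantP=> a _; rewrite mxE oppr_ge0.
have zN : zero_set setT (- v) = set0.
  apply/setP=> i; rewrite !inE /=; apply/negP=> /forallP H.
  suff : i \in D by rewrite D0 inE.
  rewrite inE; apply/forallP=> a; apply/implyP=> ai.
  by have := implyP (H a) ai; rewrite mxE oppr_eq0 => /eqP ->.
have parK1 k : k \in par K -> k = 1%g.
  move=> kK; have vk : - v *m rho (k ^ repr c)%g = - v.
    rewrite mulNmx; congr (- _); rewrite /v -mulmxA -(rr_mul rr) /conjg mulKVg.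
    by rewrite (rr_mul rr) mulmxA (weight_fix kK).
  have := stab_dom dN _ vk; rewrite zN (par_setT rr) inE => /(_ isT).
  by rewrite /par /= imset0 gen0 => /set1P/eqP; rewrite conjg_eq1 => /eqP.
apply/eqP/setP=> i; rewrite inE; apply/negP=> iK.
have si1 := parK1 _ (mem_gen_par s iK).
case: (rr_sgn rr) => sg sgM sgs; have := sgM (s i) (s i).
by rewrite si1 mulg1 -si1 sgs.
Qed.
End Counting.

(** * The group of invertible matrices *)

Section InvertibleMatrices.
Variables (R : comNzRingType) (N : nat).

(** A matrix is packed with its inverse, so that the group operations are explicit; the universal
    property of [coxeter_system] needs a [groupType] as target. *)
Definition invertible_pair (p : 'M[R]_N * 'M[R]_N) :=
  (p.1 *m p.2 == 1%:M) && (p.2 *m p.1 == 1%:M).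

Definition invertible_mx := {p : 'M[R]_N * 'M[R]_N | invertible_pair p}.
HB.instance Definition _ := Choice.on invertible_mx.

Definition imx_val (p : invertible_mx) : 'M[R]_N := (val p).1.

Lemma imx_val_inj : injective imx_val.
Proof.
move=> [[a b] ab] [[c d] cd] /= e; apply: val_inj => /=; congr (_, _) => //.
have /andP[/= _ /eqP ba] := ab; have /andP[/= /eqP ad _] := cd.
rewrite /imx_val /= in e; rewrite -e in ad.
by rewrite -[b]mulmx1 -ad mulmxA ba mul1mx.
Qed.

Fact imx_one_subproof : invertible_pair (1%:M, 1%:M).
Proof. by rewrite /invertible_pair /= mulmx1 eqxx. Qed.
Definition imx_one : invertible_mx := exist (fun p => is_true (invertible_pair p)) _ imx_one_subproof.

Fact imx_mul_subproof (p q : invertible_mx) :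
  invertible_pair ((val p).1 *m (val q).1, (val q).2 *m (val p).2).
Proof.
case: p q => -[a b] /andP[/= /eqP ab /eqP ba] [[c d] /andP[/= /eqP cd /eqP dc]].
by rewrite /invertible_pair /= mulmxA -(mulmxA a) cd mulmx1 ab mulmxA -(mulmxA d) ba mulmx1 dc !eqxx.
Qed.
Definition imx_mul p q : invertible_mx := exist (fun p => is_true (invertible_pair p)) _ (imx_mul_subproof p q).

Fact imx_inv_subproof (p : invertible_mx) : invertible_pair ((val p).2, (val p).1).
Proof. by case: p => -[a b]; rewrite /invertible_pair /= andbC. Qed.
Definition imx_inv p : invertible_mx := exist (fun p => is_true (invertible_pair p)) _ (imx_inv_subproof p).

Fact imx_mulA : associative imx_mul.
Proof. by move=> p q r; apply: imx_val_inj; rewrite /imx_val /= mulmxA. Qed.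
Fact imx_mul1 : left_id imx_one imx_mul.
Proof. by move=> p; apply: imx_val_inj; rewrite /imx_val /= mul1mx. Qed.
Fact imx_mulr1 : right_id imx_one imx_mul.
Proof. by move=> p; apply: imx_val_inj; rewrite /imx_val /= mulmx1. Qed.
Fact imx_mulV : left_inverse imx_one imx_inv imx_mul.
Proof.
by case=> -[a b] ab; apply: imx_val_inj; case/andP: (ab) => _ /eqP; rewrite /imx_val /=.
Qed.
Fact imx_mulrV : right_inverse imx_one imx_inv imx_mul.
Proof.
by case=> -[a b] ab; apply: imx_val_inj; case/andP: (ab) => /eqP; rewrite /imx_val /=.
Qed.

HB.instance Definition _ :=
  isGroup.Build invertible_mx imx_mulA imx_mul1 imx_mulr1 imx_mulV imx_mulrV.

Lemma imx_valM (p q : invertible_mx) : imx_val (p * q)%g = imx_val p *m imx_val q.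
Proof. by []. Qed.
Lemma imx_val1 : imx_val 1%g = 1%:M.
Proof. by []. Qed.
End InvertibleMatrices.

(** * Representations obtained from the Coxeter presentation *)

Section CoxeterRep.
Variables (W : finGroupType) (S : {set W}) (hWS : coxeter_system S).
Variables (n : nat) (s : 'I_n -> W).
Hypotheses (s_inj : injective s) (sS : s @: setT = S).

Lemma coxeter_lift (H : groupType) (g : 'I_n -> H) :
  (forall i j, ((g i * g j) ^+ #[s i * s j])%g = 1%g) ->
  exists2 phi : W -> H, {morph phi : x y / (x * y)%g} & forall i, phi (s i) = g i.
Proof.
move=> rel; case: hWS => _ _ univ.
pose f x := if [pick i | s i == x] is Some i then g i else 1%g.
have fs i : f (s i) = g i.
  by rewrite /f; case: pickP => [k /eqP/s_inj -> //|/(_ i)]; rewrite eqxx.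
case: (univ H f) => [x y|phi phiM phif].
  by rewrite -sS => /imsetP[i _ ->] /imsetP[j _ ->]; rewrite !fs.
by exists phi => // i; rewrite phif ?fs // -sS imset_f.
Qed.

Lemma coxeter_s2 i : (s i * s i)%g = 1%g.
Proof.
case: hWS => _ ord2 _; have := ord2 (s i); rewrite -sS imset_f // => /(_ isT) o.
by have := expg_order (s i); rewrite o expgS expg1.
Qed.

(** Every generator goes to the transposition of a two-element set; the relations hold because a
    product of two generators goes to 1. *)
Lemma coxeter_sgn : exists2 sg : W -> bool,
  forall x y, sg (x * y)%g = sg x (+) sg y & forall i, sg (s i).
Proof.
case: (@coxeter_lift {perm bool} (fun=> tperm true false)) => [i j|phi phiM phis].
  by rewrite tperm2 expg1n.
exists (fun x => odd_perm (phi x)) => [x y|i]; first by rewrite phiM odd_permM.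
by rewrite phis odd_tperm.
Qed.

Lemma coxeter_braid i j : let m := #[s i * s j]%g in
  wprod s (altw i j m) = wprod s (altw j i m).
Proof.
move=> m.
have sV k : (s k)^-1%g = s k by apply/eqP; rewrite eq_invg_mul coxeter_s2.
have step r k l : ((wprod s (altw k l r))^-1 * wprod s (altw l k r))%g = ((s l * s k) ^+ r)%g.
  elim: r k l => [|r IH] k l; first by rewrite /= !wprod_nil invg1 mulg1.
  rewrite /= !wprod_rcons invMg sV -mulgA (mulgA _ (wprod s (altw k l r))) IH.
  have comm (x y : W) k' : (x * (y * x) ^+ k' = (x * y) ^+ k' * x)%g.
    elim: k' => [|k' IHk]; first by rewrite !expg0 mulg1 mul1g.
    by rewrite expgS !mulgA -(mulgA (x * y)%g) IHk mulgA -expgS.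
  by rewrite !mulgA comm -!mulgA -expgSr.
by apply/eqP; rewrite eq_sym eq_mulVg1 step expg_order.
Qed.

Variables (N : nat) (blk : 'I_N -> 'I_n) (g : 'I_n -> 'M[Z]_N).

Definition mprod (t : seq 'I_n) : 'M[Z]_N := foldr (fun i A => g i *m A) 1%:M t.

(** By the presentation, conditions on generator matrices, taken singly and in pairs, suffice for a
    representation of all of W. *)
Lemma reflection_rep_exists :
  (forall i, g i *m g i = 1%:M) ->
  (forall i j, iter #[s i * s j]%g (mulmx (g i *m g j)) 1%:M = 1%:M) ->
  (forall i b c, blk b != i -> g i b c = (b == c)%:R) ->
  (forall i b a, blk a = i -> g i b a = - (b == a)%:R) ->
  (forall i j, i != j -> forall r, (r < #[s i * s j]%g)%N ->
     forall a b, blk a = i -> 0 <= mprod (altw i j r) b a) ->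
  exists2 rho, reflection_rep s blk rho & forall i, rho (s i) = g i.
Proof.
move=> g2 gord grow gcol galt.
have gP i : invertible_pair (g i, g i) by rewrite /invertible_pair /= g2 eqxx.
pose G i : invertible_mx Z N := exist (fun p => is_true (invertible_pair p)) _ (gP i).
case: (@coxeter_lift (invertible_mx Z N) G) => [i j|phi phiM phis].
  apply: imx_val_inj; rewrite imx_val1 -[RHS](gord i j).
  elim: #[_]%g => [|k IH]; first by rewrite expg0 imx_val1.
  by rewrite expgS imx_valM IH.
have rho1 : imx_val (phi 1%g) = 1%:M.
  suff -> : phi 1%g = 1%g by [].
  by apply: (mulgI (phi 1%g)); rewrite -phiM !mulg1.
exists (fun x => imx_val (phi x)) => [|i]; last by rewrite phis.
have rhoP t : imx_val (phi (wprod s t)) = mprod t.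
  elim: t => [|i t IH]; first by rewrite wprod_nil rho1.
  by rewrite wprod_cons phiM imx_valM phis IH.
split=> //.
- by case: hWS => gen _ _; rewrite sS.
- exact: coxeter_s2.
- by move=> x y; rewrite phiM.
- by move=> i b c; rewrite phis; apply: grow.
- by move=> i b a; rewrite phis; apply: gcol.
- exact: coxeter_sgn.
move=> i j ij; exists #[s i * s j]%g; rewrite order_gt0; split=> //.
  exact: coxeter_braid.
by move=> r rm a b ai; rewrite rhoP; apply: galt.
Qed.
End CoxeterRep.

(** * Integer vectors as lists; verifying a reflection representation by computation *)

Fixpoint vsub (c : Z) (v r : seq Z) : seq Z :=
  match v, r with x :: v', y :: r' => Z.sub x (Z.mul c y) :: vsub c v' r' | _, _ => [::] end.

Lemma size_vsub c v r : size v = size r -> size (vsub c v r) = size v.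
Proof. by elim: v r => [|x v IH] [|y r] //= [/IH ->]. Qed.

Lemma nth_vsub c v r k : size v = size r ->
  nth 0 (vsub c v r) k = nth 0 v k - c * nth 0 r k.
Proof.
elim: v r k => [|x v IH] [|y r] // [|k] //= e; rewrite ?mulr0 ?subr0 //.
by apply: IH; case: e.
Qed.

(** Generator i is a list of pairs (b, r), each of which subtracts [v_b] times the row r. *)
Definition gen_data := seq (seq (nat * seq Z)).

(** The coefficients are read from the original [v] and not from the accumulator, so that all pairs
    of a generator act simultaneously. *)
Definition refl_act (G : gen_data) (i : nat) (v : seq Z) : seq Z :=
  foldl (fun acc p => vsub (nth 0%BZ v p.1) acc p.2) v (nth [::] G i).

Definition word_act G (v : seq Z) (t : seq nat) := foldl (fun v i => refl_act G i v) v t.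

Definition basis N (b : nat) : seq Z := [seq if a == b then 1%BZ else 0%BZ | a <- iota 0 N].

Section Lists.
Variables (n e : nat) (G : gen_data).
Let N := (n * e)%N.

Definition gens_wf := all (all (fun p => (p.1 < N)%N && (size p.2 == N))) G.
Hypothesis Gwf : gens_wf.

Definition vec_of (v : seq Z) : 'rV[Z]_N := \row_a nth 0 v a.

Definition gmx (i : nat) : 'M[Z]_N :=
  \matrix_(b, c) ((b == c)%:R - \sum_(p <- nth [::] G i) (p.1 == b)%:R * nth 0 p.2 c).

Lemma gens_wfP i p : p \in nth [::] G i -> (p.1 < N)%N /\ size p.2 = N.
Proof.
move=> pi; have [iG|iG] := ltnP i (size G); last by rewrite nth_default in pi.
have /allP/(_ _ (mem_nth [::] iG))/allP/(_ _ pi) := Gwf.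
by case/andP=> ? /eqP.
Qed.

Lemma refl_actP i v : size v = N -> size (refl_act G i v) = N /\
  forall k, nth 0 (refl_act G i v) k =
    nth 0 v k - \sum_(p <- nth [::] G i) nth 0 v p.1 * nth 0 p.2 k.
Proof.
move=> vN; rewrite /refl_act; move: (nth [::] G i) (@gens_wfP i) => l lwf.
elim/last_ind: l lwf => [|l p IH] lwf; first by split=> // k; rewrite big_nil subr0.
case: IH => [q ql|sz IH]; first by apply: lwf; rewrite mem_rcons inE ql orbT.
case: (lwf p) => [|p1 p2]; first by rewrite mem_rcons inE eqxx.
rewrite foldl_rcons size_vsub ?sz ?p2 //; split=> // k.
by rewrite nth_vsub ?sz ?p2 // IH big_rcons /= opprD addrA addrAC.
Qed.

Lemma size_refl_act i v : size v = N -> size (refl_act G i v) = N.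
Proof. by case/(refl_actP i). Qed.

Lemma vec_refl_act i v : size v = N -> vec_of (refl_act G i v) = vec_of v *m gmx i.
Proof.
move=> vN; apply/rowP=> c; rewrite !mxE; have [_ ->] := refl_actP i vN.
under [RHS]eq_bigr do rewrite !mxE mulrBr big_distrr /=.
rewrite sumrB; congr (_ - _).
  rewrite (bigD1 c) //= eqxx mulr1 big1 ?addr0 // => b bc.
  by rewrite (negbTE bc) mulr0.
rewrite exchange_big /= big_seq [RHS]big_seq; apply: eq_bigr => p pi.
have [p1 _] := gens_wfP pi; rewrite (bigD1 (Ordinal p1)) //= eqxx mul1r big1 ?addr0 //.
move=> b bp; suff /negbTE -> : p.1 != b by rewrite mul0r mulr0.
by apply: contraNneq bp => pb; apply/eqP/val_inj.
Qed.

Lemma size_word_act v t : size v = N -> size (word_act G v t) = N.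
Proof. by elim: t v => //= i t IH v vN; apply/IH/size_refl_act. Qed.

Lemma size_basis b : size (basis N b) = N.
Proof. by rewrite size_map size_iota. Qed.

Lemma vec_basis (b : 'I_N) : vec_of (basis N b) = delta_mx 0 b.
Proof.
apply/rowP=> a; rewrite !mxE (nth_map 0%N) ?size_iota // nth_iota //= add0n.
by rewrite (inj_eq val_inj); case: eqP.
Qed.

Lemma vec_of_inj u v : size u = N -> size v = N -> vec_of u = vec_of v -> u = v.
Proof.
move=> uN vN e'; apply: (@eq_from_nth _ 0); rewrite uN // => i iN.
by have /rowP/(_ (Ordinal iN)) := e'; rewrite !mxE.
Qed.

Definition cox_m (E : seq (nat * nat * nat)) (i j : nat) : nat :=
  if i == j then 1%N else
  head 2 [seq e.2 | e <- E & (e.1 == (i, j)) || (e.1 == (j, i))].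

(** The hypotheses of [reflection_rep_exists], tested on basis vectors: shape of the generators,
    orders of their products, positivity of alternating words. *)
Definition sys_check (E : seq (nat * nat * nat)) : bool :=
  let bs := [seq basis N b | b <- iota 0 N] in
  [&& all (fun i => all (fun b =>
        let r := refl_act G i (basis N b) in
        [&& refl_act G i r == basis N b, (b %% n == i)%N || (r == basis N b) &
            all (fun a => (a %% n != i)%N ||
               (nth 0%BZ r a == if a == b then (-1)%BZ else 0%BZ)) (iota 0 N)])
        (iota 0 N)) (iota 0 n),
      all (fun i => all (fun j => all (fun b =>
        iter (cox_m E i j) (fun v => refl_act G j (refl_act G i v)) b == b) bs)
        (iota 0 n)) (iota 0 n) &
      all (fun i => all (fun j => (i == j) || all (fun r => all (fun b =>
        let v := word_act G b (altw i j r) in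
        all (fun a => (a %% n != i)%N || Z.leb 0 (nth 0%BZ v a)) (iota 0 N)) bs)
        (iota 0 (cox_m E i j))) (iota 0 n)) (iota 0 n)].

End Lists.

(** The [e] integer components of one scalar coordinate are spaced by the rank. *)
Definition blkf n e (a : 'I_(n.+1 * e)) : 'I_n.+1 := inord (a %% n.+1).

Lemma blkfE n e (a : 'I_(n.+1 * e)) : blkf a = (a %% n.+1)%N :> nat.
Proof. by rewrite inordK // ltn_pmod. Qed.

Lemma allI n (p : pred nat) : all p (iota 0 n) -> forall i, (i < n)%N -> p i.
Proof. by move/allP=> H i ii; apply: H; rewrite mem_iota. Qed.

Lemma sys_rep (W : finGroupType) (S : {set W}) (n e : nat) (G : gen_data)
    (E : seq (nat * nat * nat)) :
  coxeter_system S -> has_coxeter_matrix S (diagram_matrix n.+1 E) ->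
  gens_wf n.+1 e G -> sys_check n.+1 e G E ->
  exists s : 'I_n.+1 -> W, [/\ injective s, s @: setT = S &
    exists2 rho, reflection_rep s (@blkf n e) rho &
      forall i : 'I_n.+1, rho (s i) = gmx n.+1 e G i].
Proof.
move=> hWS [s [s_inj sS smat]] Gwf /and3P[c1 c2 c3].
exists s; split=> //.
have sm i j : #[s i * s j]%g = cox_m E i j by rewrite smat mxE.
set N := (n.+1 * e)%N in c1 c2 c3 *.
pose g (i : 'I_n.+1) : 'M[Z]_N := gmx n.+1 e G i.
have actg (i : 'I_n.+1) v : size v = N -> vec_of n.+1 e (refl_act G i v) = vec_of n.+1 e v *m g i.
  exact: vec_refl_act.
have mxeq (A B : 'M[Z]_N) : (forall b, delta_mx 0 b *m A = delta_mx 0 b *m B :> 'rV_N) -> A = B.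
  by move=> H; apply/row_matrixP=> b; rewrite !rowE H.
have sz b : size (basis N b) = N by exact: size_basis.
have sza i v : size v = N -> size (refl_act G i v) = N by exact: size_refl_act.
have ent (A : 'M[Z]_N) b a : A b a = (delta_mx 0 b *m A : 'rV_N) 0 a.
  by rewrite -rowE mxE.
have bsP (b : 'I_N) : basis N b \in [seq basis N b | b <- iota 0 N].
  by apply: (map_f (basis N)); rewrite mem_iota add0n ltn_ord.
apply: (reflection_rep_exists hWS s_inj sS) => [i|i j|i b c bi|i b a ai|i j ij r rm a b ai].
- apply: mxeq => b; rewrite mulmxA mulmx1 -vec_basis -actg ?sz // -actg ?sza ?sz //.
  have := allI (allI c1 (ltn_ord i)) (ltn_ord b).
  by case/and3P=> /eqP ->.
- apply: mxeq => b; rewrite mulmx1 -vec_basis.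
  have := allI (allI c2 (ltn_ord i)) (ltn_ord j).
  move/allP/(_ _ (bsP b))/eqP => {2}<-; rewrite sm.
  elim: cox_m (basis N b) (sz b) => [|k IH] v vN; first by rewrite mulmx1.
  by rewrite [in RHS]iterSr -IH ?sza // actg ?sza // actg // iterS !mulmxA.
- have := allI (allI c1 (ltn_ord i)) (ltn_ord b).
  case/and3P=> _ /orP[/eqP bE|/eqP rE] _.
    by case/eqP: bi; apply: val_inj; rewrite /= blkfE bE.
  rewrite -/(g i) ent -vec_basis -actg ?sz // rE vec_basis mxE eqxx eq_sym.
  by [].
- have := allI (allI c1 (ltn_ord i)) (ltn_ord b).
  case/and3P=> _ _ /allI/(_ _ (ltn_ord a)); rewrite -blkfE ai eqxx /= => /eqP H.
  rewrite -/(g i) ent -vec_basis -actg ?sz // mxE H eq_sym (inj_eq val_inj).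
  by case: eqP.
have := allI (allI c3 (ltn_ord i)) (ltn_ord j); rewrite (inj_eq val_inj) (negbTE ij) /=.
rewrite sm in rm.
move/allI/(_ _ rm)/allP/(_ _ (bsP b))/allI/(_ _ (ltn_ord a)).
rewrite -blkfE ai eqxx /= => H; rewrite ent -vec_basis.
suff -> : vec_of n.+1 e (basis N b) *m mprod g (altw i j r) =
          vec_of n.+1 e (word_act G (basis N b) (@altw nat i j r)).
  by rewrite mxE; exact: H.
have -> : @altw nat i j r = map (@nat_of_ord _) (altw i j r).
  by elim: r i j {ij ai rm H} => //= r IH i j; rewrite map_rcons IH.
elim: (altw i j r) (basis N b) (sz b) => [|x t IH] v vN /=; first by rewrite mulmx1.
by rewrite mulmxA -actg // IH // sza.
Qed.

(** * Algorithms: formal sums of subsets, orbit enumeration, the metamatrix *)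

Fixpoint zlist_eqb (u v : seq Z) : bool :=
  match u, v with
  | [::], [::] => true
  | x :: u', y :: v' => Z.eqb x y && zlist_eqb u' v'
  | _, _ => false
  end.

Fixpoint submask (a b : bitseq) : bool :=
  match a, b with
  | x :: a', y :: b' => (x ==> y) && submask a' b'
  | x :: a', [::] => ~~ x && submask a' [::]
  | [::], _ => true
  end.

Fixpoint ormask (a b : bitseq) : bitseq :=
  match a, b with
  | x :: a', y :: b' => (x || y) :: ormask a' b'
  | [::], _ => b
  | _, [::] => a
  end.

Fixpoint img_mask (J : bitseq) (sg : seq bitseq) : bitseq :=
  match J, sg with
  | b :: J', m :: sg' => if b then ormask m (img_mask J' sg') else img_mask J' sg'
  | _, _ => [::]
  end.

Fixpoint zlist_add (a b : seq Z) : seq Z :=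
  match a, b with
  | x :: a', y :: b' => Z.add x y :: zlist_add a' b'
  | [::], _ => b
  | _, [::] => a
  end.

(** A formal sum of subsets, keyed by masks. Each coefficient is a list indexed by the size q of the
    subsets J it came from; an empty list marks an absent key. *)
Inductive trie := TE | TN of seq Z & trie & trie.

Fixpoint tadd (k : bitseq) (c : seq Z) (t : trie) : trie :=
  match k, t with
  | [::], TE => TN c TE TE
  | [::], TN c' l r => TN (zlist_add c c') l r
  | b :: k', TE => if b then TN [::] TE (tadd k' c TE) else TN [::] (tadd k' c TE) TE
  | b :: k', TN c' l r => if b then TN c' l (tadd k' c r) else TN c' (tadd k' c l) r
  end.

Fixpoint telems (pre : bitseq) (t : trie) : seq (bitseq * seq Z) :=
  match t with
  | TE => [::]
  | TN c l r => (if c is [::] then [::] else [:: (rev pre, c)])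
                ++ telems (false :: pre) l ++ telems (true :: pre) r
  end.

Section Orbits.
Variables (n e : nat) (G : gen_data).
Let N := (n * e)%N.

Definition coords i := [seq (i + n * k)%N | k <- iota 0 e].
Definition nonneg (v : seq Z) i := all (fun a => Z.leb 0 (nth 0%BZ v a)) (coords i).
Definition iszero (v : seq Z) i := all (fun a => Z.eqb (nth 0%BZ v a) 0) (coords i).
Definition elts (A : bitseq) := [seq i <- iota 0 n | nth false A i].
Definition first_neg (A : seq nat) (v : seq Z) := nth n A (find (fun i => ~~ nonneg v i) A).

Definition state := (seq nat * seq (seq Z))%type.

(** A vector is accepted only from the parent obtained by reflecting it in its first negative block.
    The orbit thus becomes a tree, and no set of visited vectors has to be kept. *)
Definition children (A : seq nat) (st : state) : seq state :=
  [seq (i :: st.1, [seq refl_act G i v | v <- st.2])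
     | i <- A & first_neg A (refl_act G i (head [::] st.2)) == i].

Fixpoint levels (A : seq nat) fuel (lvl : seq state) : option (seq state) :=
  if lvl is [::] then Some [::] else
  if fuel is f.+1 then
    if levels A f (flatten [seq children A st | st <- lvl]) is Some r
    then Some (lvl ++ r) else None
  else None.

(** Besides the orbit vector, a state carries the images, under the same word, of the regular vector
    d and of all s_m d; comparing these identifies conjugates of simple reflections. *)
Definition state0 (k : nat) : state :=
  let d := nseq N 1%BZ in
  ([::], [:: basis N k, d & [seq refl_act G m d | m <- iota 0 n]]).

Definition hash (v : seq Z) : Z := foldl (fun a x => Z.add (Z.mul a 64) x) 0%BZ v.

(** Distinct hashes certify distinct vectors; a collision could only make the check fail. *)
Definition sorted_hashes (l : seq state) :=
  sorted Z.ltb (sort Z.leb [seq hash (head [::] st.2) | st <- l]).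

(** The m with w s_j = s_m w, where w is the word of the state; it is n if there is none. *)
Definition sigma (st : state) j :=
  find (zlist_eqb (refl_act G j (nth [::] st.2 1))) (drop 2 st.2).

Definition info (st : state) : bitseq * seq bitseq :=
  let v := head [::] st.2 in
  ([seq nonneg v i | i <- iota 0 n],
   [seq if iszero v j then let m := sigma st j in [seq m == i | i <- iota 0 n] else [::]
      | j <- iota 0 n]).

Definition state_ok (A : seq nat) k (st : state) :=
  all (fun j => ~~ iszero (head [::] st.2) j ||
     (let m := sigma st j in (m \in A) && (m != k))) A.

Definition infos (A : bitseq) (k : nat) : option (seq (bitseq * seq bitseq)) :=
  let l := elts A in
  if (size A == n) && (k \in l) then
    (* The depth of an orbit tree is the length of a group element, at most 120, the number of
       reflections in type E_8. Running out of fuel yields [None]. *)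
    if levels l 130 [:: state0 k] is Some sts then
      if sorted_hashes sts && all (state_ok l k) sts then Some [seq info st | st <- sts]
      else None
    else None
  else None.

(** One Mackey step on a formal sum: each J is replaced by the sum, over the orbit vectors that are
    J-dominant, of the subsets generating the intersections. *)
Definition tres (inf : seq (bitseq * seq bitseq)) (t : trie) : trie :=
  foldr (fun (Jc : bitseq * seq Z) acc =>
    foldr (fun (x : bitseq * seq bitseq) acc =>
      if submask Jc.1 x.1 then tadd (img_mask Jc.1 x.2) Jc.2 acc else acc) acc inf)
    TE (telems [::] t).

(** For I equal to the current parabolic each subset accounts for a single double coset, so the
    answer is the sum of the coefficients. *)
Definition mass (t : trie) : seq Z := foldr (fun Jc acc => zlist_add Jc.2 acc) [::] (telems [::] t).

Fixpoint masks (m : nat) : seq bitseq :=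
  if m is m'.+1 then [seq false :: x | x <- masks m'] ++ [seq true :: x | x <- masks m']
  else [:: [::]].

(** The formal sum of all J, graded by |J|. Cutting off the sizes below [q0] keeps the tries small
    when only large q are wanted. *)
Definition trie0 (q0 : nat) : trie :=
  foldr (fun J t => let q := count id J in
           if (q0 <= q)%N then tadd J (rcons (nseq q 0%BZ) 1%BZ) t else t) TE (masks n).

Fixpoint lookup T (tab : seq (bitseq * T)) (A : bitseq) : option T :=
  if tab is (B, t) :: tab' then if A == B then Some t else lookup tab' A else None.

Fixpoint run_restrict (tab : seq (bitseq * trie)) (steps : seq (bitseq * nat)) :=
  if steps is (A, k) :: steps' then
    if lookup tab A is Some t then
      if infos A k is Some inf then
        let A' := set_nth false A k false in
        let t' := tres inf t in
        if all (fun Jc => submask Jc.1 A') (telems [::] t')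
        then run_restrict ((A', t') :: tab) steps' else None
      else None
    else None
  else Some [seq (x.1, mass x.2) | x <- tab].

(** Certifies that w carries the simple reflections of I onto those of I' by conjugation, by
    comparing images of regular vectors. *)
Definition conj_ok (I : bitseq) (w : seq nat) (I' : bitseq) :=
  let d := nseq N 1%BZ in
  let y := word_act G d w in
  let zs := [seq word_act G (refl_act G m d) w | m <- iota 0 n] in
  let im := [seq find (zlist_eqb (refl_act G i y)) zs | i <- elts I] in
  [&& all (fun i => (i < n)%N) w, all (fun m => m \in elts I') im & all (fun m => m \in im) (elts I')].

Fixpoint run_conj (tab : seq (bitseq * seq Z)) (steps : seq (bitseq * seq nat * bitseq)) :=
  if steps is (K, w, K') :: steps' then
    if lookup tab K' is Some c then
      if conj_ok K w K' then run_conj ((K, c) :: tab) steps' else None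
    else None
  else Some tab.

Definition row_sum (tab : seq (bitseq * seq Z)) (p : nat) : option (seq Z) :=
  foldr (fun J acc => if count id J == p then
      if lookup tab J is Some c then if acc is Some a then Some (zlist_add c a) else None
      else None else acc) (Some [::]) (masks n).

Fixpoint bits (m x : nat) : bitseq := if m is m'.+1 then odd x :: bits m' x./2 else [::].

Definition restrict_table q0 (steps : seq (nat * nat)) :=
  let t := trie0 q0 in
  if all (fun Jc => submask Jc.1 (nseq n true)) (telems [::] t)
  then run_restrict [:: (nseq n true, t)] [seq (bits n x.1, x.2) | x <- steps]
  else None.

Definition conj_steps (P : pred nat) (steps : seq (nat * seq nat * nat)) :=
  [seq (bits n x.1.1, x.1.2, bits n x.2) | x <- steps & P (count id (bits n x.1.1))].

(** Rows up to n - 3 are computed in full, row n - 2 only in columns n - 2 and n - 1. Symmetry and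
    the binomial last row give everything else except the entry (n - 1, n - 1), which is fixed by
    the alternating sum of its row. *)
Definition meta_check (rs rsh : seq (nat * nat)) (cj : seq (nat * seq nat * nat))
    (M : seq (seq Z)) : bool :=
  let ent p q := nth 0%BZ (nth [::] M p) q in
  [&& (if restrict_table 0 rs is Some tab then
         if run_conj tab (conj_steps (fun p => p <= n - 3)%N cj) is Some tab' then
           all (fun p => if row_sum tab' p is Some r then zlist_eqb r (nth [::] M p) else false)
             (iota 0 (n - 2))
         else false else false),
      (if restrict_table (n - 2) rsh is Some tab then
         if run_conj tab (conj_steps (fun p => p == n - 2)%N cj) is Some tab' then
           if row_sum tab' (n - 2) is Some r then
             all (fun q => Z.eqb (nth 0%BZ r q) (ent (n - 2)%N q)) (iota (n - 2) 2)
           else false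
         else false else false),
      all (fun p => all (fun q => Z.eqb (ent p q) (ent q p)) (iota 0 n.+1)) (iota 0 n.+1),
      all (fun q => Z.eqb (ent n q) (Z.of_nat 'C(n, q))) (iota 0 n.+1) &
      Z.eqb (foldr (fun q acc => if odd q then Z.sub acc (ent n.-1 q) else Z.add acc (ent n.-1 q))
              0%BZ (iota 0 n.+1)) 0].

End Orbits.

(** * Correctness of masks and tries *)

Lemma zlist_eqbP u v : reflect (u = v) (zlist_eqb u v).
Proof.
apply: (iffP idP) => [|<-]; last by elim: u => //= x u ->; rewrite Z.eqb_refl.
by elim: u v => [|x u IH] [|y v] //= /andP[/Z.eqb_eq -> /IH ->].
Qed.

Lemma submaskP a b : reflect (forall i, nth false a i -> nth false b i) (submask a b).
Proof.
apply: (iffP idP) => [|H].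
  elim: a b => [|x a IH] b.
    by move=> _ i; rewrite nth_nil.
  case: b => [|y b] /=.
    by case/andP=> /negbTE -> /IH H [|i] //= /H; rewrite nth_nil.
  by case/andP=> /implyP xy /IH H [|i] //=; apply: H.
elim: a b H => [|x a IH] [|y b] //= H.
  rewrite IH ?andbT => [|i ai]; last by have := H i.+1 ai.
  by apply/negP=> /(H 0).
by rewrite IH ?andbT => [|i]; [apply/implyP/(H 0)|apply: (H i.+1)].
Qed.

Lemma nth_ormask a b i : nth false (ormask a b) i = nth false a i || nth false b i.
Proof.
elim: a b i => [|x a IH] [|y b] [|i] //=; rewrite ?nth_nil ?orbF //.
Qed.

Lemma nth_img_mask J sg i : nth false (img_mask J sg) i <->
  exists j, nth false J j && nth false (nth [::] sg j) i.
Proof.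
elim: J sg => [|b J IH] [|m sg] /=.
- by rewrite nth_nil; split=> // -[j]; rewrite !nth_nil.
- by rewrite nth_nil; split=> // -[j]; rewrite !nth_nil.
- by rewrite nth_nil; split=> // -[j]; rewrite !nth_nil andbF.
split.
  case: b; rewrite ?nth_ormask.
    by case/orP=> [mi|/IH[j H]]; [exists 0%N|exists j.+1].
  by case/IH=> j H; exists j.+1.
case=> -[|j] /= H.
  by case/andP: H => -> mi; rewrite nth_ormask mi.
have {}H : nth false (img_mask J sg) i by apply/IH; exists j.
by case: b; rewrite ?nth_ormask ?H ?orbT.
Qed.

Lemma nth_zlist_add a b q : nth 0 (zlist_add a b) q = nth 0 a q + nth 0 b q.
Proof. by elim: a b q => [|x a IH] [|y b] [|q] //=; rewrite ?nth_nil ?addr0 ?add0r. Qed.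

Section TrieSum.
Variables (q : nat) (F : bitseq -> Z).

(** The degree-q part of a formal sum, evaluated by sending K to [F K]. The proofs see tries only
    through these linear functionals. *)
Definition wsum (l : seq (bitseq * seq Z)) : Z := \sum_(x <- l) nth 0 x.2 q * F x.1.

Lemma wsum_cat l l' : wsum (l ++ l') = wsum l + wsum l'.
Proof. by rewrite /wsum big_cat. Qed.

Lemma wsum_single k c : wsum (if c is [::] then [::] else [:: (k, c)]) = nth 0 c q * F k.
Proof. by case: c => [|x c]; rewrite /wsum ?big_nil ?big_seq1 // nth_nil mul0r. Qed.

Lemma wsum_tadd pre k c t : wsum (telems pre (tadd k c t)) =
  nth 0 c q * F (rev pre ++ k) + wsum (telems pre t).
Proof.
have E0 : wsum [::] = 0 by rewrite /wsum big_nil.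
have ET p : wsum (telems p TE) = 0 by exact: E0.
elim: k pre t => [|b k IH] pre t.
  case: t => [|c' l r] /=; first by rewrite !cats0 wsum_single E0 addr0.
  by rewrite cats0 !wsum_cat !wsum_single nth_zlist_add mulrDl !addrA.
case: t => [|c' l r]; case: b => /=.
- by rewrite IH rev_cons cat_rcons ?ET ?E0.
- by rewrite cats0 IH rev_cons cat_rcons ?ET ?E0.
- by rewrite !wsum_cat IH rev_cons cat_rcons; ring.
- by rewrite !wsum_cat IH rev_cons cat_rcons; ring.
Qed.

Lemma wsum_tres inf t : wsum (telems [::] (tres inf t)) =
  \sum_(x <- telems [::] t) nth 0 x.2 q * \sum_(y <- inf | submask x.1 y.1) F (img_mask x.1 y.2).
Proof.
rewrite /tres; elim: (telems [::] t) => [|x l IH]; first by rewrite big_nil /wsum big_nil.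
rewrite big_cons -IH /=; set acc := foldr _ _ l; clearbody acc; clear IH.
elim: inf => [|y inf IHi].
  by rewrite /= big_nil mulr0 add0r.
rewrite big_cons /=; case: ifP => sub; last exact: IHi.
by rewrite wsum_tadd /= IHi mulrDr addrA.
Qed.
End TrieSum.

Lemma nth_mass q t : nth 0 (mass t) q = wsum q (fun=> 1) (telems [::] t).
Proof.
rewrite /mass /wsum; elim: (telems _ _) => [|x l IH]; first by rewrite big_nil nth_nil.
by rewrite big_cons /= nth_zlist_add IH mulr1.
Qed.

Section Sets.
Variable n : nat.
Definition bset (m : bitseq) : {set 'I_n} := [set i : 'I_n | nth false m i].

Lemma size_masks m : size (masks m) = (2 ^ m)%N.
Proof. by elim: m => //= m IH; rewrite size_cat !size_map IH expnS mul2n addnn. Qed.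

Lemma mem_masks m (x : bitseq) : (x \in masks m) = (size x == m).
Proof.
elim: m x => [|m IH] [|b x] //=; rewrite mem_cat.
- by apply/negP=> /orP[] /mapP[].
rewrite eqSS -IH; case: b.
  rewrite (mem_map (f := cons true)); last by move=> ? ? [].
  by rewrite orbC; case: (x \in _) => //=; apply/negP=> /mapP[].
rewrite (mem_map (f := cons false)); last by move=> ? ? [].
by case: (x \in _) => //=; apply/negP=> /mapP[].
Qed.

Lemma card_bset (m : bitseq) : size m = n -> #|bset m| = count id m.
Proof.
move=> mn; rewrite cardE -(size_map val) /enum_mem -enumT.
rewrite (_ : map _ _ = [seq i <- iota 0 n | nth false m i]).
  by rewrite size_filter -[in RHS](mkseq_nth false m) /mkseq count_map mn.
rewrite -val_enum_ord filter_map; congr map; apply: eq_filter => i.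
by rewrite !inE.
Qed.

Lemma sum_masks (H : {set 'I_n} -> nat) (P : pred nat) :
  (\sum_(m <- masks n | P (count id m)) H (bset m) = \sum_(J : {set 'I_n} | P #|J|) H J)%N.
Proof.
have surj (J : {set 'I_n}) : J \in [seq bset m | m <- masks n].
  apply/mapP; exists (mkseq (fun i => if insub i is Some k then k \in J else false) n).
    by rewrite mem_masks size_mkseq.
  by apply/setP=> i; rewrite inE nth_mkseq // valK.
have perm : perm_eq [seq bset m | m <- masks n] (enum [set: {set 'I_n}]).
  apply: uniq_perm (enum_uniq _) _ => [|J]; last by rewrite surj mem_enum inE.
  apply: (leq_size_uniq (enum_uniq [set: {set 'I_n}])) => [J _|]; first exact: surj.
  by rewrite size_map size_masks -cardE -powersetT card_powerset cardsT card_ord.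
transitivity (\sum_(J <- [seq bset m | m <- masks n] | P #|J|) H J)%N.
  rewrite big_map big_seq_cond [RHS]big_seq_cond; apply: eq_bigl => m.
  by case: (boolP (m \in _)) => //=; rewrite mem_masks => /eqP/card_bset ->.
rewrite (perm_big _ perm) /= big_enum_cond /=.
by apply: eq_bigl => J; rewrite inE.
Qed.
End Sets.

(** * Soundness of the orbit computation *)

Section Soundness.
Variables (W : finGroupType) (n e : nat) (G : gen_data).
Let N := (n * e)%N.
Variables (i0 : 'I_n) (s : 'I_n -> W) (blk : 'I_N -> 'I_n) (rho : W -> 'M[Z]_N).
Hypotheses (e_gt0 : (0 < e)%N) (blkE : forall a, blk a = (a %% n)%N :> nat).
Hypotheses (rr : reflection_rep s blk rho)
  (rhoG : forall i : 'I_n, rho (s i) = gmx n e G i) (Gwf : gens_wf n e G).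

Definition ino (i : nat) : 'I_n := insubd i0 i.

Lemma inoK i : (i < n)%N -> ino i = i :> nat.
Proof. by move=> ii; rewrite /ino val_insubd ii. Qed.

Lemma n_gt0 : (0 < n)%N.
Proof. exact: leq_ltn_trans (leq0n i0) (ltn_ord i0). Qed.

Lemma ino_val (i : 'I_n) : ino i = i.
Proof. exact: valKd. Qed.

Local Notation vec := (vec_of n e).
Local Notation par := (par s).
Local Notation dominant := (dominant blk).
Local Notation zero_set := (zero_set blk).
Local Notation bset := (bset n).
Local Notation ndc := (ndc s).

Definition elt (t : seq nat) : W := wprod s [seq ino i | i <- t].

Lemma elt_rcons t i : elt (rcons t i) = (elt t * s (ino i))%g.
Proof. by rewrite /elt map_rcons wprod_rcons. Qed.

Lemma vec_act (i : nat) v : (i < n)%N -> size v = N ->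
  vec (refl_act G i v) = vec v *m rho (s (ino i)).
Proof. by move=> ii vN; rewrite vec_refl_act // rhoG inoK. Qed.

Lemma vec_word v t : size v = N -> all (fun i => i < n)%N t ->
  vec (word_act G v t) = vec v *m rho (elt t).
Proof.
move=> vN; elim/last_ind: t => [_|t i IH].
  by rewrite /elt /= wprod_nil (rr_one rr) mulmx1.
rewrite all_rcons => /andP[ii tn]; rewrite /word_act foldl_rcons -/(word_act G v t).
by rewrite vec_act ?(size_word_act Gwf) // IH // elt_rcons (rr_mul rr) mulmxA.
Qed.

Lemma leN_n i : (i < n)%N -> (i < N)%N.
Proof. by move=> ii; rewrite (leq_trans ii) // leq_pmulr. Qed.

Lemma coordsP i a : (i < n)%N -> (a \in coords n e i) = (a < N)%N && (a %% n == i)%N.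
Proof.
move=> ii; apply/mapP/andP => [[k]|[aN /eqP ai]].
  rewrite mem_iota add0n => /= ke ->; split; last by rewrite addnC mulnC modnMDl modn_small.
  have : (n * k.+1 <= n * e)%N by rewrite leq_mul2l ke orbT.
  by rewrite mulnS /N; lia.
exists (a %/ n)%N; last by rewrite -ai mulnC addnC -divn_eq.
by rewrite mem_iota add0n /= ltn_divLR ?n_gt0 // mulnC.
Qed.

Lemma nonnegP v i : (i < n)%N ->
  reflect (forall a, blk a = i :> nat -> 0 <= vec v 0 a) (nonneg n e v i).
Proof.
move=> ii; apply: (iffP allP) => H a.
  by rewrite blkE mxE => ai; apply: H; rewrite coordsP // ltn_ord; apply/eqP.
rewrite coordsP // => /andP[aN /eqP ai].
by have := H (Ordinal aN); rewrite blkE mxE /= => /(_ ai).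
Qed.

Lemma iszeroP v i : (i < n)%N ->
  reflect (forall a, blk a = i :> nat -> vec v 0 a = 0) (iszero n e v i).
Proof.
move=> ii; apply: (iffP allP) => H a.
  by rewrite blkE mxE => ai; apply/Z.eqb_eq/H; rewrite coordsP // ltn_ord; apply/eqP.
rewrite coordsP // => /andP[aN /eqP ai]; apply/Z.eqb_eq.
by have := H (Ordinal aN); rewrite blkE mxE /= => /(_ ai).
Qed.

Lemma vec_dominant (J : {set 'I_n}) v :
  reflect (forall i : 'I_n, i \in J -> nonneg n e v i) (dominant J (vec v)).
Proof.
apply: (iffP (dominantP _ _ _)) => H.
  by move=> i iJ; apply/nonnegP=> // a ai; apply: H; rewrite (val_inj ai).
by move=> a aJ; have /nonnegP := H _ aJ; apply=> //.
Qed.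

Lemma vec_zero_set (J : {set 'I_n}) v (i : 'I_n) :
  (i \in zero_set J (vec v)) = (i \in J) && iszero n e v i.
Proof.
apply/zero_setP/andP => -[iJ H]; split=> //.
  by apply/iszeroP=> // a ai; apply: H; apply: val_inj.
by move=> a ai; have /iszeroP := H; apply; rewrite // ai.
Qed.

Lemma eltsP A i : (i \in elts n A) = (i < n)%N && nth false A i.
Proof. by rewrite mem_filter mem_iota add0n andbC. Qed.

Lemma elts_ord A (i : 'I_n) : ((i : nat) \in elts n A) = (i \in bset A).
Proof. by rewrite eltsP ltn_ord inE. Qed.

Lemma blk_surj (i : 'I_n) : exists a, blk a = i.
Proof.
by exists (Ordinal (leN_n (ltn_ord i))); apply: val_inj; rewrite /= blkE /= modn_small.
Qed.

Lemma vec_ones : vec (nseq N 1%BZ) = weight blk set0.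
Proof. by apply/rowP=> a; rewrite !mxE nth_nseq ltn_ord inE. Qed.

(** Both sides move the regular vector d to the same place, and d has trivial stabiliser. *)
Lemma find_conj t (j : 'I_n) :
  let d := nseq N 1%BZ in
  let m := find (zlist_eqb (refl_act G j (word_act G d t)))
             [seq word_act G (refl_act G m d) t | m <- iota 0 n] in
  all (fun i => i < n)%N t -> (m < n)%N -> (elt t * s j = s (ino m) * elt t)%g.
Proof.
move=> d m wl mn; have dN : size d = N by rewrite size_nseq.
apply: (act_faithful rr blk_surj); rewrite -vec_ones -/d !(rr_mul rr) !mulmxA.
have jE : ino j = j :> 'I_n by rewrite ino_val.
rewrite -vec_word // -{1}jE -vec_act ?ltn_ord ?(size_word_act Gwf) //.
rewrite -vec_act // -vec_word ?(size_refl_act Gwf) //; congr vec.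
have hs : has (zlist_eqb (refl_act G j (word_act G d t)))
              [seq word_act G (refl_act G m d) t | m <- iota 0 n].
  by rewrite has_find size_map size_iota.
have /zlist_eqbP -> := nth_find [::] hs.
by rewrite (nth_map 0%N) ?size_iota // nth_iota // add0n.
Qed.

Section Orbit.
Variables (A : bitseq) (k : nat).
Let l := elts n A.
Hypothesis kA : k \in l.
Let om := vec (basis N k).
Let L := set_nth false A k false.

(** [st.1] stores the word with its last letter first, hence [rev]. *)
Definition valid_state (st : state) := (all (mem l) st.1) /\
  st.2 = [seq word_act G v (rev st.1) | v <- (state0 n e G k).2].

Lemma valid0 : valid_state (state0 n e G k).
Proof. by split=> //; rewrite /state0 /= map_id. Qed.

Lemma valid_children st st' : valid_state st -> st' \in children n e G l st -> valid_state st'.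
Proof.
case=> stl ste /mapP[i]; rewrite mem_filter => /andP[_ il] ->; split=> /=.
  by apply/andP.
rewrite ste -map_comp; apply: eq_map => v /=.
by rewrite rev_cons /word_act foldl_rcons.
Qed.

Lemma levels_valid f lvl r : levels n e G l f lvl = Some r ->
  (forall st, st \in lvl -> valid_state st) -> forall st, st \in r -> valid_state st.
Proof.
elim: f lvl r => [|f IH] [|a lvl] r //=; try by case=> <-.
case E : levels => [r'|] // -[<-] val st; rewrite inE mem_cat => /or3P[/eqP ->|stl|str].
- by apply: val; rewrite mem_head.
- by apply: val; rewrite inE stl orbT.
have nxt st' : st' \in flatten [seq children n e G l x | x <- a :: lvl] -> valid_state st'.
  by case/flatten_mapP=> y /val vy; apply: valid_children.
exact: (IH _ _ E nxt).
Qed.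

Lemma levels_sub f lvl r : levels n e G l f lvl = Some r -> {subset lvl <= r}.
Proof.
case: f lvl => [|f] [|a lvl] //=.
case: levels => [r'|] // -[<-] st; rewrite !inE mem_cat.
by case/orP=> ->; rewrite ?orbT.
Qed.

Lemma levels_closed f lvl r : levels n e G l f lvl = Some r ->
  forall st, st \in r -> {subset children n e G l st <= r}.
Proof.
elim: f lvl r => [|f IH] [|a lvl] r //=; try by case=> <-.
case E : levels => [r'|] // -[<-] st st_in st' st'c.
suff : st' \in r' by rewrite inE mem_cat => ->; rewrite !orbT.
move: st_in; rewrite -cat_cons mem_cat => /orP[stl|/(IH _ _ E)]; last exact.
have st'n : st' \in flatten [seq children n e G l x | x <- a :: lvl].
  by apply/flatten_mapP; exists st.
exact: (levels_sub E st'n).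
Qed.

Lemma size_om : size (basis N k) = N. Proof. by rewrite size_map size_iota. Qed.

Lemma k_lt : (k < n)%N. Proof. by move: kA; rewrite eltsP => /andP[]. Qed.

Lemma l_lt t : all (mem l) t -> all (fun i => i < n)%N t.
Proof. by apply: sub_all => i; rewrite /= eltsP => /andP[]. Qed.

Lemma valid_size st v : valid_state st -> v \in st.2 -> size v = N.
Proof.
case=> _ -> /mapP[u ust ->]; apply: (size_word_act Gwf).
move: ust; rewrite /= 2!in_cons => /or3P[/eqP ->|/eqP ->|/mapP[m _ ->]].
- exact: size_om.
- by rewrite size_nseq.
by apply: (size_refl_act Gwf); rewrite size_nseq.
Qed.

Lemma valid_head st : valid_state st -> vec (head [::] st.2) = om *m rho (elt (rev st.1)).
Proof.
by case=> stl ->; rewrite /= vec_word ?size_om ?all_rev ?l_lt.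
Qed.

Lemma valid_elt st : valid_state st -> elt (rev st.1) \in par (bset A).
Proof.
case=> stl _; apply: wprod_par; apply/allP=> i /mapP[j jst ->].
rewrite /= -elts_ord; move/allP: stl => /(_ j); rewrite -mem_rev => /(_ jst) jl.
have {}jl : j \in elts n A := jl.
by rewrite inoK //; move: jl; rewrite eltsP => /andP[].
Qed.

Lemma om_dominant : dominant setT om.
Proof.
apply/dominantP=> a _; rewrite mxE (nth_map 0%N) ?size_iota //.
by case: ifP.
Qed.

Lemma bsetL : bset L = bset A :\ ino k.
Proof.
apply/setP=> i; rewrite !inE nth_set_nth /= -(inj_eq val_inj) /= inoK ?k_lt //.
by case: eqP.
Qed.

Lemma om_zero : zero_set (bset A) om = bset L.
Proof.
apply/setP=> i; rewrite bsetL vec_zero_set in_setD1 andbC; congr (_ && _).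
rewrite -(inj_eq val_inj) /= inoK ?k_lt //.
apply/iszeroP/negP => // [H /eqP ik|ik a ai].
  have kN := leN_n k_lt; have := H (Ordinal kN); rewrite blkE /= modn_small ?k_lt // ik.
  by move=> /(_ erefl); rewrite mxE (nth_map 0%N) ?size_iota //= nth_iota // add0n eqxx.
rewrite mxE (nth_map 0%N) ?size_iota //= nth_iota // add0n; case: eqP => // ak.
by case: ik; rewrite -ai blkE ak modn_small ?k_lt.
Qed.

(** Induction on the length of x. If [om x] is not dominant for A, reflecting it in its first
    negative block i shortens x; the state of [om x s_i] exists by induction, and [children] accepts
    [om x] from it by the very choice of i. *)
Lemma orbit_cover f r : levels n e G l f [:: state0 n e G k] = Some r ->
  forall x, x \in par (bset A) -> exists2 st, st \in r & vec (head [::] st.2) = om *m rho x.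
Proof.
move=> lev x xA; have val := levels_valid lev.
have {}val st : st \in r -> valid_state st.
  by apply: val => st'; rewrite inE => /eqP ->; apply: valid0.
have dA : dominant (bset A) om := domS (subsetT _) om_dominant.
have [m] := ubnP (len s (bset A) x); elim: m x xA => // m IH x xA /ltnSE lx.
pose u := [seq (om *m rho x) 0 a | a <- enum 'I_N].
have uN : size u = N by rewrite size_map size_enum_ord.
have vu : vec u = om *m rho x.
  by apply/rowP=> a; rewrite mxE (nth_map a) ?size_enum_ord // nth_ord_enum.
have [hs|] := boolP (has (fun i => ~~ nonneg n e u i) l); last first.
  move/hasPn=> nn; exists (state0 n e G k).
    by apply: (levels_sub lev); rewrite inE.
  have dx : dominant (bset A) (om *m rho x).
    by rewrite -vu; apply/vec_dominant=> i iA; have := nn i; rewrite elts_ord negbK; apply.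
  by have [-> _] := dominant_unique rr xA dA dx.
pose i := first_neg n e l u.
have il : i \in l by rewrite /i /first_neg (set_nth_default 0%N) ?mem_nth -?has_find.
have ineg : ~~ nonneg n e u i.
  by rewrite /i /first_neg (set_nth_default 0%N) -?has_find //; exact: (nth_find 0%N hs).
have ii : (i < n)%N by move: il; rewrite eltsP => /andP[].
have iA : ino i \in bset A by rewrite -elts_ord inoK.
have lxi : (len s (bset A) (x * s (ino i))%g < len s (bset A) x)%N.
  rewrite ltnNge; apply: contra ineg => le; apply/nonnegP=> // a ai.
  rewrite vu mxE; apply: sumr_ge0 => b _; apply: mulr_ge0.
    by apply: (dominantP _ _ _ om_dominant); rewrite inE.
  apply: (rho_col_ge0 rr xA iA); last by apply: val_inj; rewrite /= inoK.
  by case: (len_cases rr xA iA); move: le; clear; lia.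
have xiA : (x * s (ino i))%g \in par (bset A) by rewrite (par_mul_s s x iA).
have [st str hd] := IH _ xiA (leq_trans lxi lx).
have stN : size (head [::] st.2) = N.
  have := val _ str; move=> v; apply: (valid_size v).
  by case: v => _ ->; rewrite mem_head.
have au : refl_act G i (head [::] st.2) = u.
  apply: (@vec_of_inj n e) => //; first exact: (size_refl_act Gwf).
  by rewrite vec_act // hd vu -mulmxA -(rr_mul rr) (sK rr).
exists (i :: st.1, [seq refl_act G i v | v <- st.2]).
  apply: (levels_closed lev str); apply/mapP; exists i => //.
  by rewrite mem_filter il andbT; apply/eqP; rewrite au.
by case: (val _ str) => _ sE; move: au; rewrite sE /= => ->.
Qed.

Lemma hash_uniq (sts : seq state) : sorted_hashes sts ->
  uniq [seq head [::] st.2 | st <- sts].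
Proof.
move=> so; apply: (@map_uniq _ _ hash); rewrite -map_comp -(sort_uniq Z.leb).
apply: sorted_uniq so => [x y z|x]; last exact: Z.ltb_irrefl.
by move=> /Z.ltb_lt a /Z.ltb_lt b; apply/Z.ltb_lt; apply: Z.lt_trans a b.
Qed.

Lemma sigmaP st (j : 'I_n) : valid_state st -> (sigma G st j < n)%N ->
  (elt (rev st.1) * s j = s (ino (sigma G st j)) * elt (rev st.1))%g.
Proof.
move=> [stl stE]; rewrite /sigma stE /= drop0 -map_comp => sn.
by apply: find_conj sn; rewrite all_rev l_lt.
Qed.

(** Instance of [ndc_restrict] for the fundamental weight k, whose stabiliser in A is A without k;
    [state_ok] supplies the hypothesis on conjugates. *)
Lemma infos_sound inf : infos n e G A k = Some inf ->
  forall (J : bitseq) (I : {set 'I_n}), submask J A -> I \subset bset L ->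
  ndc (bset A) I (bset J) =
  (\sum_(y <- inf | submask J y.1) ndc (bset L) I (bset (img_mask J y.2)))%N.
Proof.
rewrite /infos -/l kA andbT; case: eqP => // An.
case lev : levels => [sts|] //; case: ifP => // /andP[so ok] -[<-].
move=> J I sJA IL; rewrite big_map.
have JA : bset J \subset bset A.
  by apply/subsetP=> i; rewrite !inE; apply/submaskP.
have val st : st \in sts -> valid_state st.
  by apply: (levels_valid lev) => st'; rewrite inE => /eqP ->; apply: valid0.
pose dd (st : state) := elt (rev st.1).
have ddE st : st \in sts -> om *m rho (dd st) = vec (head [::] st.2).
  by move=> /val/valid_head ->.
have uom : uniq [seq om *m rho d | d <- [seq dd st | st <- sts]].
  have -> : [seq om *m rho d | d <- [seq dd st | st <- sts]] =
      [seq vec u | u <- [seq head [::] st.2 | st <- sts]].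
    by rewrite -!map_comp; apply/eq_in_map => st /ddE.
  rewrite map_inj_in_uniq ?hash_uniq // => u v /mapP[st1 st1s ->] /mapP[st2 st2s ->].
  have szh st : st \in sts -> size (head [::] st.2) = N.
    by move=> /val v0; apply: (valid_size v0); case: v0 => _ ->; rewrite mem_head.
  by apply: vec_of_inj; apply: szh.
have udd : uniq [seq dd st | st <- sts] by apply: map_uniq uom.
pose st0 : state := ([::], [::]).
(* [ndc_restrict] wants the subset as a function of the group element, so the state is recovered
   from its index; by [udd] the elements are distinct. *)
pose Kf (d : W) := bset (img_mask J (info n e G (nth st0 sts (index d [seq dd st | st <- sts]))).2).
have KfE st : st \in sts -> Kf (dd st) = bset (img_mask J (info n e G st).2).
  move=> sts_in; have lt : (index st sts < size sts)%N by rewrite index_mem.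
  rewrite /Kf -{1}(nth_index st0 sts_in) -(nth_map st0 (dd st0)) //.
  by rewrite index_uniq ?size_map // nth_index.
rewrite (ndc_restrict rr (om := om) (L := bset L) (ds := [seq dd st | st <- sts]) (K := Kf)) //.
- rewrite big_map big_seq_cond [RHS]big_seq_cond; apply: eq_big => [st|st /andP[sin _]].
    case: (boolP (st \in sts)) => //= sin; rewrite ddE //.
    apply/vec_dominant/submaskP => H i.
      case: (ltnP i n) => ii Ji.
        rewrite (nth_map 0%N) ?size_iota // nth_iota // add0n.
        by apply: (H (Ordinal ii)); rewrite inE.
      by move/submaskP: sJA => /(_ i Ji); rewrite nth_default // An.
    rewrite inE => /H; rewrite (nth_map 0%N) ?size_iota ?ltn_ord // nth_iota ?ltn_ord //.
  by rewrite KfE.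
- exact: om_dominant.
- exact: om_zero.
- by move=> d /mapP[st sin ->]; apply/valid_elt/val.
- move=> x xA; have [st sin hd] := orbit_cover lev xA.
  by exists (dd st); rewrite ?map_f // ddE.
move=> d /mapP[st sin ->] dom; rewrite KfE // ddE //.
have vst := val _ sin.
have okj (j : 'I_n) : j \in bset A -> iszero n e (head [::] st.2) j ->
    (sigma G st j < n)%N.
  move=> jA jz; have /allP/(_ _ sin)/allP/(_ j) := ok.
  rewrite /l elts_ord jA jz => /(_ isT) /andP[+ _].
  by rewrite eltsP => /andP[].
apply/setP=> x; apply/imsetP/imsetP => [[j jz ->]|[m]].
  move: jz; rewrite vec_zero_set => /andP[jJ jz].
  have mlt := okj j (subsetP JA j jJ) jz.
  exists (ino (sigma G st j)).
    rewrite inE; apply/nth_img_mask; exists j; move: jJ; rewrite inE => -> /=.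
    rewrite (nth_map 0%N) ?size_iota ?ltn_ord // nth_iota ?ltn_ord // add0n jz.
    by rewrite (nth_map 0%N) ?size_iota ?ltn_ord // nth_iota ?ltn_ord // add0n inoK.
  by rewrite /conjg invgK mulgA sigmaP // mulgK.
rewrite inE => /nth_img_mask[j /andP[Jj]].
have [jn|jn] := ltnP j n; last by rewrite [nth [::] _ j]nth_default ?nth_nil // size_map size_iota.
rewrite (nth_map 0%N) ?size_iota // nth_iota // add0n.
case: ifP => jz; last by rewrite nth_nil.
rewrite (nth_map 0%N) ?size_iota ?ltn_ord // nth_iota ?ltn_ord // add0n => /eqP mE ->.
have jJ : Ordinal jn \in bset J by rewrite inE.
exists (Ordinal jn); first by rewrite vec_zero_set jJ.
have mlt := okj (Ordinal jn) (subsetP JA _ jJ) jz.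
rewrite /conjg invgK mulgA sigmaP // mulgK; congr (s _); apply: val_inj.
by rewrite /= inoK // mE.
Qed.

End Orbit.

Lemma ndc_full (A J : {set 'I_n}) : J \subset A -> ndc A A J = 1%N.
Proof.
move=> JA; rewrite /ndc; apply/eqP/cards1P; exists (par A : {set W}).
apply/setP=> D; apply/imsetP/set1P => [[x xA ->]|->].
  by rewrite rcoset_id // mulGSid // par_sub.
by exists 1%g; rewrite ?group1 // rcoset_id ?group1 // mulGSid // par_sub.
Qed.

Definition face_count (I : {set 'I_n}) q : nat :=
  (\sum_(J : {set 'I_n} | #|J| == q) ndc setT I J)%N.

Definition meta_entry p q : nat := (\sum_(I : {set 'I_n} | #|I| == p) face_count I q)%N.

Fixpoint all_prop T (P : T -> Prop) (l : seq T) : Prop :=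
  if l is x :: l' then P x /\ all_prop P l' else True.

Lemma lookup_prop T (P : bitseq * T -> Prop) tab A t :
  all_prop P tab -> lookup tab A = Some t -> P (A, t).
Proof.
by elim: tab => //= -[B u] tab IH [PB Ptab]; case: eqP => [-> [<-]|_ /(IH Ptab)].
Qed.

Section Tables.
Variable q0 : nat.

(** The trie depends on A alone and serves every I inside A at once, so a single orbit enumeration
    per step is enough. *)
Definition valid_trie (x : bitseq * trie) :=
  all (fun Jc => submask Jc.1 x.1) (telems [::] x.2) /\
  forall (I : {set 'I_n}) q, I \subset bset x.1 -> (q0 <= q)%N ->
    wsum q (fun K => (ndc (bset x.1) I (bset K))%:R) (telems [::] x.2) = (face_count I q)%:R.

Definition valid_counts (x : bitseq * seq Z) :=
  forall q, (q0 <= q)%N -> nth 0 x.2 q = (face_count (bset x.1) q)%:R.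

Lemma mass_valid A t : valid_trie (A, t) -> valid_counts (A, mass t).
Proof.
case=> /= keys sums q qq; rewrite nth_mass -(sums _ q (subxx _) qq) /wsum.
rewrite big_seq [RHS]big_seq; apply: eq_bigr => x /(allP keys) /submaskP sub.
rewrite ndc_full //; apply/subsetP=> i; rewrite !inE; exact: sub.
Qed.

Lemma restrict_valid A k t inf : valid_trie (A, t) -> infos n e G A k = Some inf ->
  all (fun Jc => submask Jc.1 (set_nth false A k false)) (telems [::] (tres inf t)) ->
  valid_trie (set_nth false A k false, tres inf t).
Proof.
move=> [/= keys sums] infE keys'; split=> // I q IL qq.
have kA : k \in elts n A by move: infE; rewrite /infos; case: ifP => // /andP[].
have LA : bset (set_nth false A k false) \subset bset A by rewrite bsetL // subD1set.
rewrite wsum_tres -(sums I q (subset_trans IL LA) qq) /wsum big_seq [RHS]big_seq.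
apply: eq_bigr => x /(allP keys) sub; congr (_ * _).
by rewrite (infos_sound kA infE sub IL) natr_sum.
Qed.

Lemma run_restrict_valid tab steps res : all_prop valid_trie tab ->
  run_restrict n e G tab steps = Some res -> all_prop valid_counts res.
Proof.
elim: steps tab => [|[A k] steps IH] tab vtab /=.
  case=> <-; elim: tab vtab => //= -[A t] tab IHt [vA vtab]; split; last exact: IHt.
  exact: mass_valid.
case E : lookup => [t|] //; case infE : infos => [inf|] //; case: ifP => // keys.
by apply: IH; split=> //; apply: restrict_valid => //; apply: lookup_prop E.
Qed.

Lemma restrict_table_valid steps res :
  restrict_table n e G q0 steps = Some res -> all_prop valid_counts res.
Proof.
rewrite /restrict_table; case: ifP => // keys; apply: run_restrict_valid; split=> //.
have bT : bset (nseq n true) = setT.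
  by apply/setP=> i; rewrite !inE nth_nseq ltn_ord.
have gen F q : wsum q F (telems [::] (trie0 n q0)) =
   \sum_(J <- masks n | (q0 <= count id J)%N && (count id J == q)) F J.
  rewrite /trie0; elim: (masks n) => [|J l IH] /=; first by rewrite /wsum !big_nil.
  rewrite big_cons -IH; case: ifP => //= _.
  rewrite wsum_tadd nth_rcons size_nseq nth_nseq /=.
  by case: ltngtP => [qc|qc|->]; rewrite ?mul0r ?add0r ?mul1r.
split=> //= I q _ qq; rewrite gen bT /face_count.
rewrite (eq_bigl (fun J => count id J == q)) => [|J]; last first.
  by case: eqP => [->|]; rewrite ?andbF // qq.
rewrite -natr_sum; congr (_%:R); exact: (@sum_masks n (ndc setT I) (fun c => c == q)).
Qed.

(** Conjugate left parabolics have equally many double cosets with each fixed [par J]. *)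
Lemma conj_valid I0 w I1 q : conj_ok n e G I0 w I1 ->
  face_count (bset I0) q = face_count (bset I1) q.
Proof.
case/and3P=> wn im1 im2; apply: eq_bigr => J _; symmetry; rewrite /ndc.
rewrite (par_setT rr); apply: (@dcosets_conj _ _ _ _ ((elt w)^-1)%g); symmetry.
pose m (i : nat) := find (zlist_eqb (refl_act G i (word_act G (nseq N 1%BZ) w)))
             [seq word_act G (refl_act G m (nseq N 1%BZ)) w | m <- iota 0 n].
have conj (i : 'I_n) : i \in bset I0 -> (s i ^ (elt w)^-1)%g = s (ino (m i)) /\ m i \in elts n I1.
  move=> iI; have mi : m i \in elts n I1.
    by apply: (allP im1); apply: (map_f m); rewrite elts_ord.
  split=> //; rewrite /conjg invgK mulgA.
  by rewrite find_conj ?mulgK //; move: mi; rewrite eltsP => /andP[].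
apply: par_conj; apply/setP=> x; apply/imsetP/imsetP => [[i iI ->]|[j jI ->]].
  case: (conj i iI) => -> mi; exists (ino (m i)) => //.
  by rewrite -elts_ord inoK //; move: mi; rewrite eltsP => /andP[].
move: jI; rewrite -elts_ord => /(allP im2)/mapP[i iI jE].
have ii : (i < n)%N by move: iI; rewrite eltsP => /andP[].
exists (Ordinal ii); first by rewrite -elts_ord.
case: (conj (Ordinal ii)) => [|-> _]; first by rewrite -elts_ord.
by rewrite -[j in LHS]ino_val; congr (s (ino _)); exact: jE.
Qed.

Lemma run_conj_valid tab steps res : all_prop valid_counts tab ->
  run_conj n e G tab steps = Some res -> all_prop valid_counts res.
Proof.
elim: steps tab => [|[[I0 w] I1] steps IH] tab vtab /=; first by case=> <-.
case E : lookup => [c|] //; case: ifP => // ok; apply: IH; split=> // q qq.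
by rewrite (conj_valid q ok) -(lookup_prop vtab E).
Qed.

Lemma row_sum_valid tab p r q : all_prop valid_counts tab -> row_sum n tab p = Some r ->
  (q0 <= q)%N -> nth 0 r q = (meta_entry p q)%:R.
Proof.
move=> vtab rE qq; rewrite /meta_entry -(@sum_masks n (face_count^~ q) (fun c => c == p)).
rewrite natr_sum; move: r rE; rewrite /row_sum; elim: (masks n) => [|J l IH] r /=.
  by case=> <-; rewrite big_nil nth_nil.
rewrite big_cons; case: ifP => // _; last exact: IH.
case E : lookup => [c|] //; case F : (foldr _ _ _) => [a|] // -[<-].
by rewrite nth_zlist_add (IH _ F) (lookup_prop vtab E).
Qed.
End Tables.

Lemma meta_sym p q : meta_entry p q = meta_entry q p.
Proof.
rewrite /meta_entry /face_count exchange_big /=.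
by apply: eq_bigr => I _; apply: eq_bigr => J _; apply: ndc_sym.
Qed.

Lemma card_set_le (J : {set 'I_n}) : (#|J| <= n)%N.
Proof. by have := max_card (mem J); rewrite card_ord. Qed.

Lemma meta_last q : meta_entry n q = 'C(n, q).
Proof.
rewrite /meta_entry (big_pred1 setT) => [|I]; last first.
  by rewrite /= eqEcard subsetT cardsT card_ord /= eqn_leq card_set_le.
rewrite /face_count (eq_bigr (fun=> 1%N)) => [|J _]; last by rewrite ndc_full ?subsetT.
have := card_draws 'I_n q; rewrite card_ord => <-.
by rewrite -sum1_card; apply: eq_bigl => J; rewrite !inE.
Qed.

Lemma meta_alternating p : (0 < p)%N ->
  \sum_(0 <= q < n.+1) (-1) ^+ q * (meta_entry p q)%:R = 0 :> Z.
Proof.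
move=> p0; rewrite big_mkord.
transitivity (\sum_(I : {set 'I_n} | #|I| == p)
    \sum_(J : {set 'I_n}) (-1) ^+ #|J| * (ndc setT I J)%:R : Z); last first.
  apply: big1 => I /eqP Ip; apply: (ndc_alternating rr blk_surj).
  by rewrite -card_gt0 Ip.
under eq_bigr do rewrite natr_sum big_distrr /=.
rewrite exchange_big; apply: eq_bigr => I _.
have le (J : {set 'I_n}) : (#|J| < n.+1)%N by rewrite ltnS card_set_le.
rewrite [RHS](partition_big (fun J => Ordinal (le J)) predT) //=.
apply: eq_bigr => q _; rewrite /face_count natr_sum big_distrr /=.
by apply: eq_big => [J|J /eqP <-].
Qed.

Theorem meta_check_sound rs rsh cj M : (2 < n)%N -> meta_check n e G rs rsh cj M ->
  forall p q, (p <= n)%N -> (q <= n)%N -> (meta_entry p q)%:R = nth 0 (nth [::] M p) q.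
Proof.
move=> n2 /and5P[c1 c2 c3 c4 c5].
pose ent p q := nth 0 (nth [::] M p) q.
have low p q : (p < n - 2)%N -> (meta_entry p q)%:R = ent p q.
  move=> pn; move: c1; case E1 : restrict_table => [tab|] //.
  case E2 : run_conj => [tab'|] // /allI/(_ _ pn).
  case E3 : row_sum => [r|] // /zlist_eqbP rE; rewrite /ent -rE.
  symmetry; apply: (@row_sum_valid 0 tab') E3 (leq0n _).
  apply: run_conj_valid E2; exact: restrict_table_valid E1.
have mid q : (n - 2 <= q < n)%N -> (meta_entry (n - 2)%N q)%:R = ent (n - 2)%N q.
  move=> /andP[qn qn']; move: c2; case E1 : restrict_table => [tab|] //.
  case E2 : run_conj => [tab'|] //; case E3 : row_sum => [r|] // /allP/(_ q).
  rewrite mem_iota qn => /= H; have /Z.eqb_eq <- : Z.eqb (nth 0 r q) (ent (n - 2)%N q).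
    by apply: H; lia.
  symmetry; apply: (@row_sum_valid (n - 2)%N tab') E3 qn.
  apply: run_conj_valid E2; exact: restrict_table_valid E1.
have entC p q : (p <= n)%N -> (q <= n)%N -> ent p q = ent q p.
  by move=> pn qn; apply/Z.eqb_eq; apply: (allI (allI c3 (i := p) _)).
have lastr q : (q <= n)%N -> (meta_entry n q)%:R = ent n q.
  move=> qn; rewrite meta_last; symmetry.
  have /Z.eqb_eq H := allI c4 (i := q) qn; rewrite /ent [LHS]H; lia.
have sym p q : (p <= n)%N -> (q <= n)%N ->
    (meta_entry p q)%:R = ent p q -> (meta_entry q p)%:R = ent q p.
  by move=> pn qn; rewrite meta_sym entC.
have all_but p q : (p <= n)%N -> (q <= n)%N -> (p, q) != (n.-1, n.-1) ->
    (meta_entry p q)%:R = ent p q.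
  move=> pn qn pq.
  have [?|p2] := ltnP p (n - 2); first exact: low.
  have [?|q2] := ltnP q (n - 2); first by apply: sym => //; apply: low.
  have [->|pn'] := eqVneq p n; first exact: lastr.
  have [->|qn'] := eqVneq q n; first by apply: sym => //; apply: lastr.
  have [->|p3] := eqVneq p (n - 2)%N; first by apply: mid; lia.
  have [->|q3] := eqVneq q (n - 2)%N; first by apply: sym; try lia; apply: mid; lia.
  by case/eqP: pq; congr (_, _); lia.
(* The remaining entry: row n - 1 of the metamatrix and of the table have the same alternating sum 0
   and agree at all other places. *)
move=> p q pn qn; have [[-> ->]|] := eqVneq (p, q) (n.-1, n.-1); last exact: all_but.
have n1 : (0 < n.-1)%N by lia.
have alt := meta_alternating n1.
have alt' : \sum_(0 <= q < n.+1) (-1) ^+ q * ent n.-1 q = 0.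
  move/Z.eqb_eq: c5 => c5; refine (etrans _ c5); rewrite /index_iota subn0.
  elim: (iota 0 n.+1) => [|x l IH]; first by rewrite big_nil.
  rewrite big_cons IH /= -signr_odd addrC.
  by case: (odd x); rewrite ?expr1 ?expr0 ?mulN1r ?mul1r.
move: alt; rewrite -[RHS]alt' !big_mkord.
have kn : (n.-1 < n.+1)%N by lia.
rewrite (bigD1 (Ordinal kn)) //= [RHS](bigD1 (Ordinal kn)) //=.
rewrite (eq_bigr (fun i : 'I_n.+1 => (-1) ^+ i * ent n.-1 i)) => [/addIr|i ik].
  by apply: mulfI; rewrite signr_eq0.
have pi : (i <= n)%N by rewrite -ltnS ltn_ord.
have ne : (n.-1, (i : nat)) != (n.-1, n.-1).
  by apply: contraNneq ik => -[ie]; apply/eqP/val_inj.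
by rewrite (all_but _ _ (leq_pred n) pi ne).
Qed.
End Soundness.

Lemma metamatrixE (R : realFieldType) (W : finGroupType) (S : {set W}) n (s : 'I_n -> W)
    (i j : 'I_(#|S|.+1)) :
  injective s -> s @: setT = S -> <<S>>%g = [set: W] ->
  contingency_metamatrix R S i j = (meta_entry s i j)%:R.
Proof.
move=> s_inj sS gen; rewrite mxE; congr (_%:R).
have reix p (F : {set W} -> nat) : (\sum_(I : {set W} | (I \subset S) && (#|I| == p)) F I =
    \sum_(I : {set 'I_n} | #|I| == p) F [set s x | x in I])%N.
  rewrite (reindex_onto (fun I : {set 'I_n} => [set s x | x in I])
             (fun I : {set W} => s @^-1: I)) /=; last first.
    move=> I /andP[IS _]; apply/setP=> x; apply/imsetP/idP => [[y]|xI].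
      by rewrite inE => yI ->.
    have := subsetP IS x xI; rewrite -sS => /imsetP[y _ xE].
    by exists y; rewrite // inE -xE.
  apply: eq_bigl => I; rewrite card_imset // -sS imsetS ?subsetT //=.
  suff -> : s @^-1: [set s x | x in I] == I by rewrite andbT.
  by apply/eqP/setP=> x; rewrite inE mem_imset.
rewrite reix; apply: eq_bigr => I _; rewrite reix; apply: eq_bigr => J _.
rewrite /ndc /dcosets /double_cosets; congr #|pred_of_set _|.
by rewrite /par /= sS gen.
Qed.

(** * Rational certificates of total positivity *)

Definition zr (R : realFieldType) (z : Z) : R := (int_of_Z z)%:~R.

Section NumericTP.
Variable R : realFieldType.
Local Notation zr := (zr R).

Lemma zr_add x y : zr (Z.add x y) = zr x + zr y.
Proof. by rewrite /zr -[Z.add x y]/(x + y) rmorphD rmorphD. Qed.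
Lemma zr_mul x y : zr (Z.mul x y) = zr x * zr y.
Proof. by rewrite /zr -[Z.mul x y]/(x * y) rmorphM rmorphM. Qed.
Lemma zr_nat k : zr k%:R = k%:R.
Proof. by rewrite /zr !rmorph_nat. Qed.
Lemma zr_gt0 z : Z.ltb 0 z -> 0 < zr z.
Proof. by move=> z0; rewrite /zr ltr0z; lia. Qed.

Definition qr (x : Q) : R := zr (Qnum x) / zr (Zpos (Qden x)).

Lemma zr_pos p : zr (Zpos p) != 0.
Proof. by rewrite gt_eqF // zr_gt0. Qed.

Lemma qr_eq x y : Qeq_bool x y -> qr x = qr y.
Proof.
move=> /Qeq_bool_iff; rewrite /Qeq => e; apply/eqP.
by rewrite eqr_div ?zr_pos // -!zr_mul e.
Qed.

Lemma qr_add x y : qr (Qplus x y) = qr x + qr y.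
Proof.
rewrite /qr addf_div ?zr_pos // /Qplus /= zr_add !zr_mul; congr (_ / _).
by rewrite -zr_mul.
Qed.

Lemma qr_mul x y : qr (Qmult x y) = qr x * qr y.
Proof. by rewrite /qr mulf_div /Qmult /= -!zr_mul. Qed.

Lemma qr_gt0 x : Z.ltb 0 (Qnum x) -> 0 < qr x.
Proof. by move=> x0; rewrite /qr divr_gt0 // zr_gt0. Qed.

Lemma qr_inject z : qr (inject_Z z) = zr z.
Proof. by rewrite /qr /= (zr_nat 1) divr1. Qed.

Definition qmat (M : seq (seq Q)) (i j : nat) : Q := nth (inject_Z 0) (nth [::] M i) j.

(* One factor of the bidiagonal factorization: the superdiagonal b of A, and
   the blocks d, G of the middle factor. *)
Definition tp_level := (seq Q * Q * seq (seq Q))%type.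

Definition blockQ (d : Q) (G : seq (seq Q)) (i j : nat) : Q :=
  match i, j with 0, 0 => d | i'.+1, j'.+1 => qmat G i' j' | _, _ => inject_Z 0 end.

Fixpoint tp_check (N : nat) (M : seq (seq Q)) (cert : seq tp_level) : bool :=
  if N is N'.+1 then
    if cert is (bs, d, G) :: cert' then
      let b := nth (inject_Z 0) bs in let Y := blockQ d G in
      [&& Z.ltb 0 (Qnum d), all (fun i => Z.ltb 0 (Qnum (b i))) (iota 0 N'),
          Qeq_bool (b N') (inject_Z 0),
          all (fun i => all (fun j => Qeq_bool (qmat M i j)
            (Qplus (Qplus (Y i j) (Qmult (b j) (Y i j.+1)))
                   (Qmult (b i) (Qplus (Y i.+1 j) (Qmult (b j) (Y i.+1 j.+1))))))
            (iota 0 N)) (iota 0 N) &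
          tp_check N' G cert']
    else false
  else true.

Lemma tp_check_sound N M cert : tp_check N M cert ->
  tp_upto N (fun i j => qr (qmat M i j)).
Proof.
elim: N M cert => [|N IH] M cert; first by move=> _; apply: tp_upto0.
case: cert => [|[[bs d] G] cert] //.
rewrite /tp_check -/tp_check => /and5P[d0 b0 bN eqs /IH tpG].
pose b i := qr (nth (inject_Z 0) bs i).
have qr0 : qr (inject_Z 0) = 0 by rewrite qr_inject (zr_nat 0).
apply: (@eq_tp_upto _ _ (bidiag_conj (fun=> 1) b (block_extend (qr d) (fun i j => qr (qmat G i j))))).
  move=> i j iN jN; rewrite (qr_eq (allI (allI eqs iN) jN)).
  rewrite /bidiag_conj /bidiag_row !(qr_add, qr_mul) /block_extend /blockQ !mul1r.
  by case: i j {iN jN} => [|i] [|j] /=; rewrite ?qr0.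
apply: tp_bidiag_conj => //; first exact: qr_gt0.
- by move=> i iN; apply: qr_gt0; apply: allI b0 _ iN.
by rewrite /b (qr_eq bN).
Qed.
End NumericTP.

(** * Producing the certificates *)

Definition qscale (c : Q) (v : seq Q) : seq Q := [seq Qred (Qmult c x) | x <- v].
Definition qsubv (u v : seq Q) : seq Q := [seq Qred (Qminus x.1 x.2) | x <- zip u v].

(* M = L D L^T with L unit lower triangular; returns the pairs of an entry of D
   and the part of the corresponding column of L on and below the diagonal. *)
Fixpoint ldl (fuel : nat) (M : seq (seq Q)) : seq (Q * seq Q) :=
  if fuel is f.+1 then
    if M is (d :: r) :: M' then
      let c := [seq head (inject_Z 0) row | row <- M'] in
      let l := qscale (Qinv d) c in
      (d, inject_Z 1 :: l) ::
      ldl f [seq qsubv (behead x.1) (qscale x.2 c) | x <- zip M' l]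
    else [::]
  else [::].

(** Solves $U = B (1 \oplus U')$ row by row, with U and U' unit upper triangular and B unit
    bidiagonal: a row of U without its first entry is the previous row of U' plus b times the next
    one, and b is the entry that normalises the diagonal. *)
Fixpoint peel (prev : seq Q) (r : nat) (U : seq (seq Q)) : seq (Q * seq Q) :=
  if U is row :: U' then
    if U' is [::] then [::] else
    let t := qsubv (behead row) prev in
    let b := nth (inject_Z 0) t r in
    let u := qscale (Qinv b) t in
    (b, u) :: peel u r.+1 U'
  else [::].

Definition udu (D : seq Q) (U : seq (seq Q)) : seq (seq Q) :=
  [seq [seq foldr (fun x acc => Qred (Qplus acc (Qmult x.1 (Qmult x.2.1 x.2.2)))) (inject_Z 0)
          (zip D (zip u v)) | v <- U] | u <- U].

Fixpoint mk_cert (fuel : nat) (D : seq Q) (U : seq (seq Q)) : seq tp_level :=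
  if fuel is f.+1 then
    if D is d :: D' then
      let p := peel (nseq (size D') (inject_Z 0)) 0 U in
      let U' := [seq x.2 | x <- p] in
      (rcons [seq x.1 | x <- p] (inject_Z 0), d, udu D' U') :: mk_cert f D' U'
    else [::]
  else [::].

(** Reversing rows and columns turns $L D L^T$ into $U D U^T$ with U upper triangular, from which
    the bidiagonal factors are peeled. This is an oracle: [tp_check] verifies its output. *)
Definition tp_cert (N : nat) (M : seq (seq Z)) : seq tp_level :=
  let l := ldl N [seq [seq inject_Z x | x <- r] | r <- M] in
  let cols := [seq nseq (N - size x.2) (inject_Z 0) ++ x.2 | x <- l] in
  let U := [seq rev [seq nth (inject_Z 0) c i | c <- cols] | i <- rev (iota 0 N)] in
  mk_cert N (rev [seq x.1 | x <- l]) U.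

Definition rev_mat (M : seq (seq Z)) := rev [seq rev [seq inject_Z x | x <- r] | r <- M].

Lemma exceptional_tp (R : realFieldType) (W : finGroupType) (S : {set W}) n e G E
    rs rsh cj M :
  coxeter_system S -> has_coxeter_matrix S (diagram_matrix n.+1 E) ->
  gens_wf n.+1 e.+1 G -> sys_check n.+1 e.+1 G E -> (2 < n.+1)%N ->
  meta_check n.+1 e.+1 G rs rsh cj M ->
  (size M == n.+2) && all (fun r => size r == n.+2) M ->
  tp_check n.+2 (rev_mat M) (tp_cert n.+2 M) ->
  totally_positive (contingency_metamatrix R S).
Proof.
move=> hWS hS Gwf sysc n2 meta szM tpc.
have [s [s_inj sS [rho rr rhoG]]] := sys_rep hWS hS Gwf sysc.
have gen : <<S>>%g = [set: W] by case: hWS.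
have SE : #|S| = n.+1 by rewrite -sS card_imset // cardsT card_ord.
have val := meta_check_sound ord0 (ltn0Sn e) (@blkfE n e.+1) rr rhoG Gwf n2 meta.
apply: (@tp_upto_mx _ _ (fun i j => zr R (nth 0 (nth [::] M i) j))) => [i j|].
  have le (x : 'I_(#|S|.+1)) : (x <= n.+1)%N by rewrite -SE -ltnS ltn_ord.
  by rewrite (metamatrixE _ _ _ s_inj sS gen) -zr_nat val ?le.
rewrite SE; apply: tp_upto_rev.
apply: eq_tp_upto (tp_check_sound R tpc) => i j iN jN.
case/andP: szM => /eqP sM /allP szr.
have iM : (i < size M)%N by rewrite sM.
have iM' : (size M - i.+1 < size M)%N by rewrite ltn_subrL sM.
rewrite /qmat /rev_mat nth_rev ?size_map // (nth_map [::]) //.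
have sr : size (nth [::] M (size M - i.+1)) = n.+2 by apply/eqP/szr/mem_nth.
have jr : (n.+2 - j.+1 < n.+2)%N by rewrite ltn_subrL.
rewrite nth_rev ?size_map ?sr // (nth_map 0) ?sr //.
by rewrite [LHS]qr_inject sM !subSS.
Qed.

(** * Data and verification for the exceptional types *)

Definition gens_E6 : gen_data := ([:: [:: (0%N, [:: 2; 0; (-1); 0; 0; 0])]; [:: (1%N, [:: 0; 2;
  0; (-1); 0; 0])]; [:: (2%N, [:: (-1); 0; 2; (-1); 0; 0])]; [:: (3%N, [:: 0; (-1); (-1); 2;
  (-1); 0])]; [:: (4%N, [:: 0; 0; 0; (-1); 2; (-1)])]; [:: (5%N, [:: 0; 0; 0; 0; (-1);
  2])]])%BZ.
(** A step (A, k) passes from A to A without k; subsets are coded in binary, vertex 0 being the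
    lowest bit. The subsets not reached in this way are conjugated to reached ones by [conj_E6]. *)
Definition restr_E6 : seq (nat * nat) := ([:: (63, 0); (62, 4); (62, 3); (46, 5); (54, 5); (54,
  1); (22, 4); (52, 2); (6, 1); (4, 2)])%N.
(** The steps for row n - 2 alone, run with the formal sum cut off below |J| = n - 2. *)
Definition restr_hi_E6 : seq (nat * nat) := ([:: (63, 1); (63, 0); (61, 5); (61, 3); (61, 2);
  (62, 5); (62, 3)])%N.
Definition conj_E6 : seq (nat * seq nat * nat) := ([:: (1, [:: 0; 2], 4); (8, [:: 3; 2], 4); (2,
  [:: 3; 2; 1; 3], 4); (16, [:: 3; 4; 2; 3], 4); (32, [:: 3; 4; 5; 2; 3; 4], 4); (3, [:: 0; 2],
  6); (9, [:: 0; 2; 3; 1], 6); (17, [:: 0; 2; 3; 4; 1; 3], 6); (20, [:: 0; 2; 3; 4; 1; 3; 2; 0],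
  6); (33, [:: 0; 2; 3; 4; 5; 1; 3; 4], 6); (36, [:: 0; 2; 3; 4; 5; 1; 3; 4; 2; 0], 6); (40, [::
  0; 2; 3; 4; 5; 1; 3; 4; 2; 3; 0; 2], 6); (34, [:: 0; 2; 3; 4; 5; 1; 3; 4; 2; 3; 0; 2; 1; 3],
  6); (18, [:: 0; 2; 3; 4; 5; 1; 3; 4; 2; 3; 0; 2; 1; 3; 4; 5], 6); (24, [:: 3; 4; 5], 48); (10,
  [:: 3; 4; 5; 1; 3; 4], 48); (12, [:: 3; 4; 5; 2; 3; 4], 48); (5, [:: 3; 4; 5; 2; 3; 4; 0; 2;
  3], 48); (49, [:: 0; 2], 52); (44, [:: 3; 4; 5; 2; 3; 4], 52); (37, [:: 3; 4; 5; 2; 3; 4; 0;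
  2; 3], 52); (42, [:: 3; 4; 5; 2; 3; 4; 1; 3; 2], 52); (50, [:: 3; 2; 1; 3; 4; 5; 3; 2; 1; 3;
  4; 3; 2; 1; 3], 52); (21, [:: 0; 2; 3; 4; 5; 2; 3; 4; 0; 2; 3], 52); (25, [:: 0; 2; 3; 4; 5],
  52); (11, [:: 0; 2; 3; 4; 5; 1; 3; 4], 52); (7, [:: 0; 2; 3; 4; 5; 1; 3; 4; 2; 3; 0; 2; 1; 3],
  52); (19, [:: 0; 2], 22); (38, [:: 5; 4], 22); (35, [:: 5; 4; 0; 2], 22); (41, [:: 5; 4; 0; 2;
  3; 1], 22); (13, [:: 0; 2; 3; 1], 14); (28, [:: 0; 2; 3; 4; 1; 3; 2; 0], 14); (56, [:: 0; 2;
  3; 4; 5; 1; 3; 4; 2; 3; 0; 2], 14); (26, [:: 0; 2; 3; 4; 5; 1; 3; 4; 2; 3; 0; 2; 1; 3; 4; 5],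
  14); (15, [:: 1; 3; 4; 2; 3; 0; 2; 1; 3; 4], 29); (60, [:: 5; 4; 3; 2; 0], 29); (58, [:: 5; 4;
  3; 2; 1; 3; 4; 5; 0; 2; 3; 4; 1; 3; 2], 29); (51, [:: 0; 2], 54); (43, [:: 0; 2; 3; 4; 5; 1;
  3; 4], 54); (39, [:: 0; 2; 3; 4; 5; 1; 3; 4; 2; 3; 0; 2; 1; 3], 54); (23, [:: 0; 2; 3; 4; 5;
  1; 3; 4; 2; 3; 0; 2; 1; 3; 4; 5], 54); (27, [:: 1; 3; 4; 5], 57); (45, [:: 2; 3; 4; 5; 0; 2;
  3; 4], 57); (46, [:: 2; 3; 4; 5; 0; 2; 3; 4; 1; 3; 2; 0], 57)])%N.
Definition meta_E6 : seq (seq Z) := ([:: [:: 51840; 155520; 172800; 86400; 18558; 1278; 1]; [::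
  155520; 479520; 550800; 287100; 65124; 4830; 6]; [:: 172800; 550800; 658800; 361350; 87680;
  7145; 15]; [:: 86400; 287100; 361350; 211450; 55945; 5165; 20]; [:: 18558; 65124; 87680;
  55945; 16650; 1834; 15]; [:: 1278; 4830; 7145; 5165; 1834; 268; 6]; [:: 1; 6; 15; 20; 15; 6;
  1]])%BZ.

Lemma tp_E6 (R : realFieldType) (W : finGroupType) (S : {set W}) :
  coxeter_system S -> has_coxeter_matrix S type_E6 ->
  totally_positive (contingency_metamatrix R S).
Proof.
move=> hWS hS.
refine (@exceptional_tp R W S 5 0 gens_E6 [:: (0, 2, 3); (2, 3, 3); (3, 4, 3); (4, 5, 3); (1, 3, 3)]%N
          restr_E6 restr_hi_E6 conj_E6 meta_E6 hWS hS _ _ isT _ _ _);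
  vm_cast_no_check (erefl true).
Qed.

Definition gens_E7 : gen_data := ([:: [:: (0%N, [:: 2; 0; (-1); 0; 0; 0; 0])]; [:: (1%N, [:: 0;
  2; 0; (-1); 0; 0; 0])]; [:: (2%N, [:: (-1); 0; 2; (-1); 0; 0; 0])]; [:: (3%N, [:: 0; (-1);
  (-1); 2; (-1); 0; 0])]; [:: (4%N, [:: 0; 0; 0; (-1); 2; (-1); 0])]; [:: (5%N, [:: 0; 0; 0; 0;
  (-1); 2; (-1)])]; [:: (6%N, [:: 0; 0; 0; 0; 0; (-1); 2])]])%BZ.
Definition restr_E7 : seq (nat * nat) := ([:: (127, 0); (126, 5); (126, 4); (126, 3); (126, 1);
  (94, 6); (118, 5); (118, 4); (118, 2); (124, 6); (110, 1); (118, 1); (86, 6); (86, 2); (102,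
  1); (114, 1); (22, 4); (100, 2); (6, 1); (4, 2)])%N.
Definition restr_hi_E7 : seq (nat * nat) := ([:: (127, 6); (127, 5); (127, 0); (95, 6); (95, 4);
  (63, 3); (95, 3); (95, 2); (95, 0); (126, 4); (126, 2); (126, 1)])%N.
Definition conj_E7 : seq (nat * seq nat * nat) := ([:: (1, [:: 0; 2], 4); (8, [:: 3; 2], 4); (2,
  [:: 3; 2; 1; 3], 4); (16, [:: 3; 4; 2; 3], 4); (32, [:: 3; 4; 5; 2; 3; 4], 4); (64, [:: 3; 4;
  5; 6; 2; 3; 4; 5], 4); (3, [:: 0; 2], 6); (9, [:: 0; 2; 3; 1], 6); (17, [:: 0; 2; 3; 4; 1; 3],
  6); (20, [:: 0; 2; 3; 4; 1; 3; 2; 0], 6); (33, [:: 0; 2; 3; 4; 5; 1; 3; 4], 6); (36, [:: 0; 2;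
  3; 4; 5; 1; 3; 4; 2; 0], 6); (65, [:: 0; 2; 3; 4; 5; 6; 1; 3; 4; 5], 6); (68, [:: 0; 2; 3; 4;
  5; 6; 1; 3; 4; 5; 2; 0], 6); (72, [:: 0; 2; 3; 4; 5; 6; 1; 3; 4; 5; 2; 3; 0; 2], 6); (66, [::
  0; 2; 3; 4; 5; 6; 1; 3; 4; 5; 2; 3; 0; 2; 1; 3], 6); (80, [:: 0; 2; 3; 4; 5; 6; 1; 3; 4; 5; 2;
  3; 4; 0; 2; 3], 6); (40, [:: 0; 2; 3; 4; 5; 1; 3; 4; 2; 3; 0; 2], 6); (34, [:: 0; 2; 3; 4; 5;
  1; 3; 4; 2; 3; 0; 2; 1; 3], 6); (18, [:: 0; 2; 3; 4; 5; 1; 3; 4; 2; 3; 0; 2; 1; 3; 4; 5], 6);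
  (48, [:: 4; 5; 6], 96); (24, [:: 4; 5; 6; 3; 4; 5], 96); (10, [:: 4; 5; 6; 3; 4; 5; 1; 3; 4],
  96); (12, [:: 4; 5; 6; 3; 4; 5; 2; 3; 4], 96); (5, [:: 4; 5; 6; 3; 4; 5; 2; 3; 4; 0; 2; 3],
  96); (97, [:: 0; 2], 100); (104, [:: 3; 2], 100); (52, [:: 4; 5; 6], 100); (49, [:: 4; 5; 6;
  0; 2], 100); (44, [:: 4; 5; 6; 3; 4; 5; 2; 3; 4], 100); (37, [:: 4; 5; 6; 3; 4; 5; 2; 3; 4; 0;
  2; 3], 100); (42, [:: 4; 5; 6; 3; 4; 5; 2; 3; 4; 1; 3; 2], 100); (76, [:: 3; 4; 5; 6; 2; 3; 4;
  5; 2; 3; 4], 100); (69, [:: 3; 4; 5; 6; 2; 3; 4; 5; 2; 3; 4; 0; 2; 3], 100); (74, [:: 3; 4; 5;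
  6; 2; 3; 4; 5; 2; 3; 4; 1; 3; 2], 100); (88, [:: 3; 4; 5; 6; 2; 3; 4; 5], 100); (50, [:: 4; 5;
  6; 3; 2; 1; 3; 4; 5; 3; 2; 1; 3; 4; 3; 2; 1; 3], 100); (98, [:: 4; 3; 2; 1; 3; 4; 5; 6; 4; 3;
  2; 1; 3; 4; 5; 4; 3; 2; 1; 3; 4], 100); (21, [:: 4; 5; 6; 0; 2; 3; 4; 5; 2; 3; 4; 0; 2; 3],
  100); (25, [:: 4; 5; 6; 0; 2; 3; 4; 5], 100); (11, [:: 4; 5; 6; 0; 2; 3; 4; 5; 1; 3; 4], 100);
  (7, [:: 4; 5; 6; 0; 2; 3; 4; 5; 1; 3; 4; 2; 3; 0; 2; 1; 3], 100); (19, [:: 0; 2], 22); (38,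
  [:: 5; 4], 22); (35, [:: 5; 4; 0; 2], 22); (70, [:: 5; 6; 4; 5], 22); (67, [:: 5; 6; 4; 5; 0;
  2], 22); (73, [:: 5; 6; 4; 5; 0; 2; 3; 1], 22); (81, [:: 5; 6; 4; 5; 0; 2; 3; 4; 1; 3], 22);
  (41, [:: 5; 4; 0; 2; 3; 1], 22); (84, [:: 5; 6; 4; 5; 0; 2; 3; 4; 1; 3; 2; 0], 22); (56, [::
  3; 4; 5; 6], 112); (26, [:: 3; 4; 5; 6; 1; 3; 4; 5], 112); (28, [:: 3; 4; 5; 6; 2; 3; 4; 5],
  112); (13, [:: 3; 4; 5; 6; 2; 3; 4; 5; 0; 2; 3; 4], 112); (14, [:: 3; 4; 5; 6; 2; 3; 4; 5; 0;
  2; 3; 4; 1; 3; 2; 0], 112); (29, [:: 0; 2; 3; 4; 5], 60); (58, [:: 1; 3; 4; 5; 2; 3; 4; 1; 3;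
  2], 60); (120, [:: 6; 5; 4; 3; 2], 60); (15, [:: 0; 2; 3; 4; 5; 1; 3; 4; 2; 3; 0; 2; 1; 3; 4],
  60); (99, [:: 0; 2], 102); (54, [:: 4; 5; 6], 102); (51, [:: 4; 5; 6; 0; 2], 102); (43, [:: 4;
  5; 6; 0; 2; 3; 4; 5; 1; 3; 4], 102); (39, [:: 4; 5; 6; 0; 2; 3; 4; 5; 1; 3; 4; 2; 3; 0; 2; 1;
  3], 102); (75, [:: 0; 2; 3; 4; 5; 6; 1; 3; 4; 5; 1; 3; 4], 102); (71, [:: 0; 2; 3; 4; 5; 6; 1;
  3; 4; 5; 1; 3; 4; 2; 3; 0; 2; 1; 3], 102); (89, [:: 0; 2; 3; 4; 5; 6; 1; 3; 4; 5], 102); (85,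
  [:: 0; 2; 3; 4; 5; 6; 1; 3; 4; 5; 2; 3; 4; 0; 2; 3], 102); (105, [:: 0; 2; 3; 1], 102); (23,
  [:: 4; 5; 6; 0; 2; 3; 4; 5; 1; 3; 4; 2; 3; 0; 2; 1; 3; 4; 5], 102); (113, [:: 0; 2], 116);
  (92, [:: 3; 4; 5; 6; 2; 3; 4; 5], 116); (77, [:: 3; 4; 5; 6; 2; 3; 4; 5; 0; 2; 3; 4], 116);
  (78, [:: 3; 4; 5; 6; 2; 3; 4; 5; 0; 2; 3; 4; 1; 3; 2; 0], 116); (45, [:: 0; 2; 3; 4; 5; 6; 2;
  3; 4; 5; 0; 2; 3; 4], 116); (46, [:: 0; 2; 3; 4; 5; 6; 2; 3; 4; 5; 0; 2; 3; 4; 1; 3; 2; 0],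
  116); (57, [:: 0; 2; 3; 4; 5; 6], 116); (27, [:: 0; 2; 3; 4; 5; 6; 1; 3; 4; 5], 116); (83, [::
  0; 2], 86); (101, [:: 0; 2; 3], 108); (106, [:: 1; 3; 2], 108); (53, [:: 0; 2; 3; 4; 5; 6],
  108); (90, [:: 3; 4; 5; 6; 1; 3; 4; 5], 114); (62, [:: 5; 4; 3; 2; 1; 3; 4; 5; 0; 2; 3; 4; 1;
  3; 2; 0], 31); (93, [:: 4; 3; 2; 1; 3; 4; 0; 2; 3; 1], 79); (47, [:: 5; 6], 79); (59, [:: 5;
  6; 4; 5; 3; 4; 2; 3; 0; 2; 1; 3; 4; 5; 2; 3; 0; 2; 1; 3; 4; 3; 2; 1; 3; 0; 2], 79); (121, [::
  5; 6; 4; 5; 3; 4; 2; 3; 0; 2; 1; 3; 4; 5; 6; 2; 3; 0; 2; 1; 3; 4; 5; 3; 2; 1; 3; 4; 0; 2; 3;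
  1], 79); (103, [:: 6; 5; 4], 55); (107, [:: 6; 5; 4; 3; 2; 1; 3; 0; 2], 55); (115, [:: 5; 6;
  4; 5; 3; 4; 1; 3], 91); (118, [:: 5; 6; 4; 5; 3; 4; 1; 3; 2; 0], 91); (61, [:: 0; 2; 3; 4; 5;
  6], 124); (109, [:: 0; 2; 3; 1], 110); (117, [:: 0; 2; 3; 4; 5; 6; 1; 3; 4; 5; 2; 3; 4; 0; 2;
  3], 110)])%N.
Definition meta_E7 : seq (seq Z) := ([:: [:: 2903040; 10160640; 13789440; 9072000; 2938320;
  415800; 17642; 1]; [:: 10160640; 36126720; 49956480; 33626880; 11211480; 1648920; 73927; 7];
  [:: 13789440; 49956480; 70640640; 48867840; 16868580; 2598930; 124611; 21]; [:: 9072000;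
  33626880; 48867840; 34960080; 12595710; 2055820; 107265; 35]; [:: 2938320; 11211480; 16868580;
  12595710; 4794276; 843134; 49183; 35]; [:: 415800; 1648920; 2598930; 2055820; 843134; 164334;
  11231; 21]; [:: 17642; 73927; 124611; 107265; 49183; 11231; 994; 7]; [:: 1; 7; 21; 35; 35; 21;
  7; 1]])%BZ.

Lemma tp_E7 (R : realFieldType) (W : finGroupType) (S : {set W}) :
  coxeter_system S -> has_coxeter_matrix S type_E7 ->
  totally_positive (contingency_metamatrix R S).
Proof.
move=> hWS hS.
refine (@exceptional_tp R W S 6 0 gens_E7 [:: (0, 2, 3); (2, 3, 3); (3, 4, 3); (4, 5, 3); (5, 6, 3); (1, 3, 3)]%N
          restr_E7 restr_hi_E7 conj_E7 meta_E7 hWS hS _ _ isT _ _ _);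
  vm_cast_no_check (erefl true).
Qed.

Definition gens_E8 : gen_data := ([:: [:: (0%N, [:: 2; 0; (-1); 0; 0; 0; 0; 0])]; [:: (1%N, [::
  0; 2; 0; (-1); 0; 0; 0; 0])]; [:: (2%N, [:: (-1); 0; 2; (-1); 0; 0; 0; 0])]; [:: (3%N, [:: 0;
  (-1); (-1); 2; (-1); 0; 0; 0])]; [:: (4%N, [:: 0; 0; 0; (-1); 2; (-1); 0; 0])]; [:: (5%N, [::
  0; 0; 0; 0; (-1); 2; (-1); 0])]; [:: (6%N, [:: 0; 0; 0; 0; 0; (-1); 2; (-1)])]; [:: (7%N, [::
  0; 0; 0; 0; 0; 0; (-1); 2])]])%BZ.
Definition restr_E8 : seq (nat * nat) := ([:: (255, 7); (127, 6); (127, 5); (127, 0); (95, 6);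
  (95, 4); (63, 3); (95, 3); (95, 2); (95, 0); (126, 4); (126, 1); (79, 6); (87, 6); (91, 6);
  (87, 2); (55, 1); (94, 6); (23, 4); (83, 6); (27, 0); (19, 4); (7, 1); (3, 1); (1, 0)])%N.
Definition restr_hi_E8 : seq (nat * nat) := ([:: (255, 7); (255, 6); (255, 0); (191, 7); (191,
  5); (127, 4); (191, 4); (127, 3); (191, 3); (191, 1); (254, 7); (254, 5); (254, 4); (254,
  1)])%N.
Definition conj_E8 : seq (nat * seq nat * nat) := ([:: (4, [:: 2; 0], 1); (8, [:: 2; 3; 0; 2],
  1); (2, [:: 2; 3; 0; 2; 1; 3], 1); (16, [:: 2; 3; 4; 0; 2; 3], 1); (32, [:: 2; 3; 4; 5; 0; 2;
  3; 4], 1); (64, [:: 2; 3; 4; 5; 6; 0; 2; 3; 4; 5], 1); (128, [:: 2; 3; 4; 5; 6; 7; 0; 2; 3; 4;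
  5; 6], 1); (6, [:: 2; 0], 3); (9, [:: 3; 1], 3); (17, [:: 3; 4; 1; 3], 3); (20, [:: 3; 4; 1;
  3; 2; 0], 3); (33, [:: 3; 4; 5; 1; 3; 4], 3); (36, [:: 3; 4; 5; 1; 3; 4; 2; 0], 3); (65, [::
  3; 4; 5; 6; 1; 3; 4; 5], 3); (68, [:: 3; 4; 5; 6; 1; 3; 4; 5; 2; 0], 3); (129, [:: 3; 4; 5; 6;
  7; 1; 3; 4; 5; 6], 3); (132, [:: 3; 4; 5; 6; 7; 1; 3; 4; 5; 6; 2; 0], 3); (136, [:: 3; 4; 5;
  6; 7; 1; 3; 4; 5; 6; 2; 3; 0; 2], 3); (130, [:: 3; 4; 5; 6; 7; 1; 3; 4; 5; 6; 2; 3; 0; 2; 1;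
  3], 3); (144, [:: 3; 4; 5; 6; 7; 1; 3; 4; 5; 6; 2; 3; 4; 0; 2; 3], 3); (72, [:: 3; 4; 5; 6; 1;
  3; 4; 5; 2; 3; 0; 2], 3); (66, [:: 3; 4; 5; 6; 1; 3; 4; 5; 2; 3; 0; 2; 1; 3], 3); (80, [:: 3;
  4; 5; 6; 1; 3; 4; 5; 2; 3; 4; 0; 2; 3], 3); (40, [:: 3; 4; 5; 1; 3; 4; 2; 3; 0; 2], 3); (34,
  [:: 3; 4; 5; 1; 3; 4; 2; 3; 0; 2; 1; 3], 3); (18, [:: 3; 4; 5; 1; 3; 4; 2; 3; 0; 2; 1; 3; 4;
  5], 3); (160, [:: 3; 4; 5; 6; 7; 1; 3; 4; 5; 6; 2; 3; 4; 5; 0; 2; 3; 4], 3); (12, [:: 3; 2;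
  0], 5); (10, [:: 3; 2; 1; 3; 0; 2], 5); (24, [:: 3; 4; 2; 3; 0; 2], 5); (48, [:: 3; 4; 5; 2;
  3; 4; 0; 2; 3], 5); (96, [:: 3; 4; 5; 6; 2; 3; 4; 5; 0; 2; 3; 4], 5); (192, [:: 3; 4; 5; 6; 7;
  2; 3; 4; 5; 6; 0; 2; 3; 4; 5], 5); (11, [:: 3; 2; 1; 3; 0; 2], 7); (25, [:: 3; 2; 1; 3; 4; 0;
  2; 3; 1], 7); (21, [:: 3; 4; 2; 3; 0; 2; 1; 3; 4; 2; 3; 0; 2; 1; 3], 7); (49, [:: 3; 2; 1; 3;
  4; 5; 0; 2; 3; 4; 1; 3], 7); (52, [:: 3; 2; 1; 3; 4; 5; 0; 2; 3; 4; 1; 3; 2; 0], 7); (97, [::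
  3; 2; 1; 3; 4; 5; 6; 0; 2; 3; 4; 5; 1; 3; 4], 7); (100, [:: 3; 2; 1; 3; 4; 5; 6; 0; 2; 3; 4;
  5; 1; 3; 4; 2; 0], 7); (193, [:: 3; 2; 1; 3; 4; 5; 6; 7; 0; 2; 3; 4; 5; 6; 1; 3; 4; 5], 7);
  (196, [:: 3; 2; 1; 3; 4; 5; 6; 7; 0; 2; 3; 4; 5; 6; 1; 3; 4; 5; 2; 0], 7); (200, [:: 3; 2; 1;
  3; 4; 5; 6; 7; 0; 2; 3; 4; 5; 6; 1; 3; 4; 5; 2; 3; 0; 2], 7); (194, [:: 3; 2; 1; 3; 4; 5; 6;
  7; 0; 2; 3; 4; 5; 6; 1; 3; 4; 5; 2; 3; 0; 2; 1; 3], 7); (208, [:: 3; 2; 1; 3; 4; 5; 6; 7; 0;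
  2; 3; 4; 5; 6; 1; 3; 4; 5; 2; 3; 4; 0; 2; 3], 7); (104, [:: 3; 2; 1; 3; 4; 5; 6; 0; 2; 3; 4;
  5; 1; 3; 4; 2; 3; 0; 2], 7); (98, [:: 3; 2; 1; 3; 4; 5; 6; 0; 2; 3; 4; 5; 1; 3; 4; 2; 3; 0; 2;
  1; 3], 7); (88, [:: 3; 4; 2; 3; 0; 2; 1; 3; 4; 5; 6; 2; 3; 0; 2; 1; 3; 4; 5; 3; 4; 2; 3; 0;
  2], 7); (74, [:: 3; 4; 2; 3; 0; 2; 1; 3; 4; 5; 6; 2; 3; 0; 2; 1; 3; 4; 5; 3; 4; 2; 3; 0; 2; 1;
  3; 4], 7); (76, [:: 3; 4; 2; 3; 0; 2; 1; 3; 4; 5; 6; 2; 3; 0; 2; 1; 3; 4; 5; 3; 2; 0], 7);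
  (152, [:: 3; 4; 2; 3; 0; 2; 1; 3; 4; 5; 6; 7; 2; 3; 0; 2; 1; 3; 4; 5; 6; 3; 4; 2; 3; 0; 2],
  7); (138, [:: 3; 4; 2; 3; 0; 2; 1; 3; 4; 5; 6; 7; 2; 3; 0; 2; 1; 3; 4; 5; 6; 3; 4; 2; 3; 0; 2;
  1; 3; 4], 7); (140, [:: 3; 4; 2; 3; 0; 2; 1; 3; 4; 5; 6; 7; 2; 3; 0; 2; 1; 3; 4; 5; 6; 3; 2;
  0], 7); (176, [:: 3; 4; 2; 3; 0; 2; 1; 3; 4; 5; 6; 7; 2; 3; 0; 2; 1; 3; 4; 5; 6; 3; 4; 5; 2;
  3; 4; 0; 2; 3], 7); (133, [:: 3; 4; 2; 3; 0; 2; 1; 3; 4; 5; 6; 7; 2; 3; 0; 2; 1; 3; 4; 5; 6],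
  7); (69, [:: 3; 4; 2; 3; 0; 2; 1; 3; 4; 5; 6; 2; 3; 0; 2; 1; 3; 4; 5], 7); (37, [:: 3; 4; 2;
  3; 0; 2; 1; 3; 4; 5; 2; 3; 0; 2; 1; 3; 4], 7); (44, [:: 3; 4; 2; 3; 0; 2; 1; 3; 4; 5; 2; 3; 0;
  2; 1; 3; 4; 3; 2; 0], 7); (42, [:: 3; 4; 2; 3; 0; 2; 1; 3; 4; 5; 2; 3; 0; 2; 1; 3; 4; 3; 2; 1;
  3; 0; 2], 7); (50, [:: 3; 4; 5; 1; 3; 4; 2; 3; 0; 2; 1; 3; 4; 5; 3; 4; 2; 3; 0; 2; 1; 3; 4; 2;
  3; 0; 2; 1; 3], 7); (22, [:: 2; 0], 19); (35, [:: 5; 4], 19); (38, [:: 5; 4; 2; 0], 19); (41,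
  [:: 5; 4; 3; 1], 19); (67, [:: 5; 6; 4; 5], 19); (70, [:: 5; 6; 4; 5; 2; 0], 19); (73, [:: 5;
  6; 4; 5; 3; 1], 19); (131, [:: 5; 6; 7; 4; 5; 6], 19); (134, [:: 5; 6; 7; 4; 5; 6; 2; 0], 19);
  (137, [:: 5; 6; 7; 4; 5; 6; 3; 1], 19); (145, [:: 5; 6; 7; 4; 5; 6; 3; 4; 1; 3], 19); (148,
  [:: 5; 6; 7; 4; 5; 6; 3; 4; 1; 3; 2; 0], 19); (161, [:: 5; 6; 7; 4; 5; 6; 3; 4; 5; 1; 3; 4],
  19); (81, [:: 5; 6; 4; 5; 3; 4; 1; 3], 19); (84, [:: 5; 6; 4; 5; 3; 4; 1; 3; 2; 0], 19); (164,
  [:: 5; 6; 7; 4; 5; 6; 3; 4; 5; 1; 3; 4; 2; 0], 19); (168, [:: 5; 6; 7; 4; 5; 6; 3; 4; 5; 1; 3;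
  4; 2; 3; 0; 2], 19); (162, [:: 5; 6; 7; 4; 5; 6; 3; 4; 5; 1; 3; 4; 2; 3; 0; 2; 1; 3], 19);
  (146, [:: 5; 6; 7; 4; 5; 6; 3; 4; 5; 1; 3; 4; 2; 3; 0; 2; 1; 3; 4; 5], 19); (82, [:: 5; 6; 7;
  4; 5; 6; 3; 4; 5; 1; 3; 4; 2; 3; 0; 2; 1; 3; 4; 5; 6; 7], 19); (56, [:: 5; 4; 3; 1], 26); (28,
  [:: 5; 4; 3; 2; 1; 3; 4; 5], 26); (112, [:: 5; 6; 4; 5; 3; 4; 1; 3], 26); (224, [:: 5; 6; 7;
  4; 5; 6; 3; 4; 5; 1; 3; 4], 26); (13, [:: 5; 4; 3; 2; 1; 3; 4; 5; 0; 2; 3; 4], 26); (14, [::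
  5; 4; 3; 2; 1; 3; 4; 5; 0; 2; 3; 4; 1; 3; 2; 0], 26); (29, [:: 4; 3; 2; 1; 3; 4; 0; 2; 3; 1],
  15); (60, [:: 4; 3; 2; 1; 3; 4; 5; 0; 2; 3; 4; 1; 3; 2; 0], 15); (58, [:: 4; 5; 3; 4; 2; 3; 0;
  2; 1; 3; 4; 5; 2; 3; 0; 2; 1; 3; 4; 3; 2; 1; 3; 0; 2], 15); (120, [:: 4; 3; 2; 1; 3; 4; 5; 6;
  0; 2; 3; 4; 5; 1; 3; 4; 2; 3; 0; 2], 15); (240, [:: 4; 3; 2; 1; 3; 4; 5; 6; 7; 0; 2; 3; 4; 5;
  6; 1; 3; 4; 5; 2; 3; 4; 0; 2; 3], 15); (39, [:: 5; 4], 23); (43, [:: 5; 4; 3; 2; 1; 3; 0; 2],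
  23); (71, [:: 5; 6; 4; 5], 23); (75, [:: 5; 6; 4; 5; 3; 2; 1; 3; 0; 2], 23); (135, [:: 5; 6;
  7; 4; 5; 6], 23); (139, [:: 5; 6; 7; 4; 5; 6; 3; 2; 1; 3; 0; 2], 23); (153, [:: 5; 6; 7; 4; 5;
  6; 3; 2; 1; 3; 4; 0; 2; 3; 1], 23); (149, [:: 5; 6; 7; 4; 5; 6; 3; 4; 2; 3; 0; 2; 1; 3; 4; 2;
  3; 0; 2; 1; 3], 23); (177, [:: 5; 6; 7; 4; 5; 6; 3; 2; 1; 3; 4; 5; 0; 2; 3; 4; 1; 3], 23);
  (89, [:: 5; 6; 4; 5; 3; 2; 1; 3; 4; 0; 2; 3; 1], 23); (85, [:: 5; 6; 4; 5; 3; 4; 2; 3; 0; 2;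
  1; 3; 4; 2; 3; 0; 2; 1; 3], 23); (105, [:: 5; 4; 3; 2; 1; 3; 4; 5; 6; 0; 2; 3; 4; 5; 1; 3; 4;
  3; 1], 23); (99, [:: 5; 4; 3; 2; 1; 3; 4; 5; 6; 0; 2; 3; 4; 5; 1; 3; 4], 23); (201, [:: 5; 4;
  3; 2; 1; 3; 4; 5; 6; 7; 0; 2; 3; 4; 5; 6; 1; 3; 4; 5; 3; 1], 23); (195, [:: 5; 4; 3; 2; 1; 3;
  4; 5; 6; 7; 0; 2; 3; 4; 5; 6; 1; 3; 4; 5], 23); (209, [:: 5; 4; 3; 2; 1; 3; 4; 5; 6; 7; 0; 2;
  3; 4; 5; 6; 1; 3; 4; 5; 3; 4; 1; 3], 23); (212, [:: 5; 4; 3; 2; 1; 3; 4; 5; 6; 7; 0; 2; 3; 4;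
  5; 6; 1; 3; 4; 5; 3; 4; 1; 3; 2; 0], 23); (180, [:: 5; 6; 7; 4; 5; 6; 3; 2; 1; 3; 4; 5; 0; 2;
  3; 4; 1; 3; 2; 0], 23); (172, [:: 5; 6; 7; 4; 5; 6; 3; 4; 2; 3; 0; 2; 1; 3; 4; 5; 2; 3; 0; 2;
  1; 3; 4; 3; 2; 0], 23); (165, [:: 5; 6; 7; 4; 5; 6; 3; 4; 2; 3; 0; 2; 1; 3; 4; 5; 2; 3; 0; 2;
  1; 3; 4], 23); (170, [:: 5; 6; 7; 4; 5; 6; 3; 4; 2; 3; 0; 2; 1; 3; 4; 5; 2; 3; 0; 2; 1; 3; 4;
  3; 2; 1; 3; 0; 2], 23); (178, [:: 5; 6; 7; 4; 5; 6; 3; 4; 5; 1; 3; 4; 2; 3; 0; 2; 1; 3; 4; 5;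
  3; 4; 2; 3; 0; 2; 1; 3; 4; 2; 3; 0; 2; 1; 3], 23); (210, [:: 5; 6; 7; 4; 5; 6; 3; 4; 5; 1; 3;
  4; 2; 3; 0; 2; 1; 3; 4; 5; 6; 7; 3; 4; 2; 3; 0; 2; 1; 3; 4; 5; 6; 2; 3; 0; 2; 1; 3; 4; 5],
  23); (198, [:: 5; 4; 3; 2; 1; 3; 4; 5; 6; 7; 0; 2; 3; 4; 5; 6; 1; 3; 4; 5; 2; 0], 23); (102,
  [:: 5; 4; 3; 2; 1; 3; 4; 5; 6; 0; 2; 3; 4; 5; 1; 3; 4; 2; 0], 23); (54, [:: 5; 4; 3; 2; 1; 3;
  4; 5; 0; 2; 3; 4; 1; 3; 2; 0], 23); (51, [:: 5; 4; 3; 2; 1; 3; 4; 5; 0; 2; 3; 4; 1; 3], 23);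
  (57, [:: 5; 4; 3; 1], 27); (45, [:: 5; 4; 3; 2; 1; 3; 4; 5; 0; 2; 3; 4], 27); (113, [:: 5; 6;
  4; 5; 3; 4; 1; 3], 27); (116, [:: 5; 6; 4; 5; 3; 4; 1; 3; 2; 0], 27); (225, [:: 5; 6; 7; 4; 5;
  6; 3; 4; 5; 1; 3; 4], 27); (228, [:: 5; 6; 7; 4; 5; 6; 3; 4; 5; 1; 3; 4; 2; 0], 27); (232, [::
  5; 6; 7; 4; 5; 6; 3; 4; 5; 1; 3; 4; 2; 3; 0; 2], 27); (226, [:: 5; 6; 7; 4; 5; 6; 3; 4; 5; 1;
  3; 4; 2; 3; 0; 2; 1; 3], 27); (184, [:: 5; 4; 3; 2; 1; 3; 4; 5; 6; 7; 0; 2; 3; 4; 5; 6; 4; 5;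
  3; 4; 2; 3; 0; 2], 27); (154, [:: 5; 4; 3; 2; 1; 3; 4; 5; 6; 7; 0; 2; 3; 4; 5; 6; 4; 5; 3; 4;
  2; 3; 0; 2; 1; 3; 4; 5], 27); (156, [:: 5; 4; 3; 2; 1; 3; 4; 5; 6; 7; 0; 2; 3; 4; 5; 6; 4; 3;
  2; 0], 27); (141, [:: 5; 4; 3; 2; 1; 3; 4; 5; 6; 7; 0; 2; 3; 4; 5; 6], 27); (92, [:: 5; 4; 3;
  2; 1; 3; 4; 5; 6; 0; 2; 3; 4; 5; 4; 3; 2; 0], 27); (77, [:: 5; 4; 3; 2; 1; 3; 4; 5; 6; 0; 2;
  3; 4; 5], 27); (78, [:: 5; 4; 3; 2; 1; 3; 4; 5; 6; 0; 2; 3; 4; 5; 1; 3; 2; 0], 27); (46, [::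
  5; 4; 3; 2; 1; 3; 4; 5; 0; 2; 3; 4; 1; 3; 2; 0], 27); (142, [:: 5; 4; 3; 2; 1; 3; 4; 5; 6; 7;
  0; 2; 3; 4; 5; 6; 1; 3; 2; 0], 27); (90, [:: 5; 6; 7; 4; 5; 6; 3; 4; 5; 1; 3; 4; 2; 3; 0; 2;
  1; 3; 4; 5; 6; 7; 3; 4; 5; 6; 1; 3; 4; 5], 27); (114, [:: 5; 6; 7; 4; 5; 6; 3; 4; 5; 1; 3; 4;
  2; 3; 0; 2; 1; 3; 4; 5; 6; 7], 27); (86, [:: 2; 0], 83); (147, [:: 7; 6], 83); (150, [:: 7; 6;
  2; 0], 83); (163, [:: 7; 6; 5; 4], 83); (166, [:: 7; 6; 5; 4; 2; 0], 83); (169, [:: 7; 6; 5;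
  4; 3; 1], 83); (101, [:: 6; 5; 4], 53); (108, [:: 6; 5; 4; 3; 2; 0], 53); (197, [:: 6; 7; 5;
  6; 4; 5], 53); (204, [:: 6; 7; 5; 6; 4; 5; 3; 2; 0], 53); (202, [:: 6; 7; 5; 6; 4; 5; 3; 2; 1;
  3; 0; 2], 53); (216, [:: 6; 7; 5; 6; 4; 5; 3; 4; 2; 3; 0; 2], 53); (106, [:: 6; 5; 4; 3; 2; 1;
  3; 0; 2], 53); (62, [:: 5; 4; 3; 2; 1; 3; 4; 5; 0; 2; 3; 4; 1; 3; 2; 0], 31); (93, [:: 4; 3;
  2; 1; 3; 4; 0; 2; 3; 1], 79); (47, [:: 5; 6], 79); (143, [:: 7; 6], 79); (157, [:: 7; 6; 4; 3;
  2; 1; 3; 4; 0; 2; 3; 1], 79); (188, [:: 7; 6; 4; 3; 2; 1; 3; 4; 5; 0; 2; 3; 4; 1; 3; 2; 0],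
  79); (186, [:: 7; 6; 4; 5; 3; 4; 2; 3; 0; 2; 1; 3; 4; 5; 2; 3; 0; 2; 1; 3; 4; 3; 2; 1; 3; 0;
  2], 79); (244, [:: 4; 3; 2; 1; 3; 4; 5; 6; 7; 0; 2; 3; 4; 5; 6; 1; 3; 4; 5; 2; 3; 4; 0; 2; 3;
  2; 0], 79); (241, [:: 4; 3; 2; 1; 3; 4; 5; 6; 7; 0; 2; 3; 4; 5; 6; 1; 3; 4; 5; 2; 3; 4; 0; 2;
  3], 79); (121, [:: 4; 3; 2; 1; 3; 4; 5; 6; 0; 2; 3; 4; 5; 1; 3; 4; 2; 3; 0; 2], 79); (59, [::
  4; 3; 2; 1; 3; 4; 5; 6; 0; 2; 3; 4; 5; 1; 3; 4; 2; 3; 0; 2; 1; 3; 4; 5; 6], 79); (242, [:: 7;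
  6; 4; 5; 3; 4; 2; 3; 0; 2; 1; 3; 4; 5; 6; 7; 2; 3; 0; 2; 1; 3; 4; 5; 6; 3; 2; 1; 3; 4; 5; 0;
  2; 3; 4; 1; 3], 79); (103, [:: 6; 5; 4], 55); (107, [:: 6; 5; 4; 3; 2; 1; 3; 0; 2], 55); (199,
  [:: 6; 7; 5; 6; 4; 5], 55); (203, [:: 6; 7; 5; 6; 4; 5; 3; 2; 1; 3; 0; 2], 55); (217, [:: 6;
  7; 5; 6; 4; 5; 3; 2; 1; 3; 4; 0; 2; 3; 1], 55); (213, [:: 6; 7; 5; 6; 4; 5; 3; 4; 2; 3; 0; 2;
  1; 3; 4; 2; 3; 0; 2; 1; 3], 55); (181, [:: 6; 7; 5; 6; 4; 5; 3; 4; 2; 3; 0; 2; 1; 3; 4; 5; 6;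
  7; 2; 3; 0; 2; 1; 3; 4; 5; 6], 55); (151, [:: 7; 6], 87); (167, [:: 7; 6; 5; 4], 87); (171,
  [:: 7; 6; 5; 4; 3; 2; 1; 3; 0; 2], 87); (179, [:: 7; 6; 5; 4; 3; 2; 1; 3; 4; 5; 0; 2; 3; 4; 1;
  3], 87); (182, [:: 7; 6; 5; 4; 3; 2; 1; 3; 4; 5; 0; 2; 3; 4; 1; 3; 2; 0], 87); (211, [:: 7; 6;
  5; 4; 3; 2; 1; 3; 4; 5; 6; 7; 0; 2; 3; 4; 5; 6; 1; 3; 4; 5], 87); (214, [:: 7; 6; 5; 4; 3; 2;
  1; 3; 4; 5; 6; 7; 0; 2; 3; 4; 5; 6; 1; 3; 4; 5; 2; 0], 87); (115, [:: 5; 6; 4; 5; 3; 4; 1; 3],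
  91); (155, [:: 7; 6], 91); (185, [:: 7; 6; 5; 4; 3; 1], 91); (173, [:: 7; 6; 5; 4; 3; 2; 1; 3;
  4; 5; 0; 2; 3; 4], 91); (233, [:: 5; 6; 7; 4; 5; 6; 3; 4; 5; 1; 3; 4; 3; 1], 91); (227, [:: 5;
  6; 7; 4; 5; 6; 3; 4; 5; 1; 3; 4], 91); (230, [:: 5; 6; 7; 4; 5; 6; 3; 4; 5; 1; 3; 4; 2; 0],
  91); (118, [:: 5; 6; 4; 5; 3; 4; 1; 3; 2; 0], 91); (174, [:: 7; 6; 5; 4; 3; 2; 1; 3; 4; 5; 0;
  2; 3; 4; 1; 3; 2; 0], 91); (61, [:: 0; 2; 3; 4; 5; 6], 124); (248, [:: 7; 6; 5; 4; 3; 2],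
  124); (122, [:: 7; 6; 5; 4; 3; 2; 1; 3; 4; 5; 6; 7], 124); (109, [:: 0; 2; 3; 1], 110); (206,
  [:: 7; 6; 5], 110); (205, [:: 7; 6; 5; 0; 2; 3; 1], 110); (220, [:: 7; 6; 5; 0; 2; 3; 4; 1; 3;
  2; 0], 110); (236, [:: 0; 2; 3; 4; 5; 6; 7; 1; 3; 4; 5; 6; 2; 3; 4; 5; 0; 2; 3; 4; 3; 2; 0],
  110); (229, [:: 0; 2; 3; 4; 5; 6; 7; 1; 3; 4; 5; 6; 2; 3; 4; 5; 0; 2; 3; 4], 110); (234, [::
  0; 2; 3; 4; 5; 6; 7; 1; 3; 4; 5; 6; 2; 3; 4; 5; 0; 2; 3; 4; 3; 2; 1; 3; 0; 2], 110); (218, [::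
  7; 6; 0; 2; 3; 4; 5; 1; 3; 4; 2; 3; 0; 2; 1; 3; 4; 5; 6; 7; 5; 4; 3; 0; 2; 1; 3; 4; 5; 6; 5;
  4; 3; 2; 1; 3; 4; 5], 110); (117, [:: 0; 2; 3; 4; 5; 6; 1; 3; 4; 5; 2; 3; 4; 0; 2; 3], 110);
  (158, [:: 7; 6], 94); (190, [:: 5; 4; 3; 2; 1; 3; 4; 5; 0; 2; 3; 4; 1; 3; 2; 0], 159); (95,
  [:: 6; 7], 159); (207, [:: 7; 6; 5], 111); (221, [:: 7; 6; 5; 4; 3; 2; 1; 3; 4; 0; 2; 3; 1],
  111); (245, [:: 7; 6; 5; 4; 3; 2; 1; 3; 4; 5; 6; 7; 0; 2; 3; 4; 5; 6; 1; 3; 4; 5; 2; 3; 4; 0;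
  2; 3], 111); (187, [:: 4; 5; 3; 4; 2; 3; 0; 2; 1; 3; 4; 5; 2; 3; 0; 2; 1; 3; 4; 3; 2; 1; 3; 0;
  2], 175); (243, [:: 4; 5; 3; 4; 2; 3; 0; 2; 1; 3; 4; 5; 6; 7; 2; 3; 0; 2; 1; 3; 4; 5; 6; 3; 2;
  1; 3; 4; 5; 0; 2; 3; 4; 1; 3], 175); (246, [:: 4; 5; 3; 4; 2; 3; 0; 2; 1; 3; 4; 5; 6; 7; 2; 3;
  0; 2; 1; 3; 4; 5; 6; 3; 2; 1; 3; 4; 5; 0; 2; 3; 4; 1; 3; 2; 0], 175); (231, [:: 7; 6; 5; 4],
  119); (235, [:: 7; 6; 5; 4; 3; 2; 1; 3; 0; 2], 119); (219, [:: 7; 6; 5; 4; 3; 2; 1; 3; 4; 5;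
  6; 7; 0; 2; 3; 4; 5; 6; 1; 3; 4; 5], 119); (215, [:: 6; 7; 5; 6; 4; 5], 183); (249, [:: 6; 7;
  5; 6; 4; 5; 3; 4; 2; 3; 0; 2], 189); (123, [:: 6; 7; 5; 6; 4; 5; 3; 4; 2; 3; 0; 2; 1; 3; 4; 5;
  6; 7], 189); (125, [:: 0; 2; 3; 4; 5; 6; 7], 252); (250, [:: 1; 3; 4; 5; 6; 7; 2; 3; 4; 5; 6;
  1; 3; 4; 5; 2; 3; 4; 1; 3; 2], 252); (237, [:: 0; 2; 3; 1], 238)])%N.
Definition meta_E8 : seq (seq Z) := ([:: [:: 696729600; 2786918400; 4470681600; 3657830400;
  1601268480; 357557760; 34508640; 881760; 1]; [:: 2786918400; 11240570880; 18207866880;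
  15071616000; 6692958720; 1522152576; 150602304; 4006856; 8]; [:: 4470681600; 18207866880;
  29831639040; 25032430080; 11304830880; 2627041536; 267654842; 7467894; 28]; [:: 3657830400;
  15071616000; 25032430080; 21351747648; 9839303040; 2346581468; 247700376; 7318836; 56]; [::
  1601268480; 6692958720; 11304830880; 9839303040; 4648819998; 1144964066; 126314765; 4008367;
  70]; [:: 357557760; 1522152576; 2627041536; 2346581468; 1144964066; 293984848; 34351972;
  1196498; 56]; [:: 34508640; 150602304; 267654842; 247700376; 126314765; 34351972; 4349062;
  172685; 28]; [:: 881760; 4006856; 7467894; 7318836; 4008367; 1196498; 172685; 8524; 8]; [:: 1;
  8; 28; 56; 70; 56; 28; 8; 1]])%BZ.

Lemma tp_E8 (R : realFieldType) (W : finGroupType) (S : {set W}) :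
  coxeter_system S -> has_coxeter_matrix S type_E8 ->
  totally_positive (contingency_metamatrix R S).
Proof.
move=> hWS hS.
refine (@exceptional_tp R W S 7 0 gens_E8 [:: (0, 2, 3); (2, 3, 3); (3, 4, 3); (4, 5, 3); (5, 6, 3); (6, 7, 3); (1, 3, 3)]%N
          restr_E8 restr_hi_E8 conj_E8 meta_E8 hWS hS _ _ isT _ _ _);
  vm_cast_no_check (erefl true).
Qed.

Definition gens_F4 : gen_data := ([:: [:: (0%N, [:: 2; (-1); 0; 0])]; [:: (1%N, [:: (-1); 2;
  (-1); 0])]; [:: (2%N, [:: 0; (-2); 2; (-1)])]; [:: (3%N, [:: 0; 0; (-1); 2])]])%BZ.
Definition restr_F4 : seq (nat * nat) := ([:: (15, 3); (7, 1); (5, 2); (5, 0); (1, 0)])%N.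
Definition restr_hi_F4 : seq (nat * nat) := ([:: (15, 3); (15, 0); (7, 2); (7, 1); (7, 0); (14,
  1)])%N.
Definition conj_F4 : seq (nat * seq nat * nat) := ([:: (2, [:: 1; 0], 1); (8, [:: 3; 2], 4); (9,
  [:: 3; 2], 5); (10, [:: 3; 2; 1; 0], 5)])%N.
Definition meta_F4 : seq (seq Z) := ([:: [:: 1152; 2304; 1392; 240; 1]; [:: 2304; 4800; 3072;
  580; 4]; [:: 1392; 3072; 2134; 460; 6]; [:: 240; 580; 460; 124; 4]; [:: 1; 4; 6; 4; 1]])%BZ.

Lemma tp_F4 (R : realFieldType) (W : finGroupType) (S : {set W}) :
  coxeter_system S -> has_coxeter_matrix S type_F4 ->
  totally_positive (contingency_metamatrix R S).
Proof.
move=> hWS hS.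
refine (@exceptional_tp R W S 3 0 gens_F4 [:: (0, 1, 3); (1, 2, 4); (2, 3, 3)]%N
          restr_F4 restr_hi_F4 conj_F4 meta_F4 hWS hS _ _ isT _ _ _);
  vm_cast_no_check (erefl true).
Qed.

(** Scalars a + b phi with phi^2 = phi + 1: coordinates i and i + 3 hold a and b, and the bond of
    label 5 has Cartan entry -phi. Signs can be tested on a and b separately, since [rho_col_ge0]
    bounds all components of a root at once. *)
Definition gens_H3 : gen_data := ([:: [:: (0%N, [:: 2; 0; 0; 0; (-1); 0]); (3%N, [:: 0; (-1); 0;
  2; (-1); 0])]; [:: (1%N, [:: 0; 2; (-1); (-1); 0; 0]); (4%N, [:: (-1); 0; 0; (-1); 2; (-1)])];
  [:: (2%N, [:: 0; (-1); 2; 0; 0; 0]); (5%N, [:: 0; 0; 0; 0; (-1); 2])]])%BZ.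
Definition restr_H3 : seq (nat * nat) := ([:: (7, 2); (3, 1); (1, 0)])%N.
Definition restr_hi_H3 : seq (nat * nat) := ([:: (7, 0); (6, 2)])%N.
Definition conj_H3 : seq (nat * seq nat * nat) := ([:: (1, [:: 0; 1; 0; 1], 2); (4, [:: 2; 1],
  2)])%N.
Definition meta_H3 : seq (seq Z) := ([:: [:: 120; 180; 62; 1]; [:: 180; 288; 111; 3]; [:: 62;
  111; 52; 3]; [:: 1; 3; 3; 1]])%BZ.

Lemma tp_H3 (R : realFieldType) (W : finGroupType) (S : {set W}) :
  coxeter_system S -> has_coxeter_matrix S type_H3 ->
  totally_positive (contingency_metamatrix R S).
Proof.
move=> hWS hS.
refine (@exceptional_tp R W S 2 1 gens_H3 [:: (0, 1, 5); (1, 2, 3)]%N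
          restr_H3 restr_hi_H3 conj_H3 meta_H3 hWS hS _ _ isT _ _ _);
  vm_cast_no_check (erefl true).
Qed.

Definition gens_H4 : gen_data := ([:: [:: (0%N, [:: 2; 0; 0; 0; 0; (-1); 0; 0]); (4%N, [:: 0;
  (-1); 0; 0; 2; (-1); 0; 0])]; [:: (1%N, [:: 0; 2; (-1); 0; (-1); 0; 0; 0]); (5%N, [:: (-1); 0;
  0; 0; (-1); 2; (-1); 0])]; [:: (2%N, [:: 0; (-1); 2; (-1); 0; 0; 0; 0]); (6%N, [:: 0; 0; 0; 0;
  0; (-1); 2; (-1)])]; [:: (3%N, [:: 0; 0; (-1); 2; 0; 0; 0; 0]); (7%N, [:: 0; 0; 0; 0; 0; 0;
  (-1); 2])]])%BZ.
Definition restr_H4 : seq (nat * nat) := ([:: (15, 3); (7, 1); (5, 2); (1, 0)])%N.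
Definition restr_hi_H4 : seq (nat * nat) := ([:: (15, 3); (15, 0); (7, 2); (14, 3); (14, 2)])%N.
Definition conj_H4 : seq (nat * seq nat * nat) := ([:: (2, [:: 1; 0; 1; 0], 1); (4, [:: 1; 0; 1;
  2; 0; 1], 1); (8, [:: 1; 0; 1; 2; 3; 0; 1; 2], 1); (9, [:: 0; 1; 0; 1], 10); (5, [:: 0; 1; 0;
  1; 2; 3], 10); (12, [:: 3; 2; 1], 6)])%N.
Definition meta_H4 : seq (seq Z) := ([:: [:: 14400; 28800; 17040; 2640; 1]; [:: 28800; 58560;
  35520; 5764; 4]; [:: 17040; 35520; 22366; 3892; 6]; [:: 2640; 5764; 3892; 772; 4]; [:: 1; 4;
  6; 4; 1]])%BZ.

Lemma tp_H4 (R : realFieldType) (W : finGroupType) (S : {set W}) :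
  coxeter_system S -> has_coxeter_matrix S type_H4 ->
  totally_positive (contingency_metamatrix R S).
Proof.
move=> hWS hS.
refine (@exceptional_tp R W S 3 1 gens_H4 [:: (0, 1, 5); (1, 2, 3); (2, 3, 3)]%N
          restr_H4 restr_hi_H4 conj_H4 meta_H4 hWS hS _ _ isT _ _ _);
  vm_cast_no_check (erefl true).
Qed.

(** * Type I_2 *)

Lemma sum_dcosets (W : finGroupType) (I J : {group W}) (h : W -> nat) c :
  (forall w, \sum_(z in I * [set w] * J) h z = c)%g%N ->
  (\sum_w h w = #|dcosets [set: W] I J| * c)%N.
Proof.
move=> hc; rewrite -sum_nat_const.
rewrite (partition_big (fun w => I * [set w] * J)%g (mem (dcosets [set: W] I J))) /=; last first.
  by move=> w _; apply: imset_f.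
apply: eq_bigr => D /imsetP[w _ ->]; rewrite -(hc w); apply: eq_bigl => z.
by apply/eqP/idP => [<-|/dcoset_eq //]; apply: dcoset_refl.
Qed.

Lemma sum1_type (T : finType) : (\sum_(w : T) 1 = #|T|)%N.
Proof. by rewrite -sum1_card; apply: eq_bigl. Qed.

Lemma sum_singletons n (F : {set 'I_n} -> nat) :
  (\sum_(I : {set 'I_n} | #|I| == 1) F I = \sum_i F [set i])%N.
Proof.
rewrite -(big_imset (h := fun i : 'I_n => [set i]) F) /=; last by move=> i j _ _ /set1_inj.
apply: eq_bigl => I; apply/cards1P/imsetP => [[x ->]|[x _ ->]]; first by exists x.
by exists x.
Qed.

(* With t = x - g, the matrix is (1 0) A1 (d + A2 (t + (g)) A2^T) A1^T. *)
Lemma tp_rank2 (R : realFieldType) (g t : R) : 2 <= t -> t < g ->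
  tp_upto 3 (fun i j => nth 0 (nth [::] [:: [:: g; g; 1]; [:: g; g + t; 2]; [:: 1; 2; 1]] i) j).
Proof.
move=> t2 tg; have t0 : 0 < t by lra.
have g0 : 0 < g by lra.
have tn : t != 0 by rewrite gt_eqF.
have gn : g != 0 by rewrite gt_eqF.
apply: tp_upto_rev.
pose G2 (i j : nat) : R := block_extend g (fun _ _ => 0) i j.
have tp2 : tp_upto 1 G2.
  have := @tp_bidiag_conj R 0 g (fun _ _ => 0) (fun=> 1) (fun=> 0) g0 (@tp_upto0 _ _).
  move=> H; apply: eq_tp_upto (H _ _ _) => // [[|i] [|j]] // _ _.
  by rewrite /bidiag_conj /bidiag_row /= !mul0r !addr0 !mul1r.
pose b1 (i : nat) : R := if i is 0 then t / g else 0.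
pose G1 := bidiag_conj (fun=> 1) b1 (block_extend t G2).
have tp1 : tp_upto 2 G1.
  by apply: tp_bidiag_conj => // -[|i] //= _; rewrite divr_gt0.
pose b0 (i : nat) : R := match i with 0 => t^-1 | 1 => 1 - t / g | _ => 0 end.
pose d : R := 1 - g^-1 - t^-1.
have d0 : 0 < d.
  have : t^-1 <= 2^-1 by rewrite lef_pV2 ?posrE.
  have : g^-1 < 2^-1 by rewrite ltf_pV2 ?posrE //; lra.
  by rewrite /d; lra.
have : tp_upto 3 (bidiag_conj (fun=> 1) b0 (block_extend d G1)).
  apply: tp_bidiag_conj => // -[|[|i]] //= _; first by rewrite invr_gt0.
  by rewrite subr_gt0 ltr_pdivrMr // mul1r.
apply: eq_tp_upto => i j; case: i => [|[|[|i]]] // _; case: j => [|[|[|j]]] // _;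
  rewrite /= /bidiag_conj /bidiag_row /= /G1 /bidiag_conj /bidiag_row /= /d ?mul1r; field;
  rewrite ?tn ?gn //.
Qed.

Section Rank2.
Variables (W : finGroupType) (S : {set W}) (s : 'I_2 -> W).
Hypotheses (hWS : coxeter_system S) (s_inj : injective s) (sS : s @: setT = S).
Variable m : nat.
Hypotheses (m2 : (2 <= m)%N) (ordm : forall i j : 'I_2, i != j -> #[s i * s j]%g = m).

Let s2 := coxeter_s2 hWS sS.

(** W is the union of the cyclic group of rotations, of order m, and its coset by a reflection; the
    sign separates the two. *)
Lemma card_I2 : #|W| = (2 * m)%N.
Proof.
pose a := s ord0; pose b := s ord_max; pose r := <[a * b]>%G.
have rab : (a * b)%g \in r by exact: cycle_id.
have rba : (b * a)%g \in r.
  have -> : (b * a = (a * b)^-1)%g; last by rewrite groupV.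
  by apply/eqP; rewrite eq_sym eq_invg_mul -mulgA (mulgA b) s2 mul1g s2.
case: (coxeter_sgn hWS s_inj sS) => sg sgM sgs.
have sg1 : sg 1%g = false by have := sgM 1%g 1%g; rewrite mulg1; case: (sg 1%g).
have sgr w : w \in r -> sg w = false.
  case/cycleP=> k ->; elim: k => [|k IH]; first by rewrite expg0.
  by rewrite expgS !sgM !sgs IH.
have cov w : (w \in r) || (w * a \in r)%g.
  have : w \in par s setT by rewrite /par /= sS; case: hWS => ->; rewrite inE.
  case/par_word=> t _ <-; elim/last_ind: t => [|t i IH]; first by rewrite wprod_nil group1.
  rewrite wprod_rcons; have [->|->] : i = ord0 \/ i = ord_max.
  - by case: i => -[|[|i]] ?; [left|right|]; try exact: val_inj.
  - by rewrite -mulgA s2 mulg1 orbC.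
  case/orP: IH => tr; apply/orP; [right|left]; first by rewrite -mulgA groupM.
  by have -> : (wprod s t * b = wprod s t * a * (a * b))%g;
    [rewrite mulgA -(mulgA _ a a) s2 mulg1|rewrite groupM].
have <- : #|[set: W]| = #|W| by rewrite cardsT.
have -> : [set: W] = (r :|: r :* a)%g.
  apply/setP=> w; rewrite !inE mem_rcoset; have -> : (a^-1 = a)%g; last by rewrite cov.
  by apply/eqP; rewrite eq_invg_mul s2.
rewrite cardsU card_rcoset (_ : r :&: r :* a = set0)%g ?cards0 ?subn0.
  by rewrite -[#|r|]/#[a * b]%g ordm // mul2n addnn.
apply/setP=> w; rewrite !inE mem_rcoset; apply/negP=> /andP[/sgr w0 /sgr].
have -> : (a^-1 = a)%g by apply/eqP; rewrite eq_invg_mul s2.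
by rewrite sgM w0 sgs.
Qed.

Lemma par1 (i : 'I_2) z : (z \in par s [set i]) = (z == 1%g) || (z == s i).
Proof.
have -> : par s [set i] = <[s i]>%G.
  by apply: val_inj; rewrite /= imset_set1.
have o : #[s i]%g = 2 by case: hWS => _ H _; apply: H; rewrite -sS imset_f.
apply/cycleP/orP => [[k ->]|[/eqP ->|/eqP ->]].
- rewrite -(expg_mod_order (s i) k) o modn2.
  by case: odd; [right; rewrite expg1|left].
- by exists 0%N.
by exists 1%N; rewrite expg1.
Qed.

Lemma par0 z : (z \in par s set0) = (z == 1%g).
Proof. by rewrite /par /= imset0 gen0 inE. Qed.

Lemma sn1 i : s i != 1%g.
Proof.
have o : #[s i]%g = 2 by case: hWS => _ H _; apply: H; rewrite -sS imset_f.
by apply/eqP=> e; rewrite e order1 in o.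
Qed.

Lemma parT : par s setT = [set: W] :> {set W}.
Proof. by rewrite /par /= sS; case: hWS. Qed.

Lemma ndc00 : ndc s setT set0 set0 = (2 * m)%N.
Proof.
rewrite -card_I2 /ndc parT -sum1_type.
rewrite (@sum_dcosets _ (par s set0) (par s set0) (fun=> 1%N) 1%N) ?muln1 // => w.
rewrite (big_pred1 w) // => z; apply/dcosetP/eqP => [[a [b]]|->].
  by rewrite !par0 => -[/eqP -> /eqP -> ->]; rewrite mul1g mulg1.
by exists 1%g, 1%g; rewrite !group1 mul1g mulg1.
Qed.

Lemma ndc01 i : ndc s setT set0 [set i] = m.
Proof.
suff H : (\sum_(w : W) 1 = ndc s setT set0 [set i] * 2)%N.
  by move: H; rewrite sum1_type card_I2; lia.
rewrite /ndc parT; apply: sum_dcosets => w.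
rewrite (_ : (_ * _)%g = [set w; w * s i]%g); last first.
  apply/setP=> z; rewrite !inE; apply/dcosetP/orP => [[a [b]]|].
    rewrite par0 par1 => -[/eqP -> /orP[] /eqP -> ->]; rewrite mul1g ?mulg1; [by left|by right].
  case=> /eqP ->; [exists 1%g, 1%g|exists 1%g, (s i)]; rewrite !group1 mul1g ?mulg1 //.
  by rewrite par1 eqxx orbT.
rewrite sum1_card cards2; suff -> : w != (w * s i)%g by [].
by rewrite -{1}[w]mulg1 (inj_eq (mulgI w)) eq_sym sn1.
Qed.

Definition swaps (i j : 'I_2) : pred W := fun w => (s i * w == w * s j)%g.

(** A double coset has four elements, unless it contains a solution of s_i w = w s_j; then it has
    two, both of them solutions. Weighting w by [1 + swaps i j w] gives every double coset the mass
    4. *)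
Lemma ndc11 i j : (4 * ndc s setT [set i] [set j] = 2 * m + #|swaps i j|)%N.
Proof.
rewrite -card_I2 mulnC /ndc parT -sum1_type -(sum1_card (swaps i j)).
rewrite -(@sum_dcosets _ (par s [set i]) (par s [set j]) (fun w => 1 + swaps i j w)%N 4).
  rewrite big_split /=; congr (_ + _)%N; rewrite [RHS]big_mkcond.
  by apply: eq_bigr => w _; rewrite /in_mem /=; case: (swaps i j w).
move=> w; have sV k : (s k)^-1%g = s k by apply/eqP; rewrite eq_invg_mul s2.
rewrite (_ : (_ * _)%g = [set w; s i * w; w * s j; s i * w * s j]%g); last first.
  apply/setP=> z; rewrite !inE; apply/dcosetP/idP => [[a [b]]|].
    rewrite !par1 => -[/orP[] /eqP -> /orP[] /eqP -> ->];
    by rewrite ?mul1g ?mulg1 eqxx ?orbT.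
  rewrite -!orbA => /or4P[] /eqP ->.
  - by exists 1%g, 1%g; rewrite !group1 mul1g mulg1.
  - by exists (s i), 1%g; rewrite !group1 mulg1 par1 eqxx orbT.
  - by exists 1%g, (s j); rewrite !group1 mul1g par1 eqxx orbT.
  - by exists (s i), (s j); rewrite !par1 !eqxx !orbT.
have [sw|nsw] := boolP (swaps i j w).
  have e := eqP sw; rewrite -e -mulgA -e mulgA s2 mul1g.
  rewrite (_ : [set _; _; _; _] = [set w; s i * w]%g); last first.
    by apply/setP=> z; rewrite !inE; do 2 case: (z == _).
  have wn : w != (s i * w)%g by rewrite -{1}[w]mul1g (inj_eq (mulIg w)) eq_sym sn1.
  have sw2 : swaps i j (s i * w)%g by rewrite /swaps -[X in _ == X]mulgA -e.
  by rewrite big_setU1 ?inE //= big_set1 sw sw2.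
have h0 z : z \in [set w; s i * w; w * s j; s i * w * s j]%g -> swaps i j z = false.
  rewrite !inE -!orbA => H; apply/negbTE; apply: contra nsw; rewrite /swaps.
  case/or4P: H => /eqP ->.
  - by [].
  - by rewrite -mulgA (inj_eq (mulgI (s i))).
  - by rewrite mulgA (inj_eq (mulIg (s j))).
  - rewrite !mulgA s2 mul1g -!mulgA s2 mulg1 => /eqP H.
    by apply/eqP; rewrite H.
rewrite (eq_bigr (fun=> 1%N)) => [|z /h0 ->] //; rewrite sum1_card.
have wa : w != (s i * w)%g by rewrite -{1}[w]mul1g (inj_eq (mulIg w)) eq_sym sn1.
have wb : w != (w * s j)%g by rewrite -{1}[w]mulg1 (inj_eq (mulgI w)) eq_sym sn1.
have ab : (s i * w)%g != (w * s j)%g by [].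
have aab : (s i * w)%g != (s i * w * s j)%g.
  by rewrite -{1}[(s i * w)%g]mulg1 (inj_eq (mulgI _)) eq_sym sn1.
have bab : (w * s j)%g != (s i * w * s j)%g by rewrite (inj_eq (mulIg _)).
have wab : w != (s i * w * s j)%g.
  by apply: contra ab => /eqP e; apply/eqP; rewrite {2}e -mulgA s2 mulg1.
have uq : uniq [:: w; s i * w; w * s j; s i * w * s j]%g.
  by rewrite /= !inE !negb_or wa wb wab ab aab bab.
transitivity #|[:: w; s i * w; w * s j; s i * w * s j]%g|; last exact: (card_uniqP uq).
by apply: eq_card => z; rewrite !inE -!orbA.
Qed.

(** No w solves s_i w = w s_j for both i, whence the upper bound |W|. The lower bound comes from the
    solutions 1, s_j, c and c s_j, with c the longest element. *)
Lemma swaps_bounds j : (4 <= #|swaps ord0 j| + #|swaps ord_max j| <= 2 * m)%N.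
Proof.
have dis w : ~~ (swaps ord0 j w && swaps ord_max j w).
  by apply/negP=> /andP[/eqP e1 /eqP e2]; have /mulIg/s_inj := etrans e1 (esym e2).
have U : (#|swaps ord0 j| + #|swaps ord_max j| = #|[pred w | swaps ord0 j w || swaps ord_max j w]|)%N.
  rewrite -!sum1_card [in LHS]big_mkcond [X in (_ + X)%N]big_mkcond [RHS]big_mkcond /=.
  rewrite -big_split /=; apply: eq_bigr => w _; have := dis w.
  by rewrite /in_mem /=; case: (swaps ord0 j w); case: (swaps ord_max j w).
rewrite U -card_I2 max_card andbT.
pose i : 'I_2 := if j == ord0 then ord_max else ord0.
have ij : j != i by rewrite /i; case: (eqVneq j ord0) => [->|].
pose c := wprod s (altw j i m).
(* The longest element permutes the simple reflections: compare the first letter of one alternating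
   word for c with the last letter of the other. *)
have [p pc] : exists p, (s p * c = c * s j)%g.
  have br : c = wprod s (altw i j m) by have := coxeter_braid hWS sS j i; rewrite ordm.
  have [r mr] : exists r, m = r.+1 by exists m.-1; move: m2; clear; lia.
  exists (if odd r then j else i).
  have c1 : c = (s (if odd r then j else i) * wprod s (altw j i r))%g.
    by rewrite /c mr altwSl wprod_cons.
  have c2 : c = (wprod s (altw j i r) * s j)%g by rewrite br mr /= wprod_rcons.
  by rewrite {1}c1 mulgA s2 mul1g c2 -mulgA s2 mulg1.
case: (coxeter_sgn hWS s_inj sS) => sg sgM sgs.
have sg1 : sg 1%g = false by have := sgM 1%g 1%g; rewrite mulg1; case: (sg 1%g).
have sgw t : sg (wprod s t) = odd (size t).
  elim: t => [|x t IH]; first by rewrite wprod_nil sg1.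
  by rewrite wprod_cons sgM sgs IH.
have alt2 k : wprod s (altw j i k.*2) = ((s j * s i) ^+ k)%g.
  elim: k => [|k IH]; first by rewrite wprod_nil.
  by rewrite doubleS /= !wprod_rcons IH expgSr mulgA.
have ordk k : (0 < k < m)%N -> ((s j * s i) ^+ k)%g != 1%g.
  move=> /andP[k0 km]; rewrite -order_dvdn ordm //.
  by apply/negP=> /(dvdn_leq k0); rewrite leqNgt km.
have cn1 : c != 1%g.
  apply/eqP=> c1; have := sgw (altw j i m); rewrite -/c c1 sg1 size_altw => /esym mo.
  have mE := odd_double_half m; rewrite mo add0n in mE.
  have kb : (0 < m./2 < m)%N by move: m2 mE; clear; lia.
  have /eqP[] := ordk m./2 kb.
  by rewrite -alt2 mE.
have cnj : c != s j.
  apply/eqP=> cj; have := sgw (altw j i m); rewrite -/c cj sgs size_altw => /esym mo.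
  have mE := odd_double_half m; rewrite mo add1n in mE.
  have br : c = wprod s (altw i j m) by have := coxeter_braid hWS sS j i; rewrite ordm.
  have kb : (0 < m./2 < m)%N by move: m2 mE; clear; lia.
  have /eqP[] := ordk m./2 kb.
  apply: (mulIg (s j)); rewrite mul1g -alt2 -wprod_rcons -[rcons _ _]/(altw i j (m./2.*2).+1).
  by rewrite mE -br.
pose Q := [pred w | swaps ord0 j w || swaps ord_max j w].
have Qp w p' : (s p' * w = w * s j)%g -> w \in Q.
  move=> e; rewrite inE /swaps; case: (ltngtP p' 0) => // [p1|p0].
    have -> : ord_max = p' by apply: val_inj; rewrite /=; have := ltn_ord p'; lia.
    by rewrite e eqxx orbT.
  by have -> : ord0 = p' by [apply: val_inj]; rewrite e eqxx.
have uq : uniq [:: 1; s j; c; c * s j]%g.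
  rewrite /= !inE !negb_or [1%g == s j]eq_sym sn1 [1%g == c]eq_sym cn1 [s j == c]eq_sym cnj /=.
  have -> : 1%g != (c * s j)%g.
    apply: contra cnj => /eqP e; apply/eqP/(mulIg (s j)); rewrite -e s2 //.
  have -> : s j != (c * s j)%g.
    by apply: contra cn1 => /eqP e; apply/eqP/(mulIg (s j)); rewrite -e mul1g.
  by rewrite -{1}[c]mulg1 (inj_eq (mulgI c)) eq_sym sn1.
have c4 : #|[:: 1; s j; c; c * s j]%g| = 4%N by exact: (card_uniqP uq).
rewrite -c4.
apply/subset_leq_card/subsetP=> w; rewrite inE in_cons in_cons mem_seq1 => /or4P[] /eqP ->.
- by apply: (Qp _ j); rewrite mul1g mulg1.
- by apply: (Qp _ j).
- exact: Qp pc.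
by apply: (Qp _ p); rewrite mulgA pc.
Qed.
End Rank2.

Lemma tp_I2 (R : realFieldType) (W : finGroupType) (S : {set W}) m : (2 <= m)%N ->
  coxeter_system S -> has_coxeter_matrix S (type_I2 m) ->
  totally_positive (contingency_metamatrix R S).
Proof.
move=> m2 hWS [s [s_inj sS smat]].
have ordm (i j : 'I_2) : i != j -> #[s i * s j]%g = m.
  move=> ij; rewrite smat mxE (negbTE ij).
  by case: i j ij => [[|[|i]] ?] [[|[|j]] ?].
have gen : <<S>>%g = [set: W] by case: hWS.
have SE : #|S| = 2 by rewrite -sS card_imset // cardsT card_ord.
have m0 F : (\sum_(I : {set 'I_2} | #|I| == 0) F I = F set0)%N.
  by rewrite (big_pred1 set0) // => I; rewrite /= cards_eq0.
have e00 : meta_entry s 0 0 = (2 * m)%N by rewrite /meta_entry /face_count !m0 (ndc00 hWS s_inj sS ordm).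
have e01 : meta_entry s 0 1 = (2 * m)%N.
  rewrite /meta_entry /face_count m0 sum_singletons (eq_bigr (fun=> m)) => [|i _].
    by rewrite sum_nat_const card_ord.
  exact: (ndc01 hWS s_inj sS m2 ordm).
have [x [e11 x1 x2]] : exists x, [/\ meta_entry s 1 1 = (2 * m + x)%N, (2 <= x)%N & (x <= m)%N].
  have H : (4 * meta_entry s 1 1 = 4 * (2 * m) + \sum_(j < 2) (#|swaps s ord0 j| + #|swaps s ord_max j|))%N.
    rewrite /meta_entry /face_count sum_singletons.
    under eq_bigr do rewrite sum_singletons.
    have q := ndc11 hWS s_inj sS ordm.
    rewrite exchange_big /= !big_ord_recl !big_ord0 /=.
    rewrite (_ : lift ord0 ord0 = ord_max :> 'I_2); last exact: val_inj.
    move: (q ord0 ord0) (q ord0 ord_max) (q ord_max ord0) (q ord_max ord_max); clear.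
    move: (ndc s setT [set ord0] [set ord0]) (ndc s setT [set ord0] [set ord_max])
      (ndc s setT [set ord_max] [set ord0]) (ndc s setT [set ord_max] [set ord_max]).
    move: #|swaps s ord0 ord0| #|swaps s ord_max ord0|
        #|swaps s ord0 ord_max| #|swaps s ord_max ord_max| => p1 p2 p3 p4 q1 q2 q3 q4.
    lia.
  move: H; rewrite !big_ord_recl big_ord0 /=.
  have /andP[a1 a2] := swaps_bounds hWS s_inj sS m2 ordm ord0.
  have /andP[b1 b2] := swaps_bounds hWS s_inj sS m2 ordm (lift ord0 ord0).
  move=> H; exists (meta_entry s 1 1 - 2 * m)%N; move: H a1 a2 b1 b2 m2; clear.
  rewrite (_ : lift ord0 ord0 = ord_max); last exact: val_inj.
  move: (meta_entry s 1 1) #|swaps s ord0 ord0| #|swaps s ord_max ord0|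
        #|swaps s ord0 ord_max| #|swaps s ord_max ord_max| => X p1 p2 p3 p4 *.
  by split; lia.
pose F (i j : nat) : R := nth 0 (nth [::] [:: [:: (2 * m)%:R; (2 * m)%:R; 1];
   [:: (2 * m)%:R; (2 * m)%:R + x%:R; 2]; [:: 1; 2; 1]] i) j.
apply: (@tp_upto_mx _ _ F) => [i j|]; last first.
  by rewrite SE; apply: tp_rank2; rewrite ?ler_nat ?ltr_nat //; move: x1 x2 m2; clear; lia.
rewrite (metamatrixE _ _ _ s_inj sS gen).
have : (i < 3)%N by apply: leq_trans (ltn_ord i) _; rewrite SE.
have : (j < 3)%N by apply: leq_trans (ltn_ord j) _; rewrite SE.
case: i j => [i /= _] [j /= _]; case: i => [|[|[|i]]] // ; case: j => [|[|[|j]]] // _ _; rewrite /F /=.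
- by rewrite e00.
- by rewrite e01.
- by rewrite meta_sym meta_last.
- by rewrite meta_sym e01.
- by rewrite e11 natrD.
- by rewrite meta_sym meta_last.
- by rewrite meta_last.
- by rewrite meta_last.
by rewrite meta_last.
Qed.

(** * Representations from Cartan matrices; type B *)

Section CartanRep.
Variables (W : finGroupType) (S : {set W}) (n : nat) (s : 'I_n -> W).
Hypotheses (hWS : coxeter_system S) (s_inj : injective s) (sS : s @: setT = S).
Variable C : 'I_n -> 'I_n -> Z.
Hypothesis C2 : forall i, C i i = 2.

Definition cartan_mx (i : 'I_n) : 'M[Z]_n :=
  \matrix_(b, c) ((b == c)%:R - (b == i)%:R * C i c).
Local Notation g := cartan_mx.

Definition cpair i (u : 'cV[Z]_n) : Z := \sum_c C i c * u c 0.

Lemma cartan_col i u : g i *m u = u - cpair i u *: delta_mx i 0.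
Proof.
apply/matrixP=> b z; rewrite ord1 !mxE.
under eq_bigr do rewrite mxE mulrBl -mulrA.
rewrite sumrB -big_distrr /= eqxx andbT [X in _ = _ - X]mulrC; congr (_ - _).
rewrite (bigD1 b) //= eqxx mul1r big1 ?addr0 // => c cb.
by rewrite eq_sym (negbTE cb) mul0r.
Qed.

Lemma cpair_delta i j x u : cpair i (u - x *: delta_mx j 0) = cpair i u - x * C i j.
Proof.
rewrite /cpair; under eq_bigr do rewrite !mxE mulrBr.
rewrite sumrB; congr (_ - _); rewrite (bigD1 j) //= !eqxx mulr1 mulrC big1 ?addr0 // => c cj.
by rewrite (negbTE cj) mulr0 mulr0.
Qed.

(** The reflections in i and j act on the pair (x, y) by affine maps, so the relations and
    positivity in rank two become computations with two integers. *)
Definition cst i j (u : 'cV[Z]_n) x y := u - x *: delta_mx i 0 - y *: delta_mx j 0.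

Lemma cst_l i j u x y : g i *m cst i j u x y = cst i j u (cpair i u - x - y * C i j) y.
Proof.
rewrite cartan_col /cst !cpair_delta C2.
by apply/matrixP=> b z; rewrite !mxE; ring.
Qed.

Lemma cstC i j u x y : cst i j u x y = cst j i u y x.
Proof. by rewrite /cst addrAC. Qed.

Lemma cst_r i j u x y : g j *m cst i j u x y = cst i j u x (cpair j u - y - x * C j i).
Proof. by rewrite cstC cst_l cstC. Qed.

Lemma cst0 i j u : u = cst i j u 0 0.
Proof. by rewrite /cst !scale0r !subr0. Qed.

Definition cartan_bond (m : nat) (a b : Z) :=
  [\/ [/\ m = 2, a = 0 & b = 0], [/\ m = 3, a = -1 & b = -1],
      [/\ m = 4, a = -1 & b = -2] | [/\ m = 4, a = -2 & b = -1]].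

Hypothesis bonds : forall i j, i != j -> cartan_bond #[s i * s j]%g (C i j) (C j i).

Lemma cartan_rep : exists2 rho, reflection_rep s id rho & forall i, rho (s i) = g i.
Proof.
have colP (A : 'M[Z]_n) : (forall u : 'cV[Z]_n, A *m u = u) -> A = 1%:M.
  move=> H; apply/matrixP=> b c; have /matrixP/(_ b 0) := H (delta_mx c 0).
  by rewrite -colE !mxE eqxx andbT.
have g2 i : g i *m g i = 1%:M.
  apply: colP => u; rewrite -mulmxA !cartan_col cpair_delta C2.
  set p := cpair i u; have -> : p - p * 2 = - p by ring.
  by rewrite scaleNr opprK subrK.
apply: (reflection_rep_exists hWS s_inj sS) => [//|i j|i b c bi|i b a ->|i j ij r rm a b ->].
- have [->|ij] := eqVneq i j.
    by have -> : #[s j * s j]%g = 1%N; rewrite ?(coxeter_s2 hWS sS) ?order1 //= mulmx1.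
  apply: colP => u.
  have it k : iter k (mulmx (g i *m g j)) 1%:M *m u = iter k (fun w => g i *m (g j *m w)) u.
    by elim: k => [|k IH] /=; rewrite ?mul1mx // -!mulmxA IH.
  rewrite it; set F := fun w => _.
  suff: iter #[s i * s j]%g F (cst i j u 0 0) = cst i j u 0 0 by rewrite -cst0.
  by case: (bonds ij) => -[-> cij cji]; rewrite /= /F /= !(cst_l, cst_r) cij cji; congr (cst _ _ _ _ _); ring.
- by rewrite mxE (negbTE bi) mul0r subr0.
- by rewrite mxE C2; case: eqP => _; [rewrite mul1r|rewrite mul0r subr0].
have -> : mprod g (altw i j r) b i = (mprod g (altw i j r) *m delta_mx i 0 : 'cV_n) b 0.
  by rewrite -colE mxE.
have e0 : delta_mx i 0 = cst i j 0 (-1) 0 :> 'cV[Z]_n.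
  by rewrite /cst scale0r scaleN1r sub0r opprK subr0.
have p0 k : cpair k 0 = 0 by rewrite /cpair big1 // => c _; rewrite mxE mulr0.
have neg x y : x <= 0 -> y <= 0 -> 0 <= cst i j 0 x y b 0.
  move=> x0 y0; rewrite !mxE !eqxx !andbT add0r.
  by rewrite addr_ge0 // oppr_ge0 mulr_le0_ge0 ?ler0n.
rewrite e0; case: (bonds ij) rm => -[-> cij cji]; case: r => [|[|[|[|r]]]] // _;
  rewrite /= ?mulmx1 -?mulmxA ?mul1mx ?(cst_l, cst_r) ?p0 ?cij ?cji; exact: neg.
Qed.
End CartanRep.

(** Euclidean coordinate l of the simple root i: e_i - e_{i+1}, and 2 e_{n-1} at the end. With the
    long last root the simple coroots are e_j - e_{j+1} and e_{n-1}, so integral pairings are the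
    same as integral Euclidean coordinates. *)
Definition stepB n (i l : nat) : Z :=
  if (i.+1 < n)%N then (l == i)%:R - (l == i.+1)%:R else 2 * (l == i)%:R.

Definition cartanB n (i j : 'I_n) : Z := stepB n i j - stepB n i j.+1.

Lemma head_labels (P : pred (nat * nat * nat)) L z : all (fun e => e.2 == 3) L ->
  head 2 [seq e.2 | e <- rcons L z & P e] =
  if has P L then 3%N else if P z then z.2 else 2%N.
Proof.
elim: L => [|x L IH] /=; first by case: (P z).
by case/andP=> /eqP x3 /IH; case: (P x) => //= _.
Qed.

Lemma type_B_rep (W : finGroupType) (S : {set W}) n : (2 <= n)%N ->
  coxeter_system S -> has_coxeter_matrix S (type_B n) ->
  exists s : 'I_n -> W, [/\ injective s, s @: setT = S &
    exists2 rho, reflection_rep s id rho & forall i, rho (s i) = cartan_mx (@cartanB n) i].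
Proof.
move=> n2 hWS [s [s_inj sS smat]]; exists s; split=> //.
apply: (cartan_rep hWS s_inj sS) => [i|i j ij].
  have ii := ltn_ord i; rewrite /cartanB /stepB !eqxx.
  have -> : (nat_of_ord i == i.+1) = false by apply/eqP; lia.
  have -> : (i.+1 == i :> nat) = false by apply/eqP; lia.
  by case: ifP.
rewrite smat mxE (negbTE ij) head_labels; last by apply/allP=> x /mapP[a _ ->].
rewrite has_map.
have hasE : has (preim (fun k => (k, k.+1, 3%N))
    (fun e : nat * nat * nat => (e.1 == (val i, val j)) || (e.1 == (val j, val i)))) (iota 0 (n - 2)) =
    ((j == i.+1 :> nat) && (j.+1 < n)%N) || ((i == j.+1 :> nat) && (i.+1 < n)%N).
  apply/hasP/orP => [[k]|].
    rewrite mem_iota /= !xpair_eqE => kn /orP[] /andP[/eqP <- /eqP <-]; rewrite eqxx /=; [left|right]; lia.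
  case=> /andP[/eqP e lt]; [exists (i : nat)|exists (j : nat)]; rewrite ?mem_iota /= ?e ?eqxx ?orbT //; lia.
rewrite hasE /= !xpair_eqE.
have {}ij : (i : nat) <> j by move=> e; case/eqP: ij; apply: val_inj.
have ii := ltn_ord i; have jj := ltn_ord j.
rewrite /cartan_bond /cartanB /stepB.
move: (nat_of_ord i) (nat_of_ord j) ij ii jj {hasE} => a b ab an bn; clear -n2 ab an bn.
have d x : ((x == x.+1) = false) * ((x.+1 == x) = false) * ((x == x.+2) = false) *
    ((x.+2 == x) = false) by do !split; apply/eqP; lia.
have [e|ne] : b = a.+1 \/ b <> a.+1 by lia.
  subst b; have [lt|ge] : (a.+2 < n)%N \/ n = a.+2 by lia.
    by apply: Or42; rewrite lt bn /= ?eqSS ?eqxx ?d /=; split.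
  subst n; apply: Or43; rewrite !ltnn ?ltnSn ?leqnn ?subSS ?subn0 ?eqSS ?eqxx ?d /=.
  by rewrite ?eqxx ?d /=; split.
have [e'|ne'] : a = b.+1 \/ a <> b.+1 by lia.
  subst a; have [lt|ge] : (b.+2 < n)%N \/ n = b.+2 by lia.
    by apply: Or42; rewrite lt an /= ?eqSS ?eqxx ?d /=; split.
  subst n; apply: Or44; rewrite !ltnn ?ltnSn ?leqnn ?subSS ?subn0 ?eqSS ?eqxx ?d /=.
  by rewrite ?eqxx ?d /=; split.
apply: Or41.
have -> : (n - 2 == a)%N && (n - 1 == b)%N || (n - 2 == b)%N && (n - 1 == a)%N = false.
  by apply/negP=> /orP[] /andP[/eqP ? /eqP ?]; lia.
have f1 : (b == a.+1) = false by apply/eqP.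
have f2 : (a == b.+1) = false by apply/eqP.
have f3 : (a == b) = false by apply/eqP.
have f4 : (b == a) = false by rewrite eq_sym.
have f5 : (b.+1 == a) = false by rewrite eq_sym.
have f6 : (a.+1 == b) = false by rewrite eq_sym.
by split; rewrite ?eqSS ?f1 ?f2 ?f3 ?f4 ?f5 ?f6 //=; do ?case: ifP.
Qed.

(** * Signed permutation coordinates in type B *)

Section Box.
Variables (W : finGroupType) (n : nat) (s : 'I_n -> W) (rho : W -> 'M[Z]_n).
Hypotheses (rr : reflection_rep s id rho) (rhoB : forall i, rho (s i) = cartan_mx (@cartanB n) i).

Definition simple_coord (v : 'rV[Z]_n) (j : nat) : Z := if insub j is Some k then v 0 k else 0.

Lemma coord_ord (v : 'rV[Z]_n) (k : 'I_n) : simple_coord v k = v 0 k.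
Proof. by rewrite /simple_coord valK. Qed.

Lemma coordE (v : 'rV[Z]_n) j (jn : (j < n)%N) : simple_coord v j = v 0 (Ordinal jn).
Proof. by rewrite -(coord_ord v (Ordinal jn)). Qed.

(* The coordinates of v in the orthonormal basis on which W acts by signed
   permutations; v itself lists the pairings with the simple coroots. *)
Definition eucl (v : 'rV[Z]_n) (l : nat) : Z := \sum_(l <= j < n) simple_coord v j.

Lemma eucl_lin c (u v : 'rV[Z]_n) l : eucl (c *: u + v) l = c * eucl u l + eucl v l.
Proof.
rewrite /eucl big_distrr -big_split /=; apply: eq_bigr => j _; rewrite /simple_coord.
by case: insub => [k|]; rewrite ?mxE // mulr0 addr0.
Qed.

Lemma eucl_step (v : 'rV[Z]_n) (i : 'I_n) : v 0 i = eucl v i - eucl v i.+1.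
Proof. by rewrite /eucl big_ltn // coord_ord addrK. Qed.

Lemma eucl_n (v : 'rV[Z]_n) l : (n <= l)%N -> eucl v l = 0.
Proof. by move=> nl; rewrite /eucl big_geq. Qed.

Lemma eucl_s (v : 'rV[Z]_n) (i : 'I_n) l : (l <= n)%N ->
  eucl (v *m rho (s i)) l = eucl v l - v 0 i * stepB n i l.
Proof.
move=> ln; rewrite /eucl rhoB.
have E j : (l <= j < n)%N -> simple_coord (v *m cartan_mx (@cartanB n) i) j =
    simple_coord v j - v 0 i * (stepB n i j - stepB n i j.+1).
  case/andP=> _ jn; rewrite !(coordE _ jn) mxE.
  under eq_bigr do rewrite mxE mulrBr.
  rewrite sumrB; congr (_ - _).
    rewrite (bigD1 (Ordinal jn)) //= eqxx mulr1 big1 ?addr0 // => b bj.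
    by rewrite (negbTE bj) mulr0.
  rewrite (bigD1 i) //= eqxx mul1r big1 ?addr0 // => b bi.
  by rewrite (negbTE bi) mul0r mulr0.
rewrite (eq_big_nat _ _ E) sumrB -big_distrr /=; congr (_ - _ * _).
have s0 : stepB n i n = 0.
  have ii := ltn_ord i; rewrite /stepB.
  have -> : (n == i) = false by rewrite gtn_eqF.
  by case: ifP => i1 //; rewrite gtn_eqF // subrr.
transitivity (stepB n i l - stepB n i n); last by rewrite s0 subr0.
rewrite -[RHS]opprB -(telescope_sumr (stepB n i) ln) -sumrN.
by apply: eq_bigr => j _; rewrite opprB.
Qed.

Definition box (k : nat) (v : 'rV[Z]_n) := forall l, (l < n)%N -> - k%:R <= eucl v l <= k%:R.

(** A generator exchanges two neighbouring Euclidean coordinates or negates the last one. *)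
Lemma box_s k (v : 'rV[Z]_n) i : box k v -> box k (v *m rho (s i)).
Proof.
move=> bv l ln; rewrite eucl_s ?(ltnW ln) // (eucl_step v i) /stepB.
have bl := bv l ln; have bi := bv i (ltn_ord i).
case: ifP => i1.
  have bi1 := bv i.+1 i1; have [li|li] := eqVneq l (nat_of_ord i).
    have -> : (l == i.+1) = false by apply/eqP; lia.
    by rewrite li /= subr0 mulr1 opprB addrC subrK.
  have [li1|li1] := eqVneq l i.+1; last by rewrite subrr mulr0 subr0.
  by rewrite li1 /= sub0r mulrN1 opprK addrC subrK.
rewrite [eucl v i.+1]eucl_n ?subr0; last by rewrite leqNgt i1.
have [li|li] := eqVneq l (nat_of_ord i); last first.
  by have -> : eucl v l - eucl v i * (2 * false%:R) = eucl v l by rewrite /=; ring.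
have -> : eucl v l - eucl v i * (2 * true%:R) = - eucl v i by rewrite li /=; ring.
by move: bi; case/andP=> h1 h2; rewrite lerN2 h2 lerNl h1.
Qed.

Lemma box_act k (v : 'rV[Z]_n) x : box k v -> box k (v *m rho x).
Proof.
have : x \in par s setT by rewrite (par_setT rr) inE.
case/par_word=> t _ <-; elim/last_ind: t => [|t i IH] bv.
  by rewrite wprod_nil (rr_one rr) mulmx1.
by rewrite wprod_rcons (rr_mul rr) mulmxA; apply: box_s; apply: IH.
Qed.

(** Pairing with the strictly dominant vector (n, n - 1, ..., 1), which is positive on simple
    roots. *)
Definition height (v : 'rV[Z]_n) : Z := \sum_(0 <= l < n) (n - l)%N%:R * eucl v l.

Lemma height_s (v : 'rV[Z]_n) (i : 'I_n) : v 0 i < 0 -> height v < height (v *m rho (s i)).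
Proof.
move=> vi; rewrite /height -subr_gt0 -sumrB.
have -> : \sum_(0 <= l < n) ((n - l)%N%:R * eucl (v *m rho (s i)) l - (n - l)%N%:R * eucl v l) =
    - v 0 i * \sum_(0 <= l < n) (n - l)%N%:R * stepB n i l.
  rewrite big_distrr /= big_nat_cond [RHS]big_nat_cond; apply: eq_bigr => l /andP[/andP[_ ln] _].
  by rewrite eucl_s ?(ltnW ln) //; ring.
rewrite pmulr_rgt0 ?oppr_gt0 // big_mkord (bigD1 i) //=.
have ii := ltn_ord i; rewrite /stepB; case: ifP => i1.
  rewrite (bigD1 (Ordinal i1)) //=; last by rewrite -(inj_eq val_inj) /=; apply/eqP; clear; lia.
  rewrite big1 => [|l /andP[li li1]].
    rewrite !eqxx; have -> : (nat_of_ord i == i.+1) = false by rewrite ltn_eqF.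
    have -> : (i.+1 == i :> nat) = false by rewrite gtn_eqF.
    rewrite /= subr0 mulr1 sub0r mulrN1 addr0 subr_gt0 ltr_nat.
    by move: i1 ii; clear; lia.
  have -> : (nat_of_ord l == i) = false by rewrite (inj_eq val_inj); apply/negbTE.
  have -> : (nat_of_ord l == i.+1) = false.
    by rewrite -[i.+1]/(nat_of_ord (Ordinal i1)) (inj_eq val_inj); apply/negbTE.
  by rewrite subrr mulr0.
rewrite eqxx big1 => [|l li].
  by rewrite addr0 /= mulr1 mulr_gt0 ?ltr0n ?subn_gt0.
have -> : (nat_of_ord l == i) = false by rewrite (inj_eq val_inj); apply/negbTE.
by rewrite /= !mulr0.
Qed.

(** A point of maximal height in the orbit is dominant. Unlike in [dominant_ex], v is arbitrary
    here. *)
Lemma dominant_rep (v : 'rV[Z]_n) : exists x, dominant id setT (v *m rho x).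
Proof.
case: (@Order.TotalTheory.arg_maxP _ _ _ (1%g : W) xpredT (fun x => height (v *m rho x)) isT) => x _ mx.
exists x; apply/dominantP=> i _; rewrite leNgt; apply/negP=> /height_s.
rewrite -mulmxA -(rr_mul rr) => lt.
have le : height (v *m rho (x * s i)%g) <= height (v *m rho x) := mx _ isT.
by have := lt_le_trans lt le; rewrite ltxx.
Qed.
End Box.

(** * Binomial transform and Horner form *)

Section BinomialTransform.
Variable R : realFieldType.

Definition bt N (F : nat -> nat -> R) (k l : nat) : R :=
  \sum_(0 <= r < N) \sum_(0 <= t < N) 'C(k, r)%:R * 'C(l, t)%:R * F r t.

Lemma binomial_inj N (f : nat -> R) :
  (forall k, \sum_(0 <= r < N) 'C(k, r)%:R * f r = 0) -> forall r, (r < N)%N -> f r = 0.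
Proof.
move=> H r; have [m] := ubnP r; elim: m r => // m IH r /ltnSE rm rN.
have := H r; rewrite (big_cat_nat (n := r)) //=; last exact: ltnW.
rewrite [X in _ + X]big_ltn // binn mul1r [X in X + _]big_nat_cond big1 => [|i /andP[/andP[_ ir] _]]; last first.
  by rewrite (IH i (leq_trans ir rm) (ltn_trans ir rN)) mulr0.
rewrite add0r [X in _ + X]big_nat_cond big1 ?addr0 // => i /andP[/andP[ri _] _].
by rewrite bin_small // mul0r.
Qed.

(** The matrix of the C(k, r) is unitriangular. *)
Lemma bt_inj N F G : (forall k l, bt N F k l = bt N G k l) ->
  forall r t, (r < N)%N -> (t < N)%N -> F r t = G r t.
Proof.
move=> H r t rN tN; apply/eqP; rewrite -subr_eq0; apply/eqP.
apply: (@binomial_inj N (fun t => F r t - G r t)) tN => l.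
apply: (@binomial_inj N (fun r => \sum_(0 <= t < N) 'C(l, t)%:R * (F r t - G r t))) rN => k.
transitivity (bt N F k l - bt N G k l); last by rewrite H subrr.
rewrite /bt -sumrB; apply: eq_bigr => i _; rewrite big_distrr -sumrB /=.
by apply: eq_bigr => j _; ring.
Qed.

Definition diagB (r : nat) : R := if r is 0 then 1 else (2 * r)%:R.
Definition supB N (r : nat) : R := if (r < N)%N then (2 * r).+1%:R else 0.

(** The inverse binomial transform of the polynomial with coefficients [D] in (2k + 1)(2l + 1), in
    Horner form: [block_extend] adds the constant term, the conjugation multiplies the rest by the
    variable. *)
Fixpoint metaB (N : nat) (D : nat -> R) : nat -> nat -> R :=
  if N is N'.+1 then
    bidiag_conj diagB (supB N') (block_extend (D 0) (metaB N' (fun j => D j.+1)))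
  else fun _ _ => 0.

Lemma tp_metaB N D : (forall j, (j < N)%N -> 0 < D j) -> tp_upto N (metaB N D).
Proof.
elim: N D => [|N IH] D D0; first exact: tp_upto0.
apply: tp_bidiag_conj; first exact: D0.
- by apply: IH => j jN; apply: D0.
- by case=> [|i] _ /=; rewrite ?ltr01 ?ltr0n.
- by move=> i iN; rewrite /supB iN ltr0n.
by rewrite /supB ltnn.
Qed.

Lemma bin_step k r : (2 * k).+1%:R * 'C(k, r)%:R =
  (2 * r).+1%:R * 'C(k, r)%:R + (2 * r.+1)%:R * 'C(k, r.+1)%:R :> R.
Proof.
rewrite -!natrM -natrD; congr (_%:R).
have [kr|rk] := ltnP k r; first by rewrite !bin_small ?muln0 //; lia.
have := mul_bin_left k r.
by nia.
Qed.

(** By [bin_step], the bidiagonal matrix is multiplication by 2k + 1 on the shifted part of y; the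
    entry at 0 passes unchanged because [diagB 0] is 1. *)
Lemma sum_bidiag N k (y : nat -> R) :
  \sum_(0 <= r < N.+1) 'C(k, r)%:R * (diagB r * y r + supB N r * y r.+1) =
  y 0%N + (2 * k).+1%:R * \sum_(0 <= r < N) 'C(k, r)%:R * y r.+1.
Proof.
under eq_bigr do rewrite mulrDr.
rewrite big_split /= big_nat_recl // bin0 /= !mul1r -addrA; congr (_ + _).
rewrite [X in _ + X]big_nat_recr //= {2}/supB ltnn mul0r mulr0 addr0.
rewrite big_distrr -big_split /= big_nat_cond [RHS]big_nat_cond.
apply: eq_bigr => r /andP[/andP[_ rN] _].
rewrite /supB rN /=.
transitivity (((2 * r).+1%:R * 'C(k, r)%:R + (2 * r.+1)%:R * 'C(k, r.+1)%:R) * y r.+1 : R).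
  by ring.
by rewrite -bin_step mulrA.
Qed.

Lemma bt_metaB N D k l :
  bt N (metaB N D) k l = \sum_(0 <= j < N) D j * ((2 * k).+1%:R * (2 * l).+1%:R) ^+ j.
Proof.
elim: N D => [|N IH] D; first by rewrite /bt !big_geq.
rewrite big_nat_recl // expr0 mulr1.
under eq_bigr do rewrite exprS mulrCA.
rewrite -big_distrr /= -IH /bt.
set Y := block_extend (D 0%N) (metaB N (fun j => D j.+1)).
under eq_bigr => r _.
  rewrite (_ : \sum_(0 <= t < N.+1) _ = 'C(k, r)%:R * (diagB r *
     (Y r 0%N + (2 * l).+1%:R * \sum_(0 <= t < N) 'C(l, t)%:R * Y r t.+1) + supB N r *
     (Y r.+1 0%N + (2 * l).+1%:R * \sum_(0 <= t < N) 'C(l, t)%:R * Y r.+1 t.+1))); last first.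
    clearbody Y; rewrite -(sum_bidiag N l (Y r)) -(sum_bidiag N l (Y r.+1)) !big_distrr -big_split big_distrr /=; apply: eq_bigr => t _.
    by rewrite /bidiag_conj /bidiag_row; cbv beta; ring.
  over.
rewrite (sum_bidiag N k (fun r => Y r 0%N + (2 * l).+1%:R * \sum_(0 <= t < N) 'C(l, t)%:R * Y r t.+1)).
rewrite /= [X in D 0%N + _ * X + _]big1 => [|t _]; last by rewrite mulr0.
rewrite mulr0 addr0 -mulrA; congr (_ + _ * _); rewrite !big_distrr /=.
apply: eq_bigr => r _; rewrite add0r !big_distrr /=; apply: eq_bigr => t _; ring.
Qed.

(** The coefficient of x^j in the product of (x + 2i - 1) / (2i) for 1 <= i <= n, whose value at x =
    2a + 1 is C(n + a, n). *)
Fixpoint ehrhartB (n : nat) (j : nat) : R :=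
  if n is n'.+1 then
    ((if j is j'.+1 then ehrhartB n' j' else 0) + (2 * n').+1%:R * ehrhartB n' j) / (2 * n)%:R
  else (j == 0%N)%:R.

Lemma ehrhartB_gt0 n j : (j <= n)%N -> 0 < ehrhartB n j.
Proof.
have ge0 n' j' : 0 <= ehrhartB n' j'.
  elim: n' j' => [|n' IH] j' /=; first by rewrite ler0n.
  by rewrite divr_ge0 ?ler0n // addr_ge0 ?mulr_ge0 ?ler0n //; case: j'.
elim: n j => [|n IH] [|j] //= jn; rewrite divr_gt0 ?ltr0n //.
  by rewrite add0r mulr_gt0 ?ltr0n ?IH.
by rewrite ltr_pwDl ?IH // mulr_ge0 ?ler0n.
Qed.

Lemma ehrhartB_big n j : (n < j)%N -> ehrhartB n j = 0.
Proof.
elim: n j => [|n IH] [|j] //= jn.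
by rewrite IH // (IH j.+1) ?mulr0 ?addr0 ?mul0r // ltnW.
Qed.

Lemma sum_ehrhartB n a : \sum_(0 <= j < n.+1) ehrhartB n j * (2 * a).+1%:R ^+ j = 'C(n + a, n)%:R.
Proof.
elim: n => [|n IH]; first by rewrite big_nat1 expr0 mulr1 bin0.
transitivity (((2 * a).+1%:R + (2 * n).+1%:R) / (2 * n.+1)%:R * 'C(n + a, n)%:R : R).
  rewrite -IH mulrDl mulrDl; under eq_bigr do rewrite /= mulrAC mulrDl mulrDl.
  rewrite big_split /=; congr (_ + _).
    rewrite big_nat_recl // !mul0r add0r big_distrr /=; apply: eq_bigr => j _.
    by rewrite exprS; ring.
  rewrite big_nat_recr //= ehrhartB_big // mulr0 !mul0r addr0 big_distrr /=.
  by apply: eq_bigr => j _; ring.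
have n0 : (2 * n.+1)%:R != 0 :> R by rewrite pnatr_eq0.
apply: (mulfI n0); rewrite mulrA mulrCA divff // mulr1 -natrD -!natrM; congr (_%:R).
have H := mul_bin_diag (n + a).+1 n.
rewrite [(n.+1 + a)%N]addSn; have -> : ((2 * a).+1 + (2 * n).+1 = 2 * (n + a).+1)%N by lia.
by rewrite -!mulnA -H.
Qed.
End BinomialTransform.

(** * Lattice points of a dilated simplex *)

Fixpoint simplex (n k : nat) : seq (seq nat) :=
  if n is n'.+1 then [seq j :: t | j <- index_iota 0 k.+1, t <- simplex n' (k - j)]
  else [:: [::]].

Lemma simplexS n k :
  simplex n.+1 k = [seq j :: t | j <- index_iota 0 k.+1, t <- simplex n (k - j)].
Proof. by []. Qed.

Lemma mem_simplex n k t : (t \in simplex n k) = (size t == n) && (sumn t <= k)%N.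
Proof.
elim: n k t => [|n IH] k t; first by case: t => [|x t]; rewrite inE.
rewrite simplexS; apply/allpairsPdep/idP => [[j [u [jk uk ->]]]|].
  move: jk uk; rewrite mem_index_iota IH /= => jk /andP[/eqP -> sk]; rewrite eqxx /=; lia.
case: t => [|j u] //= /andP[sz sm]; exists j, u; rewrite mem_index_iota IH.
split=> //; first by lia.
by rewrite -eqSS sz /=; lia.
Qed.

Lemma simplex_uniq n k : uniq (simplex n k).
Proof.
elim: n k => [|n IH] k //; rewrite simplexS.
apply: allpairs_uniq_dep => [|j _|]; [exact: iota_uniq|exact: IH|].
by move=> [j u] [j' u'] _ _ /= [-> ->].
Qed.

Lemma sum_bin n k : (\sum_(0 <= j < k.+1) 'C(n + (k - j), n) = 'C(n.+1 + k, n.+1))%N.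
Proof.
elim: k => [|k IH]; first by rewrite big_nat1 subn0 !addn0 !binn.
rewrite big_nat_recl // subn0 -[(n.+1 + k.+1)%N]/((n + k.+1).+1) binS addnC.
by congr (_ + _)%N; rewrite -addSnnS -IH; apply: eq_bigr => i _; rewrite subSS.
Qed.

Lemma size_simplex n k : size (simplex n k) = 'C(n + k, n).
Proof.
elim: n k => [|n IH] k; first by rewrite bin0.
rewrite simplexS size_allpairs_dep sumnE big_map -sum_bin.
by apply: eq_bigr => j _; apply: IH.
Qed.

Lemma hockey_stick k c : (\sum_(0 <= j < k) 'C(k - j.+1, c) = 'C(k, c.+1))%N.
Proof.
elim: k => [|k IH]; first by rewrite big_geq.
rewrite big_nat_recl // binS addnC -IH subSS subn0.
by congr (_ + _)%N; apply: eq_bigr => i _; rewrite subSS.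
Qed.

(** Points with a prescribed support of size c correspond, through their partial sums, to the
    c-subsets of {1, ..., k}. *)
Lemma sum_simplex n k (H : bitseq -> nat) :
  (\sum_(t <- simplex n k) H [seq x == 0 | x <- t] =
   \sum_(m <- masks n) 'C(k, count negb m) * H m)%N.
Proof.
elim: n k H => [|n IH] k H; first by rewrite !big_seq1 bin0 mul1n.
rewrite simplexS big_allpairs_dep big_nat_recl //.
transitivity (\sum_(m <- masks n) 'C(k, count negb m) * H (true :: m) +
   \sum_(m <- masks n) 'C(k, (count negb m).+1) * H (false :: m))%N.
  congr (_ + _)%N; first by rewrite subn0; exact: (IH k (fun m => H (true :: m))).
  transitivity (\sum_(0 <= j < k) \sum_(m <- masks n) 'C(k - j.+1, count negb m) * H (false :: m))%N.
    by apply: eq_bigr => j _; exact: (IH (k - j.+1)%N (fun m => H (false :: m))).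
  by rewrite exchange_big; apply: eq_bigr => m _; rewrite -big_distrl hockey_stick.
rewrite -[masks n.+1]/([seq false :: x | x <- masks n] ++ [seq true :: x | x <- masks n]).
by rewrite big_cat !big_map addnC.
Qed.

Lemma size_mem_masks n m : m \in masks n -> size m = n.
Proof.
elim: n m => [|n IH] m; first by rewrite inE => /eqP ->.
by rewrite mem_cat => /orP[] /mapP[x /IH sz ->] /=; rewrite sz.
Qed.

(** A vector with r nonzero coordinates has a zero set of size n - r, which is why the metamatrix
    appears with reversed indices. *)
Lemma sum_masks_bin n k (H : {set 'I_n} -> nat) :
  (\sum_(m <- masks n) 'C(k, count negb m) * H (bset n m) =
   \sum_(0 <= r < n.+1) 'C(k, r) * \sum_(J : {set 'I_n} | #|J| == n - r) H J)%N.
Proof.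
transitivity (\sum_(0 <= r < n.+1) \sum_(m <- masks n)
    if count id m == n - r then 'C(k, r) * H (bset n m) else 0)%N; last first.
  apply: eq_bigr => r _; rewrite -(@sum_masks n H (fun c => c == n - r)%N).
  by rewrite -big_mkcond big_distrr.
rewrite exchange_big [LHS]big_seq [RHS]big_seq; apply: eq_bigr => m /size_mem_masks sz.
have cE : (count id m + count negb m = n)%N.
  by rewrite -sz; elim: (m) => //= b m' <-; case: b => /=; lia.
have mi : count negb m \in index_iota 0 n.+1 by rewrite mem_index_iota; lia.
have ui : uniq (index_iota 0 n.+1) := iota_uniq _ _.
rewrite (bigD1_seq _ mi ui) /=.
rewrite ifT; last by apply/eqP; lia.
rewrite big1_seq ?addn0 // => r /andP[rc]; rewrite mem_index_iota => rn.
by rewrite ifF //; apply/eqP; move/eqP: rc; lia.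
Qed.

Lemma sum_simplex2 (W : finGroupType) n (s : 'I_n -> W) k l :
  (\sum_(t <- simplex n k) \sum_(u <- simplex n l)
     ndc s setT (bset n [seq x == 0 | x <- t]) (bset n [seq x == 0 | x <- u]) =
   \sum_(0 <= r < n.+1) \sum_(0 <= t < n.+1) 'C(k, r) * 'C(l, t) * meta_entry s (n - r) (n - t))%N.
Proof.
pose G (I : {set 'I_n}) := (\sum_(0 <= t < n.+1) 'C(l, t) * face_count s I (n - t))%N.
transitivity (\sum_(t <- simplex n k) G (bset n [seq x == 0 | x <- t]))%N.
  apply: eq_bigr => t _.
  refine (etrans (sum_simplex n l (fun m => ndc s setT (bset n [seq x == 0 | x <- t]) (bset n m))) _)%N.
  exact: sum_masks_bin.
refine (etrans (sum_simplex n k (fun m => G (bset n m))) _).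
refine (etrans (sum_masks_bin k G) _).
apply: eq_bigr => r _; rewrite /G exchange_big big_distrr; apply: eq_bigr => t _.
by rewrite /= -big_distrr /= mulnA.
Qed.

(** * Balanced digits of dominant vectors *)

Lemma balanced_le (k : nat) (a b a' b' : Z) :
  (2 * k).+1%:R * a + b <= (2 * k).+1%:R * a' + b' ->
  - k%:R <= b <= k%:R -> - k%:R <= b' <= k%:R -> a <= a'.
Proof.
move=> e hb hb'; rewrite leNgt; apply/negP=> lt.
have : 0 <= (2 * k).+1%:R * (a - a' - 1) by apply: mulr_ge0; lia.
by rewrite !mulrBr mulr1; lia.
Qed.

(** The shift by k turns the floor into rounding to the nearest integer, with remainders from -k to
    k. *)
Definition digit (k : nat) (e : Z) : Z := Z.div (e + k%:R) (2 * k).+1%:R.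

Lemma digitP k e : - k%:R <= e - (2 * k).+1%:R * digit k e <= k%:R.
Proof.
have K0 : Z.lt 0 (2 * k).+1%:R by lia.
have h1 := Z.mul_div_le (e + k%:R) _ K0.
have h2 := Z.mul_succ_div_gt (e + k%:R) _ K0.
by move: h1 h2; rewrite -/(digit k e); move: (digit k e) => q; lia.
Qed.

Lemma digit0 k : digit k 0%R = 0.
Proof. by rewrite /digit; apply: Z.div_small; lia. Qed.

Section DominantVectors.
Variable n : nat.
Implicit Types u v y : 'rV[Z]_n.

Definition lv (t : seq nat) : 'rV[Z]_n := \row_i (nth 0%N t i)%:R.

Lemma lv_dom t : dominant id setT (lv t).
Proof. by apply/dominantP=> i _; rewrite mxE ler0n. Qed.

Lemma lv_zero t : size t = n -> zero_set id setT (lv t) = bset n [seq x == 0 | x <- t]%N.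
Proof.
move=> sz; apply/setP=> i; rewrite /bset [RHS]inE (nth_map 0%N) ?sz //.
apply/zero_setP/eqP => [[_ /(_ i erefl)]|ti].
  by rewrite mxE => /eqP; rewrite pnatr_eq0 => /eqP.
by split; rewrite ?inE // => a /= ai; rewrite mxE ai ti.
Qed.

Lemma lv_inj t t' : size t = n -> size t' = n -> lv t = lv t' -> t = t'.
Proof.
move=> sz sz' e; apply: (@eq_from_nth _ 0%N) => [|i]; rewrite sz ?sz' // => ii.
have /rowP/(_ (Ordinal ii)) := e.
by rewrite !mxE => /eqP; rewrite eqr_nat => /eqP.
Qed.

Lemma coord_ge0 v j : dominant id setT v -> 0 <= simple_coord v j.
Proof.
by move/dominantP=> dv; rewrite /simple_coord; case: insub => [i|] //; apply: dv; rewrite inE.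
Qed.

Lemma eucl_mono v l : dominant id setT v -> (l <= n)%N -> 0 <= eucl v l <= eucl v 0.
Proof.
move=> dv ln.
have -> : eucl v 0 = \sum_(0 <= j < l) simple_coord v j + eucl v l.
  by rewrite /eucl (big_cat_nat (n := l)).
apply/andP; split; last by rewrite lerDr sumr_ge0 // => j _; apply: coord_ge0.
by rewrite /eucl sumr_ge0 // => j _; apply: coord_ge0.
Qed.

Lemma eucl_lv t : size t = n -> eucl (lv t) 0 = (sumn t)%:R.
Proof.
move=> sz; rewrite sumnE (big_nth 0%N) sz natr_sum /eucl.
by apply: eq_big_nat => j /andP[_ jn]; rewrite (coordE _ jn) mxE.
Qed.

Lemma eucl_row (f : nat -> Z) l : (l <= n)%N ->
  eucl (\row_(i < n) (f i - f i.+1)) l = f l - f n.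
Proof.
move=> ln; rewrite /eucl -[RHS]opprB -(telescope_sumr f ln) -sumrN.
rewrite big_nat_cond [RHS]big_nat_cond.
by apply: eq_bigr => j /andP[/andP[_ jn] _]; rewrite (coordE _ jn) mxE opprB.
Qed.

Lemma mem_lv v a : (v \in [seq lv t | t <- simplex n a]) =
  dominant id setT v && (eucl v 0 <= a%:R).
Proof.
apply/mapP/andP => [[t]|[dv va]].
  rewrite mem_simplex => /andP[/eqP sz st] ->; split; first exact: lv_dom.
  by rewrite eucl_lv // ler_nat.
pose t := mkseq (fun j => Z.to_nat (simple_coord v j)) n.
have sz : size t = n by rewrite size_mkseq.
have vE : v = lv t.
  apply/rowP=> i; rewrite mxE nth_mkseq // coord_ord.
  have z0 : 0 <= v 0 i by move/dominantP: dv; apply; rewrite inE.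
  by move: (v 0 i) z0 => z; clear; lia.
exists t => //; rewrite mem_simplex sz eqxx /=.
by move: va; rewrite vE eucl_lv // ler_nat.
Qed.

Lemma box_dom k v : dominant id setT v -> eucl v 0 <= k%:R -> box k v.
Proof.
move=> dv vk l ln; case/andP: (eucl_mono dv (ltnW ln)) => h1 h2; apply/andP; split.
  by apply: le_trans h1; rewrite oppr_le0 ler0n.
exact: le_trans h2 vk.
Qed.

Lemma box0 k v : box k v -> eucl v 0 <= k%:R.
Proof.
move=> bv; have [n0|n0] := posnP n; last by case/andP: (bv 0%N n0).
have -> : eucl v 0 = 0 by apply: eucl_n; rewrite n0.
exact: ler0n.
Qed.

Lemma row_lin (c : Z) u y i : (c *: u + y) 0 i = c * u 0 i + y 0 i.
Proof. by rewrite !mxE. Qed.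

(** Where u vanishes, dominance is assumed of y. Elsewhere (2k + 1) u_i is at least 2k + 1, while
    y_i >= -2k as a difference of two box coordinates. *)
Lemma box_sum_dom k u y : dominant id setT u -> box k y ->
  dominant id (zero_set id setT u) y -> dominant id setT ((2 * k).+1%:R *: u + y).
Proof.
move=> /dominantP du yk /dominantP dy; apply/dominantP=> i _; rewrite row_lin.
have u0 : 0 <= u 0 i by apply: du; rewrite inE.
have [ui|ui] := eqVneq (u 0 i) 0.
  rewrite ui mulr0 add0r; apply: dy; apply/zero_setP.
  by split; rewrite ?inE // => a /= ->.
have y2 : - (2 * k)%:R <= y 0 i.
  rewrite (eucl_step y i); have b1 := yk i (ltn_ord i).
  have [i1|i1] := ltnP i.+1 n.
    by have b2 := yk _ i1; move: b1 b2; move: (eucl y i) (eucl y i.+1) => p q; clear; lia.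
  rewrite [eucl y i.+1]eucl_n // subr0.
  by move: b1; move: (eucl y i) => p; clear; lia.
have u1 : 1 <= u 0 i by move: u0 ui; move: (u 0 i) => z z0 /eqP; clear -z0; lia.
have : 0 <= (2 * k).+1%:R * (u 0 i - 1) by rewrite mulr_ge0 ?ler0n // subr_ge0.
by rewrite mulrBr mulr1; move: (u 0 i) (y 0 i) y2 => p q; clear; lia.
Qed.

Lemma balanced_bound k l u y : eucl u 0 <= l%:R -> box k y ->
  eucl ((2 * k).+1%:R *: u + y) 0 <= ((2 * k).+1 * l + k)%N%:R.
Proof.
move=> ul /box0 yk; rewrite eucl_lin natrD natrM lerD // ler_wpM2l // ler0n.
Qed.

Lemma balanced_inj k u y u' y' : box k y -> box k y' ->
  (2 * k).+1%:R *: u + y = (2 * k).+1%:R *: u' + y' -> u = u' /\ y = y'.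
Proof.
move=> b b' e.
have eE j : (2 * k).+1%:R * eucl u j + eucl y j = (2 * k).+1%:R * eucl u' j + eucl y' j.
  by rewrite -!eucl_lin e.
have eu j : eucl u j = eucl u' j.
  have [jn|jn] := ltnP j n; last by rewrite !eucl_n.
  apply/eqP; rewrite eq_le; apply/andP; split.
    by apply: (balanced_le _ (b j jn) (b' j jn)); rewrite eE.
  by apply: (balanced_le _ (b' j jn) (b j jn)); rewrite eE.
have uu : u = u' by apply/rowP=> i; rewrite (eucl_step u) (eucl_step u') !eu.
by split=> //; apply: (addrI ((2 * k).+1%:R *: u)); rewrite {2}uu.
Qed.

(** Each Euclidean coordinate is rounded separately. Rounding is monotone and sends 0 to 0, so the
    leading digits are again decreasing and nonnegative, that is, u is dominant. *)
Lemma balanced_split k l v : dominant id setT v -> eucl v 0 <= ((2 * k).+1 * l + k)%N%:R ->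
  exists u y, [/\ dominant id setT u, eucl u 0 <= l%:R, box k y,
    dominant id (zero_set id setT u) y & v = (2 * k).+1%:R *: u + y].
Proof.
move=> dv va; pose q j := digit k (eucl v j).
have qP j : - k%:R <= eucl v j - (2 * k).+1%:R * q j <= k%:R := digitP k (eucl v j).
have cE (A B : Z) : A + (B - A) = B by ring.
have qn : q n = 0 by rewrite /q eucl_n // digit0.
have qmono j : (j < n)%N -> q j.+1 <= q j.
  move=> jn; apply: (balanced_le _ (qP j.+1) (qP j)); rewrite !cE.
  rewrite -subr_ge0 -(eucl_step v (Ordinal jn)).
  by move/dominantP: dv; apply; rewrite inE.
have du : dominant id setT (\row_(i < n) (q i - q i.+1)).
  by apply/dominantP=> i _; rewrite mxE subr_ge0 qmono.
have Eu j : (j <= n)%N -> eucl (\row_(i < n) (q i - q i.+1)) j = q j.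
  by move=> jn; rewrite eucl_row // qn subr0.
move: (\row_(i < n) (q i - q i.+1)) du Eu => u du Eu.
have [y yv] : exists y, v = (2 * k).+1%:R *: u + y.
  by exists (v - (2 * k).+1%:R *: u); rewrite addrC subrK.
exists u, y; split=> //.
- rewrite Eu //; apply: (@balanced_le k _ (eucl v 0 - (2 * k).+1%:R * q 0%N)%R _ k%:R%R).
  - by rewrite cE; move: va; rewrite natrD natrM.
  - exact: qP.
  by clear; lia.
- move=> j jn; have ev := eucl_lin (2 * k).+1%:R u y j; rewrite -yv (Eu _ (ltnW jn)) in ev.
  have := qP j; rewrite ev.
  by have -> (A B : Z) : A + B - A = B by ring.
apply/dominantP=> i iz; case/zero_setP: iz => _ /(_ i erefl) ui.
have : 0 <= v 0 i by move/dominantP: dv; apply; rewrite inE.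
by rewrite yv row_lin ui mulr0 add0r.
Qed.
End DominantVectors.

(** * The double count in type B, and the theorem *)

Section CountB.
Variables (W : finGroupType) (n : nat) (s : 'I_n -> W) (rho : W -> 'M[Z]_n).
Hypotheses (rr : reflection_rep s id rho) (rhoB : forall i, rho (s i) = cartan_mx (@cartanB n) i).
Local Notation zs t := (bset n [seq x == 0 | x <- t]%N).
Local Notation lv := (lv n).

Lemma rcosets_repr (H : {group W}) (A c : {set W}) : c \in rcosets H A -> c = (H :* repr c)%g.
Proof. by case/rcosetsP=> x _ ->; rewrite rcoset_repr. Qed.

(** An orbit vector determines its dominant representative, and then its coset modulo the
    stabiliser. *)
Lemma act_rcoset_inj t t' c c' : size t = n -> size t' = n ->
  c \in rcosets (par s (zs t)) [set: W] -> c' \in rcosets (par s (zs t')) [set: W] ->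
  lv t *m rho (repr c) = lv t' *m rho (repr c') -> t = t' /\ c = c'.
Proof.
move=> sz sz' /rcosets_repr cE /rcosets_repr cE' e.
have e2 : lv t *m rho (repr c * (repr c')^-1)%g = lv t'.
  by rewrite (rr_mul rr) mulmxA e -mulmxA -(rr_mul rr) mulgV (rr_one rr) mulmx1.
have xT : (repr c * (repr c')^-1)%g \in par s setT by rewrite (par_setT rr) inE.
have dx : dominant id setT (lv t *m rho (repr c * (repr c')^-1)%g) by rewrite e2 lv_dom.
have [h1 h2] := dominant_unique rr xT (lv_dom n t) dx.
have tE : t = t' by apply: (lv_inj sz sz'); rewrite -e2.
split=> //; rewrite (lv_zero sz) in h2.
rewrite cE cE' -tE; apply/rcoset_eqP; by rewrite mem_rcoset.
Qed.

Lemma act_rcoset t y x : size t = n -> y *m rho x = lv t ->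
  lv t *m rho (repr (par s (zs t) :* x^-1)%g) = y.
Proof.
move=> sz yx; have := mem_repr_rcoset (par s (zs t)) (x^-1)%g.
move: (repr _) => r; rewrite mem_rcoset invgK -(lv_zero sz) => h.
have -> : r = (r * x * x^-1)%g by rewrite mulgK.
rewrite (rr_mul rr) mulmxA (fix_zeros rr h) -yx.
by rewrite -mulmxA -(rr_mul rr) mulgV (rr_one rr) mulmx1.
Qed.

(* A dominant vector with Euclidean coordinates at most (2k+1)l + k splits
   uniquely into balanced base-(2k+1) digits as (2k+1)u + y, where u is dominant and y is in
   the W-orbit of a dominant vector t; the pairs (u, y) with zero sets of u and
   t prescribed are counted by double cosets. *)
Lemma sum_ndc_simplex k l :
  (\sum_(t <- simplex n k) \sum_(u <- simplex n l) ndc s setT (zs t) (zs u) =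
   'C(n + ((2 * k).+1 * l + k), n))%N.
Proof.
pose a := ((2 * k).+1 * l + k)%N.
pose D (p : seq nat * seq nat) := [set c in rcosets (par s (zs p.1)) [set: W] |
   dominant id (zs p.2) (lv p.1 *m rho (repr c))].
pose phi (x : (seq nat * seq nat) * {set W}) : 'rV[Z]_n :=
  (2 * k).+1%:R *: lv x.1.2 + lv x.1.1 *m rho (repr x.2).
pose L1 := [seq (t, u) | t <- simplex n k, u <- simplex n l].
pose L := [seq (p, c) | p <- L1, c <- enum (D p)].
have LP x : x \in L -> [/\ x.1.1 \in simplex n k, x.1.2 \in simplex n l & x.2 \in D x.1].
  case/allpairsPdep=> p [c [/allpairsP[[t u] [/= tk ul ->]] cD ->]] /=.
  by rewrite mem_enum in cD; split.
have Lmem t u c : t \in simplex n k -> u \in simplex n l -> c \in D (t, u) -> ((t, u), c) \in L.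
  move=> tk ul cD; apply/allpairsPdep; exists (t, u), c; split; rewrite ?mem_enum //.
  by apply/allpairsP; exists (t, u).
have uL : uniq L.
  apply: allpairs_uniq_dep => [|p _|]; last by move=> [p c] [p' c'] _ _ /= [-> ->].
    by apply: allpairs_uniq; rewrite ?simplex_uniq // => -[x y] [x' y'] _ _ /= [-> ->].
  exact: enum_uniq.
have Lsz : (\sum_(t <- simplex n k) \sum_(u <- simplex n l) ndc s setT (zs t) (zs u) = size L)%N.
  rewrite size_allpairs_dep sumnE big_map big_allpairs_dep big_seq [RHS]big_seq.
  apply: eq_bigr => t; rewrite mem_simplex => /andP[/eqP sz _].
  apply: eq_bigr => u _; rewrite -cardE.
  by apply: (ndc_dominant rr); [exact: lv_dom|exact: lv_zero].
have Lbox x : x \in L -> box k (lv x.1.1 *m rho (repr x.2)).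
  case/LP; rewrite mem_simplex => /andP[/eqP sz tk] _ _.
  apply: (box_act rr rhoB); apply: box_dom; first exact: lv_dom.
  by rewrite eucl_lv // ler_nat.
have phi_inj : {in L &, injective phi}.
  move=> x x' xL xL' e; have [uu yy] := balanced_inj (Lbox x xL) (Lbox x' xL') e.
  move: (LP x xL) (LP x' xL') uu yy; clear e xL xL'.
  case: x => [[t u] c]; case: x' => [[t' u'] c']; rewrite /D /= !mem_simplex.
  move=> [/andP[/eqP szt _] /andP[/eqP szu _] /setIdP[cH _]].
  move=> [/andP[/eqP szt' _] /andP[/eqP szu' _] /setIdP[cH' _]] uu yy.
  have [-> ->] := act_rcoset_inj szt szt' cH cH' yy.
  by rewrite (lv_inj szu szu' uu).
have memE : map phi L =i map lv (simplex n a).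
  move=> v; rewrite mem_lv; apply/mapP/andP => [[x xL ->]|[dv va]].
    have bx := Lbox x xL; case: (LP x xL); rewrite !mem_simplex.
    move=> /andP[/eqP szt tk] /andP[/eqP szu ul]; rewrite /D => /setIdP[_ dx].
    rewrite /phi /a; split; last by apply: balanced_bound => //; rewrite eucl_lv // ler_nat.
    by apply: box_sum_dom; [exact: lv_dom|exact: bx|rewrite lv_zero].
  have [u [y [du ul by_ dy vE]]] := balanced_split dv va.
  have : u \in map lv (simplex n l) by rewrite mem_lv du ul.
  case/mapP=> u' uS uE; have [x dx] := dominant_rep rr rhoB y.
  have : y *m rho x \in map lv (simplex n k).
    by rewrite mem_lv dx box0 //; apply: (box_act rr rhoB).
  case/mapP=> t tS tE.
  have szt : size t = n by move: tS; rewrite mem_simplex => /andP[/eqP].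
  have szu : size u' = n by move: uS; rewrite mem_simplex => /andP[/eqP].
  exists ((t, u'), (par s (zs t) :* x^-1)%g); last first.
    by rewrite /phi /= (act_rcoset szt tE) -uE.
  apply: Lmem => //; rewrite /D; apply/setIdP; split=> /=.
    by apply/rcosetsP; exists (x^-1)%g; rewrite ?inE.
  by rewrite (act_rcoset szt tE) -(lv_zero szu) -uE.
have /perm_size : perm_eq (map phi L) (map lv (simplex n a)).
  apply: uniq_perm => //; first by rewrite map_inj_in_uniq.
  rewrite map_inj_in_uniq ?simplex_uniq // => t t'; rewrite !mem_simplex.
  by move=> /andP[/eqP sz _] /andP[/eqP sz' _]; apply: lv_inj.
by rewrite !size_map size_simplex Lsz => ->.
Qed.
End CountB.

Lemma tp_B (R : realFieldType) (W : finGroupType) (S : {set W}) n : (2 <= n)%N ->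
  coxeter_system S -> has_coxeter_matrix S (type_B n) ->
  totally_positive (contingency_metamatrix R S).
Proof.
move=> n2 hWS hS; have [s [s_inj sS [rho rr rhoB]]] := type_B_rep n2 hWS hS.
have gen : <<S>>%g = [set: W] by case: hWS.
have SE : #|S| = n by rewrite -sS card_imset // cardsT card_ord.
pose F (p q : nat) : R := (meta_entry s p q)%:R.
have H : @tp_upto R n.+1 (fun i j => F (n - i)%N (n - j)%N).
  refine (@eq_tp_upto R n.+1 (metaB n.+1 (ehrhartB R n)) _ _ _); last first.
    by apply: tp_metaB => j jn; apply: ehrhartB_gt0.
  move=> r t rn tn; symmetry.
  apply: (@bt_inj R n.+1 (fun r t => F (n - r)%N (n - t)%N)
    (metaB n.+1 (ehrhartB R n)) _ r t rn tn) => k l.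
  have E : (2 * k).+1%:R * (2 * l).+1%:R = (2 * ((2 * k).+1 * l + k)).+1%:R :> R.
    by rewrite -natrM; congr (_%:R); lia.
  rewrite bt_metaB E sum_ehrhartB -(sum_ndc_simplex rr rhoB k l) sum_simplex2 natr_sum /bt.
  apply: eq_bigr => i _; rewrite natr_sum; apply: eq_bigr => j _.
  by rewrite /F !natrM.
apply: (@tp_upto_mx R _ F) => [i j|]; first exact: (metamatrixE _ _ _ s_inj sS gen).
by rewrite SE; apply: tp_upto_rev; exact: H.
Qed.

Theorem theorem1p0p2 (R : realFieldType) (W : finGroupType) (S : {set W})
    (hWS : coxeter_system S)
    (htype : (exists2 n : nat, (2 <= n)%N & has_coxeter_matrix S (type_B n)) \/
             has_coxeter_matrix S type_E6 \/
             has_coxeter_matrix S type_E7 \/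
             has_coxeter_matrix S type_E8 \/
             has_coxeter_matrix S type_F4 \/
             has_coxeter_matrix S type_H3 \/
             has_coxeter_matrix S type_H4 \/
             (exists2 m : nat, (2 <= m)%N & has_coxeter_matrix S (type_I2 m))) :
  totally_positive (contingency_metamatrix R S).
Proof.
case: htype => [[n n2 h]|[h|[h|[h|[h|[h|[h|[m m2 h]]]]]]]].
- exact: tp_B n2 hWS h.
- exact: tp_E6 hWS h.
- exact: tp_E7 hWS h.
- exact: tp_E8 hWS h.
- exact: tp_F4 hWS h.
- exact: tp_H3 hWS h.
- exact: tp_H4 hWS h.
exact: tp_I2 m2 hWS h.
Qed.
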